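(* Let $k\geq 2$ and let $\chi_1,\chi_2$ be primitive non-trivial Dirichlet characters with conductors $q_1,q_2$ such that $\chi_1\chi_2(-1)=(-1)^k$. Then the function $\widehat S_{\chi_1,\chi_2,k}$, restricted to the set $(\Gamma_1(q_1q_2))(\infty)$ of cusps $\Gamma_1(q_1q_2)$-equivalent to $\infty$, is a weight $2-k$ quantum modular form on $\Gamma_1(q_1q_2)$; that is, for every $\gamma\in\Gamma_1(q_1q_2)$ the function $$\mathfrak a\mapsto \widehat S_{\chi_1,\chi_2,k}(\mathfrak a)-j(\gamma,\mathfrak a)^{k-2}\,\widehat S_{\chi_1,\chi_2,k}(\gamma\mathfrak a),\qquad \mathfrak a\in(\Gamma_1(q_1q_2))(\infty)\setminus\{\infty\},$$ is continuous with respect to the real topology.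
   Context: Notation: $e(z)=\exp(2\pi i z)$; $\tau(\chi)$ denotes the Gauss sum of $\chi$; $j(\gamma,z)=cz+d$ for $\gamma=\begin{pmatrix} a&b\\ c&d\end{pmatrix}$. The Eisenstein series is $E_{\chi_1,\chi_2,k}(z)=2\sum_{N\geq 1}\sum_{A\mid N}\chi_1(A)\overline{\chi_2}(N/A)(N/A)^{k-1}e(Nz)$ for $z$ in the upper half plane $\mathcal H$; it satisfies $E_{\chi_1,\chi_2,k}(\gamma z)=\chi_1\overline{\chi_2}(d)(cz+d)^kE_{\chi_1,\chi_2,k}(z)$ for $\gamma\in\Gamma_0(q_1q_2)$. Let $P_{k-2}(z;X,Y)=(Xz+Y)^{k-2}$. Let $(\Gamma_0(q_1q_2))(\infty)=\{\gamma\infty:\gamma\in\Gamma_0(q_1q_2)\}\subseteq\mathbb P^1(\mathbb Q)$. Define $\widehat S_{\chi_1,\chi_2,k}:(\Gamma_0(q_1q_2))(\infty)\to\mathbb C$ by $\widehat S_{\chi_1,\chi_2,k}(\infty)=0$ and, for $\mathfrak a\neq\infty$, $$\widehat S_{\chi_1,\chi_2,k}(\mathfrak a)=(-1)^k\tau(\overline{\chi_1})(k-1)\int_\infty^{\mathfrak a}E_{\chi_1,\chi_2,k}(z)P_{k-2}(z;1,-\mathfrak a)\,dz.$$ A function $f$ on the cusps $\Gamma(\infty)$ equivalent to $\infty$ under a group $\Gamma$ is a weight $\kappa\le 0$ quantum modular form on $\Gamma$ if for each $\gamma\in\Gamma$ the function $\mathfrak a\mapsto f(\mathfrak a)-j(\gamma,\mathfrak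 a)^{-\kappa}f(\gamma\mathfrak a)$ on $\Gamma(\infty)\setminus\{\infty\}$ is continuous in the real topology. *)

(* Defs.v *)
From Stdlib Require Import Reals ZArith.
From Coquelicot Require Import Coquelicot.

Local Open Scope R_scope.

Definition cexp (z : C) : C :=
  (exp (Re z) * cos (Im z), exp (Re z) * sin (Im z)).

Definition e (z : C) : C := cexp (Cmult (RtoC (2 * PI)) (Cmult Ci z)).

Definition csum (a : nat -> C) : C :=
  @iota C_R_CompleteNormedModule
        (fun l : C => @is_series R_AbsRing C_R_NormedModule a l).

Definition is_dirichlet_char (q : Z) (chi : Z -> C) : Prop :=
  (0 < q)%Z /\
  (forall n : Z, chi (n + q)%Z = chi n) /\
  (forall m n : Z, chi (m * n)%Z = Cmult (chi m) (chi n)) /\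
  chi 1%Z = RtoC 1 /\
  (forall n : Z, chi n = RtoC 0 <-> Z.gcd n q <> 1%Z).

(* chi is a primitive Dirichlet character modulo q, i.e. has conductor q:
   it is not induced by a character of any proper divisor d of q, i.e. for
   every divisor d < q of q there is n coprime to q, n = 1 mod d, chi n <> 1. *)
Definition is_primitive_char (q : Z) (chi : Z -> C) : Prop :=
  is_dirichlet_char q chi /\
  (forall d : Z, (0 < d)%Z -> (d < q)%Z -> Z.divide d q ->
     exists n : Z, Z.gcd n q = 1%Z /\ Z.modulo n d = Z.modulo 1 d /\
                   chi n <> RtoC 1).

Definition nontrivial_char (q : Z) (chi : Z -> C) : Prop :=
  exists n : Z, Z.gcd n q = 1%Z /\ chi n <> RtoC 1.

Definition gauss_sum (q : Z) (chi : Z -> C) : C :=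
  sum_n (fun a : nat => Cmult (chi (Z.of_nat a)) (e (RtoC (INR a / IZR q))))
        (Z.to_nat q - 1).

Definition eis_coeff (chi1 chi2 : Z -> C) (k N : nat) : C :=
  sum_n (fun i : nat =>
           let A := S i in
           if Nat.eqb (N mod A) 0 then
             Cmult (Cmult (chi1 (Z.of_nat A)) (Cconj (chi2 (Z.of_nat (N / A)))))
                   (RtoC (INR (N / A) ^ (k - 1)))
           else RtoC 0)
        (N - 1).

Definition eisenstein (chi1 chi2 : Z -> C) (k : nat) (z : C) : C :=
  Cmult (RtoC 2)
    (csum (fun n : nat => Cmult (eis_coeff chi1 chi2 k (S n))
                                (e (Cmult (RtoC (INR (S n))) z)))).

(* int_{infinity}^{a} f(z) dz, taken along the vertical ray z = a + i t,
   t running from +infinity down to 0 (dz = i dt):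
     = - i * int_0^{infinity} f(a + i t) dt                          *)
Definition int_from_infty (f : C -> C) (a : R) : C :=
  Copp (Cmult Ci
    (@RInt_gen C_R_CompleteNormedModule
       (fun t : R => f (Cplus (RtoC a) (Cmult Ci (RtoC t))))
       (at_right 0) (Rbar_locally p_infty))).

(* points of P^1(R): None = infinity, Some x = x *)
Definition cusp := option R.

Definition Ppoly (k : nat) (z X Y : C) : C :=
  pow_n (Cplus (Cmult X z) Y) (k - 2).

Definition Shat (q1 : Z) (chi1 chi2 : Z -> C) (k : nat) (c : cusp) : C :=
  match c with
  | None => RtoC 0
  | Some a =>
      Cmult (Cmult (pow_n (RtoC (-1)) k)
                   (gauss_sum q1 (fun n => Cconj (chi1 n))))
            (Cmult (RtoC (INR (k - 1)))
                   (int_from_infty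
                      (fun z => Cmult (eisenstein chi1 chi2 k z)
                                      (Ppoly k z (RtoC 1) (RtoC (- a)))) a))
  end.

Definition in_Gamma1 (N a b c d : Z) : Prop :=
  (a * d - b * c = 1)%Z /\ Z.divide N c /\
  Z.modulo a N = Z.modulo 1 N /\ Z.modulo d N = Z.modulo 1 N.

Definition moebius (a b c d : Z) (x : cusp) : cusp :=
  match x with
  | None => if Z.eqb c 0 then None else Some (IZR a / IZR c)
  | Some y =>
      if Req_EM_T (IZR c * y + IZR d) 0 then None
      else Some ((IZR a * y + IZR b) / (IZR c * y + IZR d))
  end.

Definition finite_cusp_Gamma1 (N : Z) (x : R) : Prop :=
  exists a b c d : Z, in_Gamma1 N a b c d /\
                      moebius a b c d None = Some x.

(* Main.v *)
(** The Eichler integral of the Eisenstein series [E] is a polynomial cocycle.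
    Writing [E] as a sum of [chi1(A) g(n) / (A z + n / q2)^k] over the lattice, with
    [g] the discrete Fourier transform of the conjugate of [chi2], shows that [E] has
    weight [k] for [Gamma1 (q1 q2)]: an element of the group only permutes the lattice
    and preserves the residues of [A] modulo [q1] and of [n] modulo [q2].

    Let [I(z; X, Y)] be the primitive of [E(z) (X z + Y)^(k-2)] vanishing at [i oo];
    it is homogeneous of degree [k - 2] in [(X, Y)].  By modularity
    [K_g(X, Y) = I(g w; X, Y) - I(w; (X, Y) g)] does not depend on [w], and
    [K_(g s)(X, Y) = K_g(X, Y) + K_s((X, Y) g)].  If [x = s oo], letting [w] tend to
    [i oo] in the definition of [K_s(1, - x)] gives the integral of
    [E(z) (z - x)^(k-2)] from [oo] to [x], so [Shat x] is a constant multiple of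
    [K_s(1, - x)].  The cocycle relation then turns
    [Shat x - (c x + d)^(k-2) Shat (g x)] into a constant multiple of
    [K_g(c x + d, - (a x + b))], which is a polynomial in [x]. *)

Require Import Defs.
From Stdlib Require Import Reals ZArith Lra Lia List Permutation Classical.
From Coquelicot Require Import Coquelicot.

Local Open Scope R_scope.

(** * Unordered sums *)

(** The weight [k = 2] shapes the lattice argument: there the terms decay too slowly for absolute
    convergence, so they may not be rearranged one by one. Two zeros, [chi1 0 = 0] and the vanishing
    total of [g] (the conjugate of [chi2 0]), both due to conductors larger than 1, make the sum
    over a block of residues decay one power faster. Blocks are then handled, for all weights at
    once, as an unordered sum, stable under bijections and Fubini.

    Analysis in the half-plane is reduced to real-variable facts. As [E] has no constant term, its
    antiderivatives are again series in [e z], and [I] is an explicit finite expression, polynomial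
    in [(X, Y)]; independence of [w] holds because a function with zero derivative is constant on a
    convex set. The missing constant term also gives decay faster than any power at [i oo], which
    the cocycle carries to each cusp [s oo], so that the integrals converge at both ends. The
    Lipschitz formula, which ties the series to the lattice, comes from the duplication formula of
    [1 / sin^2], iterated dyadically, and then from repeated differentiation. *)

Definition lsum {I : Type} (f : I -> C) (l : list I) : C :=
  fold_right (fun i s => Cplus (f i) s) (RtoC 0) l.

Definition rsum {I : Type} (f : I -> R) (l : list I) : R :=
  fold_right (fun i s => f i + s) 0 l.

(** Net convergence over finite subsets, encoded as lists without repetition. It is unconditional,
    hence invariant under reindexing by a bijection and compatible with Fubini, unlike the limit of
    partial sums in a fixed order. *)
Definition has_sum {I : Type} (f : I -> C) (s : C) : Prop :=
  forall eps : R, 0 < eps -> exists l0 : list I, forall l : list I,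
    NoDup l -> incl l0 l -> Cmod (lsum f l - s) < eps.

Definition sum_bounded {I : Type} (f : I -> R) (K : R) : Prop :=
  forall l : list I, NoDup l -> rsum f l <= K.

Definition summable {I : Type} (f : I -> C) : Prop :=
  exists K : R, sum_bounded (fun i => Cmod (f i)) K.

Lemma lsum_app {I : Type} (f : I -> C) (l l' : list I) :
  lsum f (l ++ l') = (lsum f l + lsum f l')%C.
Proof.
  induction l as [|a l IH]; simpl; [ring | rewrite IH; ring].
Qed.

Lemma lsum_perm {I : Type} (f : I -> C) (l l' : list I) :
  Permutation l l' -> lsum f l = lsum f l'.
Proof.
  induction 1; simpl; [reflexivity | congruence | ring | congruence].
Qed.

Lemma lsum_ext {I : Type} (f g : I -> C) (l : list I) :
  (forall i, In i l -> f i = g i) -> lsum f l = lsum g l.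
Proof.
  induction l as [|a l IH]; simpl; intros H; [reflexivity|].
  rewrite (H a (or_introl eq_refl)), IH; auto.
Qed.

Lemma lsum_plus {I : Type} (f g : I -> C) (l : list I) :
  lsum (fun i => f i + g i)%C l = (lsum f l + lsum g l)%C.
Proof.
  induction l as [|a l IH]; simpl; [ring | rewrite IH; ring].
Qed.

Lemma lsum_scal {I : Type} (c : C) (f : I -> C) (l : list I) :
  lsum (fun i => c * f i)%C l = (c * lsum f l)%C.
Proof.
  induction l as [|a l IH]; simpl; [ring | rewrite IH; ring].
Qed.

Lemma lsum_zero {I : Type} (l : list I) : lsum (fun _ => RtoC 0) l = 0.
Proof.
  induction l as [|a l IH]; simpl; [reflexivity | rewrite IH; ring].
Qed.

Lemma lsum_map {I J : Type} (phi : I -> J) (f : J -> C) (l : list I) :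
  lsum f (map phi l) = lsum (fun i => f (phi i)) l.
Proof.
  induction l as [|a l IH]; simpl; [reflexivity | rewrite IH; reflexivity].
Qed.

Lemma lsum_swap {I J : Type} (f : I -> J -> C) (l : list I) (l' : list J) :
  lsum (fun i => lsum (f i) l') l = lsum (fun j => lsum (fun i => f i j) l) l'.
Proof.
  induction l as [|a l IH]; simpl.
  - now rewrite lsum_zero.
  - now rewrite IH, lsum_plus.
Qed.

Lemma lsum_RtoC {I : Type} (f : I -> R) (l : list I) :
  lsum (fun i => RtoC (f i)) l = RtoC (rsum f l).
Proof.
  induction l as [|a l IH]; simpl; [reflexivity | now rewrite IH, RtoC_plus].
Qed.

Lemma Cmod_lsum {I : Type} (f : I -> C) (l : list I) :
  Cmod (lsum f l) <= rsum (fun i => Cmod (f i)) l.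
Proof.
  induction l as [|a l IH]; simpl; [rewrite Cmod_0; lra|].
  eapply Rle_trans; [apply Cmod_triangle|]. lra.
Qed.

Lemma rsum_app {I : Type} (f : I -> R) (l l' : list I) :
  rsum f (l ++ l') = rsum f l + rsum f l'.
Proof.
  induction l as [|a l IH]; simpl; [ring | rewrite IH; ring].
Qed.

Lemma rsum_perm {I : Type} (f : I -> R) (l l' : list I) :
  Permutation l l' -> rsum f l = rsum f l'.
Proof.
  induction 1; simpl; [reflexivity | congruence | ring | congruence].
Qed.

Lemma rsum_le {I : Type} (f g : I -> R) (l : list I) :
  (forall i, In i l -> f i <= g i) -> rsum f l <= rsum g l.
Proof.
  induction l as [|a l IH]; simpl; intros H; [lra|].
  apply Rplus_le_compat; auto.
Qed.

Lemma rsum_plus {I : Type} (f g : I -> R) (l : list I) :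
  rsum (fun i => f i + g i) l = rsum f l + rsum g l.
Proof.
  induction l as [|a l IH]; simpl; [ring | rewrite IH; ring].
Qed.

Lemma rsum_scal {I : Type} (c : R) (f : I -> R) (l : list I) :
  rsum (fun i => c * f i) l = c * rsum f l.
Proof.
  induction l as [|a l IH]; simpl; [ring | rewrite IH; ring].
Qed.

Lemma rsum_const {I : Type} (c : R) (l : list I) :
  rsum (fun _ => c) l = INR (length l) * c.
Proof.
  induction l as [|a l IH]; [simpl; ring|].
  change (length (a :: l)) with (S (length l)).
  rewrite S_INR. simpl. rewrite IH. ring.
Qed.

Lemma rsum_nonneg {I : Type} (f : I -> R) (l : list I) :
  (forall i, 0 <= f i) -> 0 <= rsum f l.
Proof.
  intros H. induction l as [|a l IH]; simpl; [lra|]. specialize (H a). lra.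
Qed.

Lemma rsum_map {I J : Type} (phi : I -> J) (f : J -> R) (l : list I) :
  rsum f (map phi l) = rsum (fun i => f (phi i)) l.
Proof.
  induction l as [|a l IH]; simpl; [reflexivity | rewrite IH; reflexivity].
Qed.

(** Excluded middle decides membership, so the index type stays arbitrary. *)
Lemma nodup_ex {I : Type} (l : list I) :
  exists l', NoDup l' /\ forall x, In x l' <-> In x l.
Proof.
  induction l as [|a l [l' [H1 H2]]].
  - exists nil. split; [constructor | tauto].
  - destruct (classic (In a l)) as [H|H].
    + exists l'. split; [assumption|]. intros x. rewrite H2. simpl.
      split; [tauto|]. intros [<-|]; assumption.
    + exists (a :: l'). split.
      * constructor; [rewrite H2|]; assumption.
      * intros x. simpl. rewrite H2. tauto.
Qed.

Lemma incl_split {I : Type} (l0 l : list I) :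
  NoDup l0 -> incl l0 l -> exists l1, Permutation l (l0 ++ l1).
Proof.
  revert l. induction l0 as [|a l0 IH]; intros l N H.
  - exists l. reflexivity.
  - inversion N; subst.
    destruct (in_split a l (H a (or_introl eq_refl))) as [u [v ->]].
    destruct (IH (u ++ v)) as [l1 Hl1]; [assumption| |].
    + intros x Hx. specialize (H x (or_intror Hx)).
      apply in_app_or in H. apply in_or_app.
      destruct H as [H|[H|H]]; auto. subst. contradiction.
    + exists l1. simpl. rewrite <- Hl1. symmetry. apply Permutation_middle.
Qed.

Lemma rsum_incl {I : Type} (f : I -> R) (l0 l : list I) :
  (forall i, 0 <= f i) -> NoDup l0 -> incl l0 l -> rsum f l0 <= rsum f l.
Proof.
  intros Hf N H. destruct (incl_split l0 l N H) as [l1 P].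
  rewrite (rsum_perm _ _ _ P), rsum_app.
  pose proof (rsum_nonneg f l1 Hf). lra.
Qed.

Lemma has_sum_unique {I : Type} (f : I -> C) (s s' : C) :
  has_sum f s -> has_sum f s' -> s = s'.
Proof.
  intros H H'. apply NNPP. intros Hn.
  assert (D : 0 < Cmod (s - s')).
  { apply Cmod_gt_0. intros E. apply Hn.
    replace s with ((s - s') + s')%C by ring. rewrite E. ring. }
  destruct (H (Cmod (s - s') / 2)) as [l0 H0]; [lra|].
  destruct (H' (Cmod (s - s') / 2)) as [l1 H1]; [lra|].
  destruct (nodup_ex (l0 ++ l1)) as [l [N Hl]].
  specialize (H0 l N). specialize (H1 l N).
  assert (incl l0 l) by (intros x Hx; apply Hl, in_or_app; auto).
  assert (incl l1 l) by (intros x Hx; apply Hl, in_or_app; auto).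
  specialize (H0 H2). specialize (H1 H3).
  assert (Cmod (s - s') <= Cmod (lsum f l - s') + Cmod (lsum f l - s)).
  { replace (s - s')%C with ((lsum f l - s') + - (lsum f l - s))%C by ring.
    eapply Rle_trans; [apply Cmod_triangle|]. rewrite Cmod_opp. lra. }
  lra.
Qed.

Lemma has_sum_ext {I : Type} (f g : I -> C) (s : C) :
  (forall i, f i = g i) -> has_sum f s -> has_sum g s.
Proof.
  intros E H eps He. destruct (H eps He) as [l0 H0]. exists l0.
  intros l N Hl. rewrite <- (lsum_ext f g); auto.
Qed.

Lemma has_sum_zero {I : Type} : has_sum (fun _ : I => RtoC 0) 0.
Proof.
  intros eps He. exists nil. intros l _ _. rewrite lsum_zero.
  replace (0 - 0)%C with (RtoC 0) by ring. now rewrite Cmod_0.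
Qed.

Lemma has_sum_plus {I : Type} (f g : I -> C) (s t : C) :
  has_sum f s -> has_sum g t -> has_sum (fun i => f i + g i)%C (s + t)%C.
Proof.
  intros H H' eps He.
  destruct (H (eps / 2)) as [l0 P0]; [lra|].
  destruct (H' (eps / 2)) as [l1 P1]; [lra|].
  exists (l0 ++ l1). intros l N Hl.
  apply incl_app_inv in Hl. destruct Hl as [Hl0 Hl1].
  specialize (P0 l N Hl0). specialize (P1 l N Hl1).
  rewrite lsum_plus.
  replace (lsum f l + lsum g l - (s + t))%C
    with ((lsum f l - s) + (lsum g l - t))%C by ring.
  eapply Rle_lt_trans; [apply Cmod_triangle|]. lra.
Qed.

Lemma has_sum_scal {I : Type} (c : C) (f : I -> C) (s : C) :
  has_sum f s -> has_sum (fun i => c * f i)%C (c * s)%C.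
Proof.
  intros H eps He.
  pose proof (Cmod_ge_0 c) as Hc.
  assert (He' : 0 < eps / (Cmod c + 1)) by (apply Rdiv_lt_0_compat; lra).
  destruct (H _ He') as [l0 H0].
  exists l0. intros l N Hl. specialize (H0 l N Hl).
  rewrite lsum_scal. replace (c * lsum f l - c * s)%C with (c * (lsum f l - s))%C by ring.
  rewrite Cmod_mult.
  apply Rle_lt_trans with (Cmod c * (eps / (Cmod c + 1))).
  - apply Rmult_le_compat_l; lra.
  - apply Rlt_le_trans with ((Cmod c + 1) * (eps / (Cmod c + 1))).
    + apply Rmult_lt_compat_r; lra.
    + right. field. lra.
Qed.

Lemma has_sum_minus {I : Type} (f g : I -> C) (s t : C) :
  has_sum f s -> has_sum g t -> has_sum (fun i => f i - g i)%C (s - t)%C.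
Proof.
  intros H H'.
  pose proof (has_sum_plus _ _ _ _ H (has_sum_scal (-1) _ _ H')) as K.
  replace (s - t)%C with (s + -1 * t)%C by ring.
  refine (has_sum_ext _ _ _ _ K). intros i. ring.
Qed.

Lemma has_sum_lsum {I J : Type} (f : J -> I -> C) (s : J -> C) (l : list J) :
  (forall j, In j l -> has_sum (f j) (s j)) ->
  has_sum (fun i => lsum (fun j => f j i) l) (lsum s l).
Proof.
  induction l as [|a l IH]; intros H; simpl.
  - apply has_sum_zero.
  - apply has_sum_plus; [apply H; left; reflexivity|].
    apply IH. intros j Hj. apply H. now right.
Qed.

Lemma has_sum_finite {I : Type} (f : I -> C) (l0 : list I) :
  NoDup l0 -> (forall i, ~ In i l0 -> f i = 0) -> has_sum f (lsum f l0).
Proof.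
  intros N0 H0 eps He. exists l0. intros l N Hl.
  destruct (incl_split l0 l N0 Hl) as [l1 P].
  rewrite (lsum_perm _ _ _ P), lsum_app.
  rewrite (lsum_ext f (fun _ => RtoC 0) l1), lsum_zero.
  - replace (lsum f l0 + 0 - lsum f l0)%C with (RtoC 0) by ring. now rewrite Cmod_0.
  - intros i Hi. apply H0. intros Hi'.
    apply (Permutation_NoDup P) in N.
    clear -N Hi Hi'. induction l0 as [|a l0 IH]; simpl in *; [contradiction|].
    inversion N; subst. destruct Hi' as [->|Hi']; auto.
    apply H1, in_or_app. now right.
Qed.

Lemma has_sum_bound {I : Type} (f : I -> C) (s : C) (K : R) :
  has_sum f s -> sum_bounded (fun i => Cmod (f i)) K -> Cmod s <= K.
Proof.
  intros H HK. apply le_epsilon. intros eps He.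
  destruct (H eps He) as [l0 H0].
  destruct (nodup_ex l0) as [l [N Hl]].
  specialize (H0 l N (fun x Hx => proj2 (Hl x) Hx)).
  replace s with (lsum f l - (lsum f l - s))%C by ring.
  eapply Rle_trans; [apply Cmod_triangle|]. rewrite Cmod_opp.
  pose proof (Cmod_lsum f l). specialize (HK l N). lra.
Qed.

Lemma has_sum_nonneg {I : Type} (g : I -> R) (K : R) :
  (forall i, 0 <= g i) -> sum_bounded g K ->
  exists s, has_sum (fun i => RtoC (g i)) s.
Proof.
  intros Hg HK.
  (* The sum is the supremum of the finite sums; a list that nearly reaches it serves as [l0]. *)
  destruct (completeness (fun x => exists l, NoDup l /\ x = rsum g l)) as [s [Hs1 Hs2]].
  - exists K. intros x [l [N ->]]. auto.
  - exists 0, nil. split; [constructor | reflexivity].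
  - exists (RtoC s). intros eps He.
    assert (exists l, NoDup l /\ s - eps < rsum g l) as [l0 [N0 H0]].
    { apply NNPP. intros Hn. assert (s <= s - eps); [|lra].
      apply Hs2. intros x [l [N ->]]. apply Rnot_lt_le. intros Hlt.
      apply Hn. exists l. auto. }
    exists l0. intros l N Hl. rewrite lsum_RtoC, <- RtoC_minus, Cmod_R.
    pose proof (rsum_incl g l0 l Hg N0 Hl).
    assert (rsum g l <= s) by (apply Hs1; exists l; auto).
    apply Rabs_def1; lra.
Qed.

Lemma sum_bounded_le {I : Type} (f g : I -> R) (K : R) :
  (forall i, f i <= g i) -> sum_bounded g K -> sum_bounded f K.
Proof.
  intros H HK l N. eapply Rle_trans; [apply rsum_le; intros; apply H|]. auto.
Qed.

Lemma Rabs_im_le_Cmod (c : C) : Rabs (Im c) <= Cmod c.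
Proof.
  eapply Rle_trans; [apply Rmax_r | apply Rmax_Cmod].
Qed.

(** Real and imaginary parts are split into positive and negative parts, each a bounded nonnegative
    family. *)
Lemma summable_has_sum {I : Type} (f : I -> C) :
  summable f -> exists s, has_sum f s.
Proof.
  intros [K HK].
  assert (P : forall g : I -> R, (forall i, Rabs (g i) <= Cmod (f i)) ->
            exists s, has_sum (fun i => RtoC (g i)) s).
  { intros g Hg.
    destruct (has_sum_nonneg (fun i => Rmax (g i) 0) K) as [s Hs].
    - intros i. apply Rmax_r.
    - apply sum_bounded_le with (2 := HK). intros i. specialize (Hg i).
      apply Rmax_lub; [eapply Rle_trans; [apply Rle_abs|] | apply Cmod_ge_0]; auto.
    - destruct (has_sum_nonneg (fun i => Rmax (- g i) 0) K) as [t Ht].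
      + intros i. apply Rmax_r.
      + apply sum_bounded_le with (2 := HK). intros i. specialize (Hg i).
        apply Rmax_lub; [|apply Cmod_ge_0].
        eapply Rle_trans; [apply Rle_abs|]. now rewrite Rabs_Ropp.
      + exists (s - t)%C. refine (has_sum_ext _ _ _ _ (has_sum_minus _ _ _ _ Hs Ht)).
        intros i. simpl. rewrite <- RtoC_minus. f_equal.
        unfold Rmax; destruct Rle_dec; destruct Rle_dec; lra. }
  destruct (P (fun i => Re (f i))) as [s Hs]; [intros; apply re_le_Cmod|].
  destruct (P (fun i => Im (f i))) as [t Ht]; [intros; apply Rabs_im_le_Cmod|].
  exists (s + Ci * t)%C.
  refine (has_sum_ext _ _ _ _ (has_sum_plus _ _ _ _ Hs (has_sum_scal Ci _ _ Ht))).
  intros i. destruct (f i) as [x y]. unfold Re, Im, RtoC, Ci, Cplus, Cmult; simpl.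
  f_equal; ring.
Qed.

(** * Reindexing and Fubini for unordered sums *)

(** Entries outside the image of the injection carry the value 0 and are dropped, the others are
    replaced by their preimages. Both directions of reindexing rest on this. *)
Lemma pullback_list {I J : Type} (phi : I -> J) (f : J -> C) (l : list J) :
  (forall i i', phi i = phi i' -> i = i') ->
  (forall j, (forall i, phi i <> j) -> f j = 0) ->
  NoDup l ->
  exists l', NoDup l' /\ (forall i, In (phi i) l <-> In i l') /\
             lsum (fun i => f (phi i)) l' = lsum f l.
Proof.
  intros Hinj H0. induction l as [|a l IH]; intros N.
  - exists nil. simpl. repeat split; [constructor | tauto | tauto].
  - inversion N; subst. destruct (IH H3) as [l' [N' [Hl' E]]].
    destruct (classic (exists i, phi i = a)) as [[i <-]|Hn].
    + exists (i :: l'). split; [|split].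
      * constructor; [now rewrite <- Hl' | assumption].
      * intros i'. simpl. rewrite Hl'. split; intros [H|H]; auto.
        left. now rewrite H.
      * simpl. now rewrite E.
    + exists l'. split; [assumption|]. split.
      * intros i'. simpl. rewrite <- Hl'. split; [|tauto].
        intros [H|H]; [|assumption]. exfalso. apply Hn. eauto.
      * simpl. rewrite (H0 a), E; [ring|]. intros i Hi. eauto.
Qed.

Lemma has_sum_extend {I J : Type} (phi : I -> J) (f : J -> C) (s : C) :
  (forall i i', phi i = phi i' -> i = i') ->
  (forall j, (forall i, phi i <> j) -> f j = 0) ->
  has_sum (fun i => f (phi i)) s -> has_sum f s.
Proof.
  intros Hinj H0 H eps He. destruct (H eps He) as [l0 Hl0].
  exists (map phi l0). intros l N Hl.
  destruct (pullback_list phi f l Hinj H0 N) as [l' [N' [Hl' <-]]].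
  apply Hl0; [assumption|]. intros i Hi. apply Hl', Hl, in_map. assumption.
Qed.

Lemma has_sum_restrict {I J : Type} (phi : I -> J) (f : J -> C) (s : C) :
  (forall i i', phi i = phi i' -> i = i') ->
  (forall j, (forall i, phi i <> j) -> f j = 0) ->
  has_sum f s -> has_sum (fun i => f (phi i)) s.
Proof.
  intros Hinj H0 H eps He. destruct (H eps He) as [l0 Hl0].
  destruct (nodup_ex l0) as [l1 [N1 Hl1]].
  destruct (pullback_list phi f l1 Hinj H0 N1) as [l0' [N0' [Hl0' _]]].
  exists l0'. intros l N Hl.
  (* [L] adjoins [l1] to the image of [l]. The entries of [l1] that have a preimage already come
     from [l], so the pullback of [L] is [l] up to order. *)
  destruct (nodup_ex (map phi l ++ l1)) as [L [NL HL]].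
  destruct (pullback_list phi f L Hinj H0 NL) as [L' [NL' [HL' E]]].
  rewrite (lsum_perm _ l L').
  - rewrite E. apply Hl0; [assumption|]. intros x Hx. apply HL, in_or_app.
    right. now apply Hl1.
  - apply NoDup_Permutation; try assumption. intros i.
    rewrite <- HL', HL, in_app_iff. split.
    + intros Hi. left. now apply in_map.
    + intros [Hi|Hi].
      * apply in_map_iff in Hi. destruct Hi as [i' [Ei Hi]].
        apply Hinj in Ei. now subst.
      * apply Hl, Hl0'. assumption.
Qed.

Lemma has_sum_bij {I J : Type} (phi : I -> J) (psi : J -> I) (f : J -> C) (s : C) :
  (forall i, psi (phi i) = i) -> (forall j, phi (psi j) = j) ->
  has_sum f s -> has_sum (fun i => f (phi i)) s.
Proof.
  intros H1 H2. apply has_sum_restrict.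
  - intros i i' E. now rewrite <- (H1 i), E, H1.
  - intros j Hj. destruct (Hj (psi j) (H2 j)).
Qed.

(** Over a list of rows containing the first components of [l0], each row sum is approximated by a
    finite part of the row. The union of these parts can be made to contain [l0], so its sum is
    close to [s]. *)
Lemma has_sum_fubini {A B : Type} (f : A * B -> C) (g : A -> C) (s : C) :
  has_sum f s -> (forall a, has_sum (fun b => f (a, b)) (g a)) -> has_sum g s.
Proof.
  intros H Hg eps He.
  destruct (H (eps / 2)) as [l0 Hl0]; [lra|].
  exists (map fst l0). intros l N Hl.
  assert (Q : forall delta, 0 < delta -> exists L, NoDup L /\
     (forall p, In p L -> In (fst p) l) /\
     (forall p, In p l0 -> In (fst p) l -> In p L) /\
     Cmod (lsum f L - lsum g l) <= INR (length l) * delta).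
  { intros delta Hd. clear Hl. induction l as [|a l IH].
    - exists nil. simpl. repeat split; try tauto; [constructor|].
      replace (0 - 0)%C with (RtoC 0) by ring. rewrite Cmod_0. lra.
    - inversion N; subst. destruct (IH H3) as [L [NL [HL1 [HL2 HL3]]]].
      destruct (Hg a delta Hd) as [b0 Hb0].
      destruct (nodup_ex (b0 ++ map snd l0)) as [b [Nb Hb]].
      exists (map (pair a) b ++ L). repeat split.
      + apply NoDup_app; [|assumption|].
        * apply NoDup_map_NoDup_ForallPairs; [|assumption].
          intros x y _ _ Exy. now inversion Exy.
        * intros p Hp Hp'. apply in_map_iff in Hp. destruct Hp as [x [<- _]].
          apply HL1 in Hp'. contradiction.
      + intros p Hp. apply in_app_iff in Hp. destruct Hp as [Hp|Hp].
        * apply in_map_iff in Hp. destruct Hp as [x [<- _]]. now left.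
        * right. auto.
      + intros [x y] Hp [E|Hx]; simpl in *; apply in_app_iff.
        * subst. left. apply in_map. apply Hb, in_app_iff. right.
          apply in_map_iff. exists (x, y). auto.
        * right. auto.
      + rewrite lsum_app, lsum_map. simpl lsum.
        change (length (a :: l)) with (S (length l)). rewrite S_INR.
        specialize (Hb0 b Nb).
        replace (lsum (fun i : B => f (a, i)) b + lsum f L - (g a + lsum g l))%C
          with ((lsum (fun i : B => f (a, i)) b - g a) + (lsum f L - lsum g l))%C by ring.
        eapply Rle_trans; [apply Cmod_triangle|].
        assert (incl b0 b) by (intros x Hx; apply Hb, in_app_iff; auto).
        specialize (Hb0 H0). lra. }
  (* The error is shared equally among the rows; the [+ 1] covers the empty list. *)
  destruct (Q (eps / 2 / (INR (length l) + 1))) as [L [NL [_ [HL2 HL3]]]].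
  { pose proof (pos_INR (length l)). apply Rdiv_lt_0_compat; lra. }
  assert (HI : incl l0 L).
  { intros p Hp. apply HL2; [assumption|]. apply Hl, in_map. assumption. }
  specialize (Hl0 L NL HI).
  assert (INR (length l) * (eps / 2 / (INR (length l) + 1)) <= eps / 2).
  { pose proof (pos_INR (length l)).
    apply Rle_trans with ((INR (length l) + 1) * (eps / 2 / (INR (length l) + 1))).
    - apply Rmult_le_compat_r; [|lra]. apply Rlt_le, Rdiv_lt_0_compat; lra.
    - right. field. lra. }
  replace (lsum g l - s)%C with ((lsum f L - s) - (lsum f L - lsum g l))%C by ring.
  eapply Rle_lt_trans; [apply Cmod_triangle|]. rewrite Cmod_opp. lra.
Qed.

Lemma rsum_list_prod {A B : Type} (f : A * B -> R) (la : list A) (lb : list B) :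
  rsum f (list_prod la lb) = rsum (fun a => rsum (fun b => f (a, b)) lb) la.
Proof.
  induction la as [|a la IH]; simpl; [reflexivity|].
  now rewrite rsum_app, rsum_map, IH.
Qed.

(** A finite set of pairs lies in the product of its two projections. *)
Lemma sum_bounded_fubini {A B : Type} (f : A * B -> R) (g : A -> R) (K : R) :
  (forall p, 0 <= f p) -> (forall a, sum_bounded (fun b => f (a, b)) (g a)) ->
  sum_bounded g K -> sum_bounded f K.
Proof.
  intros Hf Hg HK l N.
  destruct (nodup_ex (map fst l)) as [la [Na Ha]].
  destruct (nodup_ex (map snd l)) as [lb [Nb Hb]].
  apply Rle_trans with (rsum f (list_prod la lb)).
  - apply rsum_incl; try assumption. intros [x y] Hp. apply in_prod.
    + apply Ha, in_map_iff. exists (x, y). auto.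
    + apply Hb, in_map_iff. exists (x, y). auto.
  - rewrite rsum_list_prod. eapply Rle_trans; [|apply (HK la Na)].
    apply rsum_le. intros a _. apply Hg. assumption.
Qed.

Lemma summable_le {I : Type} (f : I -> C) (g : I -> R) (K : R) :
  (forall i, Cmod (f i) <= g i) -> sum_bounded g K -> summable f.
Proof.
  intros H HK. exists K. now apply sum_bounded_le with g.
Qed.

Lemma sum_bounded_scal {I : Type} (c : R) (f : I -> R) (K : R) :
  0 <= c -> sum_bounded f K -> sum_bounded (fun i => c * f i) (c * K).
Proof.
  intros Hc HK l N. rewrite rsum_scal. apply Rmult_le_compat_l; auto.
Qed.

Lemma sum_bounded_inj {I J : Type} (phi : I -> J) (f : J -> R) (K : R) :
  (forall i i', phi i = phi i' -> i = i') ->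
  sum_bounded f K -> sum_bounded (fun i => f (phi i)) K.
Proof.
  intros Hinj HK l N. rewrite <- rsum_map. apply HK.
  apply NoDup_map_NoDup_ForallPairs; [|assumption]. intros x y _ _. apply Hinj.
Qed.

(** * Comparison with ordinary series *)

Lemma C_R_norm (z : C) : @norm R_AbsRing C_R_NormedModule z = Cmod z.
Proof.
  change (sqrt (Rabs (fst z) ^ 2 + Rabs (snd z) ^ 2) = Cmod z).
  unfold Cmod. now rewrite !pow2_abs.
Qed.

Lemma sum_n_lsum (f : nat -> C) (n : nat) : @eq C (sum_n f n) (lsum f (List.seq 0 (S n))).
Proof.
  induction n as [|n IH].
  - rewrite sum_O. symmetry. apply Cplus_0_r.
  - rewrite sum_Sn, IH, (List.seq_S (S n)), lsum_app.
    change (Cplus (lsum f (List.seq 0 (S n))) (f (S n)) =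
            Cplus (lsum f (List.seq 0 (S n))) (Cplus (f (S n)) 0)).
    ring.
Qed.

Lemma has_sum_series (f : nat -> C) (s : C) :
  has_sum f s -> @is_series R_AbsRing C_R_NormedModule f s.
Proof.
  intros H. unfold is_series.
  apply filterlim_locally_ball_norm. intros eps.
  destruct (H eps (cond_pos eps)) as [l0 H0].
  exists (list_max l0). intros n Hn.
  unfold ball_norm. rewrite C_R_norm.
  change (Cmod (Cminus (sum_n f n) s) < eps).
  rewrite sum_n_lsum. apply H0.
  - apply List.seq_NoDup.
  - intros x Hx. apply in_seq.
    assert (list_max l0 <= list_max l0)%nat by lia.
    rewrite list_max_le, Forall_forall in H1. specialize (H1 x Hx). lia.
Qed.

(** Bridge to the Eisenstein series as defined: [csum] picks the limit of the partial sums, and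
    every long enough initial segment contains the list [l0] of the unordered sum. *)
Lemma csum_eq (f : nat -> C) (s : C) : has_sum f s -> csum f = s.
Proof.
  intros H. unfold csum.
  apply (@iota_filterlim_locally R_AbsRing C_R_CompleteNormedModule nat eventually
    (Proper_StrongProper eventually eventually_filter)).
  now apply has_sum_series.
Qed.

(** * Complex exponential and complex derivatives *)

Lemma Cmod_le_parts (z : C) : Cmod z <= Rabs (Re z) + Rabs (Im z).
Proof.
  destruct z as [x y]. simpl.
  replace (x, y) with (RtoC x + Ci * RtoC y)%C.
  - eapply Rle_trans; [apply Cmod_triangle|].
    rewrite Cmod_mult, Cmod_Ci, !Cmod_R. lra.
  - unfold RtoC, Ci, Cplus, Cmult; simpl. f_equal; ring.
Qed.

Lemma Re_plus (a b : C) : Re (a + b) = Re a + Re b.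
Proof. reflexivity. Qed.

Lemma Im_plus (a b : C) : Im (a + b) = Im a + Im b.
Proof. reflexivity. Qed.

Lemma Im_scal (a : R) (z : C) : Im (a * z) = a * Im z.
Proof. unfold RtoC, Cmult, Im; simpl. ring. Qed.

Lemma Re_scal (a : R) (z : C) : Re (a * z) = a * Re z.
Proof. unfold RtoC, Cmult, Re; simpl. ring. Qed.

Lemma cexp_plus (a b : C) : cexp (a + b) = (cexp a * cexp b)%C.
Proof.
  unfold cexp. rewrite Re_plus, Im_plus, exp_plus, cos_plus, sin_plus.
  unfold Cmult; simpl. f_equal; ring.
Qed.

Lemma Cmod_cexp (a : C) : Cmod (cexp a) = exp (Re a).
Proof.
  unfold cexp, Cmod; simpl.
  replace (_ + _) with (exp (Re a) ^ 2 * ((sin (Im a))² + (cos (Im a))²))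
    by (unfold Rsqr; ring).
  rewrite sin2_cos2, Rmult_1_r. apply sqrt_pow2, Rlt_le, exp_pos.
Qed.

Lemma cexp_0 : cexp 0 = 1.
Proof.
  unfold cexp; simpl. rewrite exp_0, cos_0, sin_0. unfold RtoC. f_equal; ring.
Qed.

Lemma exp_sub_1_bound (p : R) : Rabs (exp p - 1) <= Rabs p * exp (Rabs p).
Proof.
  pose proof (exp_ineq1_le p). pose proof (exp_ineq1_le (- p)).
  pose proof (exp_pos p).
  assert (E : exp (- p) * exp p = 1) by (rewrite <- exp_plus, Rplus_opp_l; apply exp_0).
  destruct (Rle_dec 0 p) as [Hp|Hp].
  - rewrite (Rabs_pos_eq p) by assumption. rewrite Rabs_pos_eq by lra. nra.
  - rewrite (Rabs_left p) by lra. pose proof (exp_pos (- p)).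
    assert (exp p < 1) by (rewrite <- exp_0; apply exp_increasing; lra).
    rewrite Rabs_left by lra. nra.
Qed.

Lemma exp_sub_1_sub_bound (p : R) : Rabs (exp p - 1 - p) <= p ^ 2 * exp (Rabs p).
Proof.
  pose proof (exp_ineq1_le p). pose proof (exp_ineq1_le (- p)).
  pose proof (exp_pos p).
  assert (E : exp (- p) * exp p = 1) by (rewrite <- exp_plus, Rplus_opp_l; apply exp_0).
  rewrite Rabs_pos_eq by lra.
  assert (exp p - 1 - p <= p * (exp p - 1)) by nra.
  assert (p * (exp p - 1) <= Rabs p * Rabs (exp p - 1)).
  { rewrite <- Rabs_mult. apply Rle_abs. }
  pose proof (exp_sub_1_bound p). pose proof (Rabs_pos p).
  replace (p ^ 2) with (Rabs p * Rabs p) by (rewrite <- Rabs_mult, Rabs_pos_eq; nra).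
  nra.
Qed.

Lemma Rabs_sin_le (x : R) : Rabs (sin x) <= Rabs x.
Proof.
  destruct (MVT_gen sin 0 x cos) as [c [_ Hc]].
  - intros. apply is_derive_sin.
  - intros. apply continuity_sin.
  - rewrite sin_0, !Rminus_0_r in Hc. rewrite Hc, Rabs_mult.
    pose proof (Rabs_pos x). pose proof (COS_bound c).
    assert (Rabs (cos c) <= 1) by (apply Rabs_le; lra). nra.
Qed.

Lemma one_sub_cos (x : R) : 1 - cos x = 2 * sin (x / 2) ^ 2.
Proof.
  replace x with (2 * (x / 2)) at 1 by field. rewrite cos_2a_sin. ring.
Qed.

Lemma one_sub_cos_bound (x : R) : 0 <= 1 - cos x <= x ^ 2 / 2.
Proof.
  rewrite one_sub_cos. pose proof (Rabs_sin_le (x / 2)).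
  assert (sin (x / 2) ^ 2 <= (x / 2) ^ 2).
  { rewrite <- !Rsqr_pow2. now apply Rsqr_le_abs_1. }
  nra.
Qed.

Lemma sin_sub_bound (x : R) : Rabs (sin x - x) <= x ^ 2.
Proof.
  destruct (MVT_gen (fun t => sin t - t) 0 x (fun t => cos t - 1)) as [c [Hc E]].
  - intros. auto_derive; [trivial | ring].
  - intros. apply continuity_pt_filterlim.
    apply (ex_derive_continuous (fun t : R => sin t - t)). auto_derive. trivial.
  - rewrite sin_0 in E. replace (sin x - x) with ((cos c - 1) * (x - 0)) by lra.
    rewrite Rabs_mult, Rminus_0_r.
    assert (Rabs (cos c - 1) <= Rabs c).
    { rewrite <- Rabs_Ropp. replace (- (cos c - 1)) with (2 * sin (c / 2) ^ 2)
        by (rewrite <- one_sub_cos; ring).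
      rewrite Rabs_mult, <- RPow_abs, (Rabs_pos_eq 2) by lra.
      pose proof (Rabs_sin_le (c / 2)). pose proof (SIN_bound (c / 2)).
      assert (Rabs (sin (c / 2)) <= 1) by (apply Rabs_le; lra).
      pose proof (Rabs_pos (sin (c / 2))).
      assert (Rabs (c / 2) = Rabs c / 2).
      { unfold Rdiv. rewrite Rabs_mult, (Rabs_pos_eq (/ 2)); lra. }
      nra. }
    assert (Rabs c <= Rabs x).
    { unfold Rmin, Rmax in Hc. destruct (Rle_dec 0 x).
      - rewrite !Rabs_pos_eq; lra.
      - rewrite !Rabs_left1; lra. }
    pose proof (Rabs_pos x).
    replace (x ^ 2) with (Rabs x * Rabs x) by (rewrite <- Rabs_mult, Rabs_pos_eq; nra).
    apply Rmult_le_compat_r; lra.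
Qed.

Lemma exp_le_mono (x y : R) : x <= y -> exp x <= exp y.
Proof.
  intros [H|<-]; [left; now apply exp_increasing | right; reflexivity].
Qed.

(** The bounds for [exp], [sin] and [1 - cos] give the constant 3/2 for the real part of the
    remainder and 2 for the imaginary part, together below 4. *)
Lemma cexp_remainder (y : C) :
  Cmod (cexp y - 1 - y) <= 4 * Cmod y ^ 2 * exp (Cmod y).
Proof.
  eapply Rle_trans; [apply Cmod_le_parts|].
  pose proof (re_le_Cmod y) as HR. pose proof (Rabs_im_le_Cmod y) as HI.
  destruct y as [p t]. set (M := Cmod (p, t)) in *.
  unfold Re, Im in HR, HI; simpl in HR, HI. unfold cexp; simpl.
  replace (exp p * cos t + - (1) + - p) with ((exp p - 1 - p) - exp p * (1 - cos t)) by ring.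
  replace (exp p * sin t + - 0 + - t) with ((exp p - 1) * sin t + (sin t - t)) by ring.
  pose proof (Rabs_pos p). pose proof (Rabs_pos t).
  assert (HM : exp (Rabs p) <= exp M) by now apply exp_le_mono.
  assert (H1 : 1 <= exp M) by (rewrite <- exp_0; apply exp_le_mono; lra).
  assert (Hp : exp p <= exp M) by (apply exp_le_mono; pose proof (Rle_abs p); lra).
  pose proof (exp_pos p).
  assert (A1 : Rabs (exp p - 1 - p - exp p * (1 - cos t)) <= M ^ 2 * exp M + M ^ 2 / 2 * exp M).
  { eapply Rle_trans; [apply Rabs_triang|]. rewrite Rabs_Ropp, Rabs_mult.
    pose proof (exp_sub_1_sub_bound p). pose proof (one_sub_cos_bound t).
    rewrite (Rabs_pos_eq (exp p)), (Rabs_pos_eq (1 - cos t)) by lra.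
    assert (p ^ 2 <= M ^ 2) by (rewrite <- (pow2_abs p); apply pow_incr; lra).
    assert (t ^ 2 <= M ^ 2) by (rewrite <- (pow2_abs t); apply pow_incr; lra).
    assert (p ^ 2 * exp (Rabs p) <= M ^ 2 * exp M).
    { apply Rmult_le_compat; try assumption; [apply pow2_ge_0 | left; apply exp_pos]. }
    nra. }
  assert (A2 : Rabs ((exp p - 1) * sin t + (sin t - t)) <= M ^ 2 * exp M + M ^ 2 * exp M).
  { eapply Rle_trans; [apply Rabs_triang|]. rewrite Rabs_mult.
    pose proof (exp_sub_1_bound p). pose proof (Rabs_sin_le t). pose proof (sin_sub_bound t).
    assert (t ^ 2 <= M ^ 2) by (rewrite <- (pow2_abs t); apply pow_incr; lra).
    assert (Rabs (exp p - 1) * Rabs (sin t) <= (M * exp M) * M).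
    { apply Rmult_le_compat; try apply Rabs_pos; [|lra].
      eapply Rle_trans; [eassumption|]. apply Rmult_le_compat; try lra.
      left; apply exp_pos. }
    nra. }
  simpl in A1, A2 |- *.
  assert (0 <= M * (M * 1) * exp M) by (apply Rmult_le_pos; nra). lra.
Qed.

Lemma e_plus (a b : C) : e (a + b) = (e a * e b)%C.
Proof.
  unfold e. rewrite <- cexp_plus. f_equal. ring.
Qed.

Lemma Cmod_e (z : C) : Cmod (e z) = exp (- (2 * PI * Im z)).
Proof.
  unfold e. rewrite Cmod_cexp. f_equal.
  unfold RtoC, Ci, Cmult, Re, Im; simpl. ring.
Qed.

Lemma e_0 : e 0 = 1.
Proof.
  unfold e. replace (RtoC (2 * PI) * (Ci * 0))%C with (RtoC 0) by ring. apply cexp_0.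
Qed.

Lemma e_mul_nat (n : nat) (z : C) : e (INR n * z) = (e z ^ n)%C.
Proof.
  induction n as [|n IH].
  - simpl INR. replace (RtoC 0 * z)%C with (RtoC 0) by ring. rewrite e_0. reflexivity.
  - rewrite S_INR, RtoC_plus.
    replace ((RtoC (INR n) + 1) * z)%C with (z + INR n * z)%C by ring.
    rewrite e_plus, IH. reflexivity.
Qed.

Lemma e_1 : e 1 = 1.
Proof.
  unfold e, cexp.
  replace (Re _) with 0 by (unfold Ci, RtoC, Cmult, Re; simpl; ring).
  replace (Im _) with (2 * PI) by (unfold Ci, RtoC, Cmult, Im; simpl; ring).
  rewrite exp_0, cos_2PI, sin_2PI. unfold RtoC. f_equal; ring.
Qed.

Lemma e_nat (n : nat) : e (INR n) = 1.
Proof.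
  replace (RtoC (INR n)) with (RtoC (INR n) * 1)%C by ring.
  rewrite e_mul_nat, e_1. apply Cpow_1_l.
Qed.

Lemma e_Z (n : Z) : e (IZR n) = 1.
Proof.
  destruct (Z_le_dec 0 n) as [H|H].
  - rewrite <- (Z2Nat.id n H), <- INR_IZR_INZ. apply e_nat.
  - assert (E : (e (IZR n) * e (INR (Z.to_nat (- n))))%C = 1).
    { rewrite <- e_plus, INR_IZR_INZ, Z2Nat.id by lia.
      rewrite opp_IZR, RtoC_opp, Cplus_opp_r. apply e_0. }
    rewrite e_nat in E. rewrite <- E. ring.
Qed.

Lemma e_period (z : C) (n : Z) : e (z + IZR n) = e z.
Proof.
  rewrite e_plus, e_Z. ring.
Qed.

Lemma e_half : e (/ 2) = (-1)%C.
Proof.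
  rewrite <- RtoC_inv by lra.
  unfold e, cexp.
  replace (Re _) with 0 by (unfold Ci, RtoC, Cmult, Re; simpl; ring).
  replace (Im _) with PI by (unfold Ci, RtoC, Cmult, Im; simpl; field).
  rewrite exp_0, cos_PI, sin_PI. unfold RtoC, Copp; simpl. f_equal; ring.
Qed.

(* A quadratic remainder is required: every function differentiated below is
   analytic, and the quadratic form passes to sums of series. *)
Definition cder (f : C -> C) (z D : C) : Prop :=
  exists delta K : R, 0 < delta /\ 0 <= K /\
    forall h : C, Cmod h < delta ->
      Cmod (f (z + h) - f z - h * D)%C <= K * Cmod h ^ 2.

Lemma cder_unique (f : C -> C) (z D D' : C) : cder f z D -> cder f z D' -> D = D'.
Proof.
  intros [d [K [Hd [HK H]]]] [d' [K' [Hd' [HK' H']]]].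
  apply NNPP. intros Hn.
  assert (P : 0 < Cmod (D - D')).
  { apply Cmod_gt_0. intros E. apply Hn.
    replace D with ((D - D') + D')%C by ring. rewrite E. ring. }
  set (M := Cmod (D - D')) in *.
  (* A real increment inside both radii, so small that the two quadratic errors cannot account for
     the difference of the two candidates. *)
  set (r := Rmin (Rmin d d' / 2) (M / (2 * (K + K' + 1)))).
  assert (0 < Rmin d d') by (apply Rmin_glb_lt; assumption).
  pose proof (Rmin_l d d'). pose proof (Rmin_r d d').
  assert (Hr : 0 < r).
  { apply Rmin_glb_lt; [lra|]. apply Rdiv_lt_0_compat; lra. }
  assert (Hr1 : r <= Rmin d d' / 2) by apply Rmin_l.
  assert (Hr2 : (K + K' + 1) * r <= M / 2).
  { apply Rle_trans with ((K + K' + 1) * (M / (2 * (K + K' + 1)))).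
    - apply Rmult_le_compat_l; [lra | apply Rmin_r].
    - right. field. lra. }
  assert (Er : Cmod (RtoC r) = r) by (rewrite Cmod_R; apply Rabs_pos_eq; lra).
  specialize (H (RtoC r)). specialize (H' (RtoC r)). rewrite Er in H, H'.
  assert (Q : Cmod (r * (D - D'))%C <= K * r ^ 2 + K' * r ^ 2).
  { replace (r * (D - D'))%C with
      ((f (z + r) - f z - r * D') - (f (z + r) - f z - r * D))%C by ring.
    eapply Rle_trans; [apply Cmod_triangle|]. rewrite Cmod_opp.
    assert (r < d) by lra. assert (r < d') by lra.
    specialize (H H3). specialize (H' H4). lra. }
  rewrite Cmod_mult, Er in Q. fold M in Q. nra.
Qed.

Lemma cder_const (c z : C) : cder (fun _ => c) z 0.
Proof.
  exists 1, 0. repeat split; try lra. intros h _.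
  replace (c - c - h * 0)%C with (RtoC 0) by ring. rewrite Cmod_0. lra.
Qed.

Lemma cder_affine (a b z : C) : cder (fun w => a * w + b)%C z a.
Proof.
  exists 1, 0. repeat split; try lra. intros h _.
  replace (_ - _ - _)%C with (RtoC 0) by ring. rewrite Cmod_0. lra.
Qed.

Lemma cder_plus (f g : C -> C) (z F G : C) :
  cder f z F -> cder g z G -> cder (fun w => f w + g w)%C z (F + G)%C.
Proof.
  intros [d [K [Hd [HK H]]]] [d' [K' [Hd' [HK' H']]]].
  exists (Rmin d d'), (K + K'). repeat split.
  - now apply Rmin_glb_lt.
  - lra.
  - intros h Hh. pose proof (Rmin_l d d'). pose proof (Rmin_r d d').
    specialize (H h ltac:(lra)). specialize (H' h ltac:(lra)).
    replace (_ - _ - _)%C with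
      ((f (z + h) - f z - h * F) + (g (z + h) - g z - h * G))%C by ring.
    eapply Rle_trans; [apply Cmod_triangle|]. lra.
Qed.

Lemma cder_mult (f g : C -> C) (z F G : C) :
  cder f z F -> cder g z G -> cder (fun w => f w * g w)%C z (F * g z + f z * G)%C.
Proof.
  intros [d [K [Hd [HK H]]]] [d' [K' [Hd' [HK' H']]]].
  set (b1 := Cmod F). set (b2 := Cmod G).
  assert (P1 : 0 <= b1) by apply Cmod_ge_0. assert (P2 : 0 <= b2) by apply Cmod_ge_0.
  pose proof (Cmod_ge_0 (f z)) as P3. pose proof (Cmod_ge_0 (g z)) as P4.
  exists (Rmin 1 (Rmin d d')),
    ((b1 + K) * (b2 + K') + Cmod (f z) * K' + Cmod (g z) * K).
  repeat split.
  - repeat apply Rmin_glb_lt; lra.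
  - repeat apply Rplus_le_le_0_compat; apply Rmult_le_pos; lra.
  - intros h Hh.
    pose proof (Rmin_l d d'). pose proof (Rmin_r d d').
    pose proof (Rmin_l 1 (Rmin d d')). pose proof (Rmin_r 1 (Rmin d d')).
    specialize (H h ltac:(lra)). specialize (H' h ltac:(lra)).
    set (r := (f (z + h) - f z - h * F)%C) in *.
    set (s := (g (z + h) - g z - h * G)%C) in *.
    replace (f (z + h) * g (z + h) - f z * g z - h * (F * g z + f z * G))%C
      with ((h * F + r) * (h * G + s) + (f z * s + g z * r))%C
      by (unfold r, s; ring).
    pose proof (Cmod_ge_0 h) as Ph. set (m := Cmod h) in *.
    assert (Q1 : Cmod (h * F + r)%C <= (b1 + K) * m).
    { eapply Rle_trans; [apply Cmod_triangle|]. rewrite Cmod_mult.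
      fold b1 m. assert (K * m ^ 2 <= K * m) by (apply Rmult_le_compat_l; nra). lra. }
    assert (Q2 : Cmod (h * G + s)%C <= (b2 + K') * m).
    { eapply Rle_trans; [apply Cmod_triangle|]. rewrite Cmod_mult.
      fold b2 m. assert (K' * m ^ 2 <= K' * m) by (apply Rmult_le_compat_l; nra). lra. }
    eapply Rle_trans; [apply Cmod_triangle|]. rewrite Cmod_mult.
    assert (Q3 : Cmod (h * F + r)%C * Cmod (h * G + s)%C <= (b1 + K) * m * ((b2 + K') * m)).
    { apply Rmult_le_compat; try apply Cmod_ge_0; assumption. }
    assert (Q4 : Cmod (f z * s + g z * r)%C <= Cmod (f z) * (K' * m ^ 2) + Cmod (g z) * (K * m ^ 2)).
    { eapply Rle_trans; [apply Cmod_triangle|]. rewrite !Cmod_mult.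
      apply Rplus_le_compat; apply Rmult_le_compat_l; assumption. }
    simpl in *. lra.
Qed.

Lemma cder_scal (c : C) (f : C -> C) (z F : C) :
  cder f z F -> cder (fun w => c * f w)%C z (c * F)%C.
Proof.
  intros H. replace (c * F)%C with (0 * f z + c * F)%C by ring.
  apply (cder_mult (fun _ => c)); [apply cder_const | assumption].
Qed.

Lemma cder_minus (f g : C -> C) (z F G : C) :
  cder f z F -> cder g z G -> cder (fun w => f w - g w)%C z (F - G)%C.
Proof.
  intros Hf Hg. pose proof (cder_plus _ _ _ _ _ Hf (cder_scal (-1) _ _ _ Hg)) as H.
  destruct H as [d [K [Hd [HK H]]]]. exists d, K. repeat split; try assumption.
  intros h Hh. specialize (H h Hh).
  replace (f (z + h) - g (z + h) - (f z - g z) - h * (F - G))%C with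
    (f (z + h) + -1 * g (z + h) - (f z + -1 * g z) - h * (F + -1 * G))%C by ring.
  assumption.
Qed.

Lemma cder_comp (f g : C -> C) (z F G : C) :
  cder f (g z) F -> cder g z G -> cder (fun w => f (g w)) z (F * G)%C.
Proof.
  intros [d [K [Hd [HK H]]]] [d' [K' [Hd' [HK' H']]]].
  set (B := Cmod G + K' + 1).
  pose proof (Cmod_ge_0 G) as P1. pose proof (Cmod_ge_0 F) as P2.
  assert (PB : 0 < B) by (unfold B; lra).
  assert (Pd : 0 < d / B) by now apply Rdiv_lt_0_compat.
  exists (Rmin (Rmin 1 d') (d / B)), (K * B ^ 2 + K' * Cmod F).
  repeat split.
  - repeat apply Rmin_glb_lt; lra.
  - apply Rplus_le_le_0_compat; apply Rmult_le_pos; try assumption. apply pow2_ge_0.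
  - intros h Hh.
    pose proof (Rmin_l 1 d'). pose proof (Rmin_r 1 d').
    pose proof (Rmin_l (Rmin 1 d') (d / B)). pose proof (Rmin_r (Rmin 1 d') (d / B)).
    specialize (H' h ltac:(lra)).
    set (s := (g (z + h) - g z - h * G)%C) in *.
    set (k := (h * G + s)%C).
    pose proof (Cmod_ge_0 h) as Ph. set (m := Cmod h) in *.
    assert (Hk : Cmod k <= B * m).
    { unfold k. eapply Rle_trans; [apply Cmod_triangle|]. rewrite Cmod_mult.
      fold m. assert (K' * m ^ 2 <= K' * m) by (apply Rmult_le_compat_l; nra).
      unfold B. lra. }
    assert (Hm : B * m < d).
    { apply Rlt_le_trans with (B * (d / B)); [apply Rmult_lt_compat_l; lra|].
      right. field. lra. }
    specialize (H k ltac:(lra)).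
    replace (g z + k)%C with (g (z + h)%C) in H by (unfold k, s; ring).
    replace (f (g (z + h)) - f (g z) - h * (F * G))%C with
      ((f (g (z + h)) - f (g z) - k * F) + s * F)%C by (unfold k; ring).
    eapply Rle_trans; [apply Cmod_triangle|]. rewrite Cmod_mult.
    assert (K * Cmod k ^ 2 <= K * (B * m) ^ 2).
    { apply Rmult_le_compat_l; [assumption|]. apply pow_incr. split; [apply Cmod_ge_0 | assumption]. }
    assert (Cmod s * Cmod F <= K' * m ^ 2 * Cmod F) by (apply Rmult_le_compat_r; assumption).
    rewrite Rpow_mult_distr in H4. lra.
Qed.

Lemma cder_ext (f g : C -> C) (z D : C) (r : R) :
  0 < r -> (forall h, Cmod h < r -> f (z + h)%C = g (z + h)%C) ->
  cder f z D -> cder g z D.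
Proof.
  intros Hr E [d [K [Hd [HK H]]]]. exists (Rmin d r), K. repeat split.
  - now apply Rmin_glb_lt.
  - assumption.
  - intros h Hh. pose proof (Rmin_l d r). pose proof (Rmin_r d r).
    rewrite <- E by lra.
    replace (g z) with (f z).
    + apply H. lra.
    + pose proof (E 0) as E0. rewrite Cplus_0_r in E0. apply E0. now rewrite Cmod_0.
Qed.

Lemma Im_near (z h : C) : Cmod h < Im z -> 0 < Im (z + h).
Proof.
  intros H. rewrite Im_plus. pose proof (Rabs_im_le_Cmod h).
  pose proof (Rabs_maj2 (Im h)). lra.
Qed.

(** Restricts a complex derivative to the real line through [p] in direction [v], where the theorems
    on functions of a real variable apply. *)
Lemma cder_is_derive (f : C -> C) (p v D : C) (t : R) :
  cder f (p + t * v)%C D ->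
  @is_derive R_AbsRing C_R_NormedModule (fun s : R => f (p + s * v)%C) t (v * D)%C.
Proof.
  intros [d [K [Hd [HK H]]]]. split; [apply is_linear_scal_l|].
  intros x Hx. apply (@is_filter_lim_locally_unique R_AbsRing R_NormedModule) in Hx. subst x.
  intros eps.
  set (V := Cmod v). assert (PV : 0 <= V) by apply Cmod_ge_0.
  set (r := Rmin (d / (V + 1)) (eps / (K * V ^ 2 + 1))).
  assert (PK : 0 <= K * V ^ 2) by (apply Rmult_le_pos; [assumption | apply pow2_ge_0]).
  assert (Hr : 0 < r).
  { apply Rmin_glb_lt; apply Rdiv_lt_0_compat; try lra. apply cond_pos. }
  exists (mkposreal r Hr). intros s Hs.
  change (Rabs (s - t) < r) in Hs.
  rewrite C_R_norm.
  change (Cmod (f (p + s * v) - f (p + t * v) - @scal _ C_R_NormedModule (s - t)%R (v * D))%C <= eps * Rabs (s - t)).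
  replace (@scal _ C_R_NormedModule (s - t)%R (v * D)%C) with (((s - t)%R * v) * D)%C.
  2:{ unfold scal; simpl. unfold prod_scal, scal; simpl. unfold mult; simpl.
      unfold RtoC, Cmult; simpl. f_equal; ring. }
  replace (p + s * v)%C with (p + t * v + (s - t)%R * v)%C
    by (rewrite RtoC_minus; ring).
  assert (Em : Cmod ((s - t)%R * v) = Rabs (s - t) * V) by now rewrite Cmod_mult, Cmod_R.
  pose proof (Rabs_pos (s - t)) as P.
  assert (R1 : Rabs (s - t) * V < d).
  { apply Rle_lt_trans with (Rabs (s - t) * (V + 1)); [nra|].
    apply Rlt_le_trans with (d / (V + 1) * (V + 1)).
    - apply Rmult_lt_compat_r; [lra|]. eapply Rlt_le_trans; [apply Hs | apply Rmin_l].
    - right. field. lra. }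
  assert (R2 : Rabs (s - t) * (K * V ^ 2) <= eps).
  { apply Rle_trans with (Rabs (s - t) * (K * V ^ 2 + 1)); [nra|].
    apply Rle_trans with (eps / (K * V ^ 2 + 1) * (K * V ^ 2 + 1)).
    - apply Rmult_le_compat_r; [lra|]. left. eapply Rlt_le_trans; [apply Hs | apply Rmin_r].
    - right. field. lra. }
  specialize (H ((s - t)%R * v)%C). rewrite Em in H. specialize (H R1).
  eapply Rle_trans; [apply H|]. rewrite Rpow_mult_distr.
  replace (K * (Rabs (s - t) ^ 2 * V ^ 2)) with (Rabs (s - t) * (K * V ^ 2) * Rabs (s - t)) by ring.
  apply Rmult_le_compat_r; assumption.
Qed.

(** The half-plane is convex, so the segment from [z] to [w] stays inside and the function is
    constant along it. This stands in for the path independence of integrals. *)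
Lemma cder_zero_const (f : C -> C) :
  (forall z, 0 < Im z -> cder f z 0) ->
  forall z w, 0 < Im z -> 0 < Im w -> f z = f w.
Proof.
  intros H z w Hz Hw.
  pose proof (@eq_is_derive C_R_NormedModule (fun t : R => f (z + t * (w - z))%C) 0 1) as E.
  replace z with (z + 0%R * (w - z))%C at 1 by ring.
  replace w with (z + 1%R * (w - z))%C at 2 by ring.
  apply E; [|lra]. intros t Ht.
  replace (@zero C_R_NormedModule) with ((w - z) * 0)%C by apply Cmult_0_r.
  apply cder_is_derive. apply H.
  rewrite Im_plus, Im_scal. unfold Cminus. rewrite Im_plus.
  replace (Im (- z)) with (- Im z) by reflexivity. nra.
Qed.

(** * Series in [e z] *)

(** The differences of [u] dominate [g], so the finite sums telescope. *)
Lemma sum_bounded_telescope (g u : nat -> R) :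
  (forall n, 0 <= g n) -> (forall n, 0 <= u n) ->
  (forall n, g n <= u n - u (S n)) -> sum_bounded g (u 0%nat).
Proof.
  intros Hg Hu H l N.
  apply Rle_trans with (rsum g (List.seq 0 (S (list_max l)))).
  - apply rsum_incl; try assumption. intros x Hx. apply in_seq.
    assert (Hm : (list_max l <= list_max l)%nat) by lia.
    rewrite list_max_le, Forall_forall in Hm. specialize (Hm x Hx). lia.
  - assert (E : forall M, rsum g (List.seq 0 M) <= u 0%nat - u M).
    { induction M as [|M IH]; [simpl; lra|].
      rewrite seq_S, rsum_app. simpl. specialize (H M). lra. }
    specialize (E (S (list_max l))). specialize (Hu (S (list_max l))). lra.
Qed.

Lemma sum_bounded_inv_square : sum_bounded (fun n => / INR (S n) ^ 2) 2.
Proof.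
  replace 2 with (2 / INR 1) by (simpl; field).
  apply (sum_bounded_telescope _ (fun n => 2 / INR (S n))).
  - intros n. left. apply Rinv_0_lt_compat, pow_lt, lt_0_INR. lia.
  - intros n. left. apply Rdiv_lt_0_compat; [lra|]. apply lt_0_INR. lia.
  - intros n. rewrite (S_INR (S n)).
    assert (P : 1 <= INR (S n)) by (rewrite S_INR; pose proof (pos_INR n); lra).
    set (x := INR (S n)) in *.
    replace (2 / x - 2 / (x + 1)) with (2 * / (x * (x + 1))) by (field; lra).
    apply Rmult_le_reg_r with (x ^ 2 * (x + 1)); [apply Rmult_lt_0_compat; nra|].
    replace (/ x ^ 2 * (x ^ 2 * (x + 1))) with (x + 1) by (field; lra).
    replace (2 * / (x * (x + 1)) * (x ^ 2 * (x + 1))) with (2 * x) by (field; lra).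
    lra.
Qed.

Lemma sum_bounded_inv_cube (a : R) :
  1 <= a -> sum_bounded (fun n => / (a + INR n) ^ 3) (2 / a ^ 2).
Proof.
  intros Ha.
  replace (2 / a ^ 2) with (2 / (a + INR 0) ^ 2)
    by (simpl INR; now rewrite Rplus_0_r).
  apply (sum_bounded_telescope _ (fun n => 2 / (a + INR n) ^ 2)).
  - intros n. pose proof (pos_INR n). left. apply Rinv_0_lt_compat, pow_lt. lra.
  - intros n. pose proof (pos_INR n). left. apply Rdiv_lt_0_compat; [lra|]. apply pow_lt. lra.
  - intros n. rewrite S_INR. pose proof (pos_INR n).
    replace (a + (INR n + 1)) with (a + INR n + 1) by ring.
    set (x := a + INR n) in *. assert (P : 1 <= x) by (unfold x; lra).
    replace (2 / x ^ 2 - 2 / (x + 1) ^ 2) with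
      ((2 * x * (2 * x + 1)) * / (x ^ 3 * (x + 1) ^ 2)) by (field; lra).
    apply Rmult_le_reg_r with (x ^ 3 * (x + 1) ^ 2).
    { apply Rmult_lt_0_compat; apply pow_lt; lra. }
    replace (/ x ^ 3 * (x ^ 3 * (x + 1) ^ 2)) with ((x + 1) ^ 2) by (field; lra).
    rewrite Rmult_assoc, Rinv_l.
    + nra.
    + apply Rmult_integral_contrapositive. split; apply pow_nonzero; lra.
Qed.

(** An integer is coded by its sign and its absolute value, whence the factor 2. *)
Lemma sum_bounded_Z (g : nat -> R) (K : R) :
  (forall n, 0 <= g n) -> sum_bounded g K ->
  sum_bounded (fun n : Z => g (Z.abs_nat n)) (2 * K).
Proof.
  intros Hg HK.
  apply (sum_bounded_inj (fun n : Z => (Z.leb 0 n, Z.abs_nat n)) (fun p => g (snd p))).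
  - intros i j E. injection E as E1 E2.
    destruct (Z.leb_spec 0 i), (Z.leb_spec 0 j); try discriminate; lia.
  - apply sum_bounded_fubini with (fun _ => K).
    + intros p. apply Hg.
    + intros b. apply HK.
    + intros l N. rewrite rsum_const.
      assert (length l <= 2)%nat.
      { apply (NoDup_incl_length (l' := true :: false :: nil) N). intros [|] _; simpl; auto. }
      assert (0 <= K).
      { specialize (HK nil (NoDup_nil _)). simpl in HK. assumption. }
      apply le_INR in H. change (INR 2) with 2 in H. apply Rmult_le_compat_r; assumption.
Qed.

Lemma abs_nat_IZR (n : Z) : INR (Z.abs_nat n) = Rabs (IZR n).
Proof.
  rewrite INR_IZR_INZ, Zabs2Nat.id_abs. apply abs_IZR.
Qed.

Lemma sum_bounded_Z_inv_square : sum_bounded (fun n : Z => / (1 + Rabs (IZR n)) ^ 2) 4.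
Proof.
  replace 4 with (2 * 2) by ring.
  apply sum_bounded_le with (fun n : Z => / INR (S (Z.abs_nat n)) ^ 2).
  - intros n. rewrite S_INR, abs_nat_IZR, Rplus_comm. lra.
  - apply (sum_bounded_Z (fun n => / INR (S n) ^ 2)); [|apply sum_bounded_inv_square].
    intros n. left. apply Rinv_0_lt_compat, pow_lt, lt_0_INR. lia.
Qed.

(** Summing over [n] costs one power and leaves the inverse square in [m]. The cube is the decay of
    a difference of two lattice terms of weight 2. *)
Lemma sum_bounded_Z2_inv_cube :
  sum_bounded (fun p : Z * Z => / (1 + Rabs (IZR (fst p)) + Rabs (IZR (snd p))) ^ 3) 16.
Proof.
  apply sum_bounded_fubini with (fun m => 4 * / (1 + Rabs (IZR m)) ^ 2).
  - intros [m n]. simpl fst; simpl snd.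
    pose proof (Rabs_pos (IZR m)). pose proof (Rabs_pos (IZR n)).
    left. apply Rinv_0_lt_compat, pow_lt. lra.
  - intros m. simpl fst; simpl snd. pose proof (Rabs_pos (IZR m)).
    apply sum_bounded_le with (fun n : Z => / ((1 + Rabs (IZR m)) + INR (Z.abs_nat n)) ^ 3).
    + intros n. rewrite abs_nat_IZR. lra.
    + replace (4 * / (1 + Rabs (IZR m)) ^ 2) with (2 * (2 / (1 + Rabs (IZR m)) ^ 2))
        by (unfold Rdiv; ring).
      apply (sum_bounded_Z (fun n => / ((1 + Rabs (IZR m)) + INR n) ^ 3)).
      * intros n. pose proof (pos_INR n). left. apply Rinv_0_lt_compat, pow_lt. lra.
      * apply sum_bounded_inv_cube. lra.
  - replace 16 with (4 * 4) by ring. apply sum_bounded_scal; [lra|].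
    apply sum_bounded_Z_inv_square.
Qed.

(** With [t = x / (r + 1)], raising [t <= exp t] to the power [r] gives [t ^ r <= exp x]. Dividing
    by [r + 1] instead of [r] covers [r = 0]. *)
Lemma pow_exp_bound (r : nat) :
  exists M, 0 <= M /\ forall x, 0 <= x -> x ^ r * exp (- x) <= M.
Proof.
  exists (INR (S r) ^ r). split; [apply pow_le, pos_INR|].
  intros x Hx. assert (P : 0 < INR (S r)) by (apply lt_0_INR; lia).
  set (t := x / INR (S r)).
  assert (Ht : 0 <= t) by (apply Rmult_le_pos; [assumption | left; now apply Rinv_0_lt_compat]).
  assert (Et : x = INR (S r) * t) by (unfold t; field; lra).
  assert (E : t ^ r <= exp x).
  { apply Rle_trans with (exp t ^ r).
    - apply pow_incr. pose proof (exp_ineq1_le t). lra.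
    - assert (Q : forall n, exp t ^ n = exp (INR n * t)).
      { induction n as [|n IH]; [simpl; now rewrite Rmult_0_l, exp_0|].
        rewrite S_INR. simpl. rewrite IH, <- exp_plus. f_equal. ring. }
      rewrite Q. apply exp_le_mono. rewrite Et, S_INR. nra. }
  rewrite Et at 1. rewrite Rpow_mult_distr, Rmult_assoc.
  rewrite <- (Rmult_1_r (INR (S r) ^ r)) at 2.
  apply Rmult_le_compat_l; [apply pow_le; lra|].
  apply Rle_trans with (exp x * exp (- x)).
  - apply Rmult_le_compat_r; [left; apply exp_pos | assumption].
  - rewrite <- exp_plus, Rplus_opp_r, exp_0. lra.
Qed.

(** * Coefficients of polynomial growth: convergence, decay and derivative *)

Definition poly_growth (p : nat) (a : nat -> C) : Prop :=
  exists K : R, 0 <= K /\ forall n, Cmod (a n) <= K * INR (S n) ^ p.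

(* The coefficient [a n] belongs to [e((n+1) z)]: there is no constant term. *)
Definition qterm (a : nat -> C) (z : C) (n : nat) : C := (a n * e (INR (S n) * z))%C.

Definition qser (a : nat -> C) (z : C) : C := csum (qterm a z).

(** With [N = n + 1] and [y = Im z], the term is at most [K N^p exp(-2 PI N y)]. Since [r >= p + 2],
    the factor [N^(p+2)] is absorbed in [N^r], and [(N y)^r exp(-2 PI N y)] is bounded. One estimate
    serves both summability, with [r = p + 2], and decay of any order at [i oo]. *)
Lemma qterm_bound (a : nat -> C) (p r : nat) :
  poly_growth p a -> (p + 2 <= r)%nat ->
  exists M, 0 <= M /\ forall z n, 0 < Im z ->
    Cmod (qterm a z n) * Im z ^ r <= M * / INR (S n) ^ 2.
Proof.
  intros [K [HK H]] Hr. destruct (pow_exp_bound r) as [M [HM Hx]].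
  exists (K * M). split; [now apply Rmult_le_pos|].
  intros z n Hz. unfold qterm. rewrite Cmod_mult, Cmod_e, Im_scal.
  assert (PN : 1 <= INR (S n)) by (rewrite S_INR; pose proof (pos_INR n); lra).
  specialize (H n). set (N := INR (S n)) in *. set (y := Im z) in *.
  pose proof PI2_3_2 as HPI.
  assert (PNy : 0 < N * y) by (apply Rmult_lt_0_compat; lra).
  assert (Q : (N * y) ^ r * exp (- (2 * PI * (N * y))) <= M).
  { eapply Rle_trans; [|apply (Hx (2 * PI * (N * y)))].
    - apply Rmult_le_compat_r; [left; apply exp_pos|]. apply pow_incr. split; [lra|]. nra.
    - nra. }
  apply Rmult_le_reg_r with (N ^ 2); [apply pow_lt; lra|].
  rewrite (Rmult_assoc (K * M)), Rinv_l, Rmult_1_r by (apply pow_nonzero; lra).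
  set (E := exp (- (2 * PI * (N * y)))) in *.
  assert (PE : 0 < E) by apply exp_pos.
  apply Rle_trans with (K * ((N * y) ^ r * E)); [|apply Rmult_le_compat_l; assumption].
  apply Rle_trans with (K * N ^ p * E * y ^ r * N ^ 2).
  - repeat apply Rmult_le_compat_r; try assumption; try (apply pow_le; lra). lra.
  - rewrite Rpow_mult_distr.
    replace (K * N ^ p * E * y ^ r * N ^ 2) with (K * (E * y ^ r) * N ^ (p + 2))
      by (rewrite pow_add; ring).
    replace (K * (N ^ r * y ^ r * E)) with (K * (E * y ^ r) * N ^ r) by ring.
    apply Rmult_le_compat_l.
    + repeat apply Rmult_le_pos; try lra. apply pow_le; lra.
    + now apply Rle_pow.
Qed.

Lemma qterm_sum_bounded (a : nat -> C) (p : nat) (z : C) :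
  poly_growth p a -> 0 < Im z -> summable (qterm a z).
Proof.
  intros Ha Hz. destruct (qterm_bound a p (p + 2) Ha (le_n _)) as [M [HM H]].
  assert (Py : 0 < Im z ^ (p + 2)) by now apply pow_lt.
  apply summable_le with (fun n => (M / Im z ^ (p + 2)) * / INR (S n) ^ 2)
                         (M / Im z ^ (p + 2) * 2).
  - intros n. specialize (H z n Hz).
    apply Rmult_le_reg_r with (Im z ^ (p + 2)); [assumption|].
    eapply Rle_trans; [apply H|]. right. field. split; [|lra].
    apply not_0_INR. lia.
  - apply sum_bounded_scal; [|apply sum_bounded_inv_square].
    apply Rmult_le_pos; [assumption|]. left. now apply Rinv_0_lt_compat.
Qed.

Lemma qser_has_sum (a : nat -> C) (p : nat) (z : C) :
  poly_growth p a -> 0 < Im z -> has_sum (qterm a z) (qser a z).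
Proof.
  intros Ha Hz. destruct (summable_has_sum _ (qterm_sum_bounded a p z Ha Hz)) as [s Hs].
  unfold qser. now rewrite (csum_eq _ s Hs).
Qed.

Lemma qser_decay (a : nat -> C) (p r : nat) :
  poly_growth p a -> (p + 2 <= r)%nat ->
  exists M, 0 <= M /\ forall z, 0 < Im z -> Cmod (qser a z) * Im z ^ r <= M.
Proof.
  intros Ha Hr. destruct (qterm_bound a p r Ha Hr) as [M [HM H]].
  exists (M * 2). split; [lra|]. intros z Hz.
  assert (Py : 0 < Im z ^ r) by now apply pow_lt.
  replace (Cmod (qser a z) * Im z ^ r) with (Cmod (RtoC (Im z ^ r) * qser a z)).
  2:{ rewrite Cmod_mult, Cmod_R, Rabs_pos_eq by lra. ring. }
  apply has_sum_bound with (fun n => RtoC (Im z ^ r) * qterm a z n)%C.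
  - apply has_sum_scal. now apply qser_has_sum with p.
  - apply sum_bounded_le with (fun n => M * / INR (S n) ^ 2).
    + intros n. rewrite Cmod_mult, Cmod_R, Rabs_pos_eq by lra.
      rewrite Rmult_comm. now apply H.
    + apply sum_bounded_scal; [assumption | apply sum_bounded_inv_square].
Qed.

(** Termwise differentiation: quadratic remainders whose constants [cb] are summable add up to a
    quadratic remainder. *)
Lemma has_sum_cder {I : Type} (f : I -> C -> C) (f' : I -> C) (F : C -> C) (z D : C)
    (cb : I -> R) (r K : R) :
  0 < r ->
  (forall h, Cmod h < r -> has_sum (fun i => f i (z + h)%C) (F (z + h)%C)) ->
  has_sum f' D ->
  (forall i h, Cmod h < r ->
     Cmod (f i (z + h)%C - f i z - h * f' i)%C <= Cmod h ^ 2 * cb i) ->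
  sum_bounded cb K -> cder F z D.
Proof.
  intros Hr HF HD HR HK.
  assert (PK : 0 <= K) by (specialize (HK nil (NoDup_nil _)); exact HK).
  exists r, K. repeat split; try assumption. intros h Hh.
  rewrite Rmult_comm.
  apply has_sum_bound with (fun i => f i (z + h)%C - f i z - h * f' i)%C.
  - apply has_sum_minus; [apply has_sum_minus|].
    + now apply HF.
    + assert (H0 : Cmod 0 < r) by now rewrite Cmod_0.
      specialize (HF 0 H0). now rewrite Cplus_0_r in HF.
    + now apply has_sum_scal.
  - apply sum_bounded_le with (fun i => Cmod h ^ 2 * cb i).
    + intros i. now apply HR.
    + apply sum_bounded_scal; [apply pow2_ge_0 | assumption].
Qed.

Definition twopii : C := (RtoC (2 * PI) * Ci)%C.

Lemma Cmod_twopii : Cmod twopii = 2 * PI.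
Proof.
  pose proof PI_RGT_0.
  unfold twopii. rewrite Cmod_mult, Cmod_Ci, Cmod_R, Rabs_pos_eq by lra. ring.
Qed.

Lemma twopii_neq_0 : twopii <> 0.
Proof.
  apply Cmod_gt_0. rewrite Cmod_twopii. pose proof PI_RGT_0. lra.
Qed.

Lemma poly_growth_mul_n (a : nat -> C) (p : nat) (c : C) :
  poly_growth p a -> poly_growth (S p) (fun n => c * INR (S n) * a n)%C.
Proof.
  intros [K [HK H]]. exists (Cmod c * K). split.
  - apply Rmult_le_pos; [apply Cmod_ge_0 | assumption].
  - intros n. rewrite !Cmod_mult, Cmod_R, Rabs_pos_eq by apply pos_INR.
    pose proof (Cmod_ge_0 c). pose proof (pos_INR (S n)).
    specialize (H n).
    replace (Cmod c * K * INR (S n) ^ S p) with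
      (Cmod c * INR (S n) * (K * INR (S n) ^ p)) by (simpl; ring).
    apply Rmult_le_compat_l; [|assumption]. now apply Rmult_le_pos.
Qed.

Lemma qser_cder (a : nat -> C) (p : nat) (z : C) :
  poly_growth p a -> 0 < Im z ->
  cder (qser a) z (qser (fun n => twopii * INR (S n) * a n)%C z).
Proof.
  intros Ha Hz.
  (* With [N = n + 1] and [w = 2 PI i N h], the remainder of a term is at most [4 |w|^2 exp |w|]
     times its modulus. For [|h| < Im z / 2] the factor [exp |w|] uses up at most half of the decay
     of [e (N z)], so the majorant is a series of the same kind at [z / 2], with coefficients
     [b]. *)
  set (b := fun n => (RtoC (4 * (2 * PI) ^ 2) * INR (S n) * (1 * INR (S n) * a n))%C).
  assert (Hb : poly_growth (S (S p)) b) by now apply poly_growth_mul_n, poly_growth_mul_n.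
  assert (Hz2 : 0 < Im (RtoC (/ 2) * z)) by (rewrite Im_scal; lra).
  destruct (qterm_sum_bounded b _ _ Hb Hz2) as [K HK].
  pose proof PI_RGT_0 as HPI.
  apply (has_sum_cder (fun n w => qterm a w n)
          (fun n => qterm (fun n => twopii * INR (S n) * a n)%C z n)
          (qser a) z _ (fun n => Cmod (qterm b (RtoC (/ 2) * z)%C n)) (Im z / 2) K).
  - lra.
  - intros h Hh. apply qser_has_sum with p; [assumption|]. apply Im_near. lra.
  - apply qser_has_sum with (S p); [|assumption]. now apply poly_growth_mul_n.
  - intros n h Hh. unfold qterm.
    set (N := INR (S n)). set (w := (twopii * N * h)%C).
    assert (PN : 0 < N) by (apply lt_0_INR; lia).
    replace (N * (z + h))%C with (N * z + N * h)%C by ring.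
    rewrite e_plus.
    replace (e (N * h)) with (cexp w)
      by (unfold e, w, twopii; f_equal; ring).
    replace (_ - _ - _)%C with (a n * e (N * z) * (cexp w - 1 - w))%C
      by (unfold w; ring).
    unfold b. rewrite !Cmod_mult, !Cmod_e, !Cmod_R, Rabs_R1.
    fold N. rewrite !Im_scal.
    assert (Ew : Cmod w = 2 * PI * N * Cmod h).
    { unfold w. rewrite !Cmod_mult, Cmod_twopii, Cmod_R, Rabs_pos_eq by lra. reflexivity. }
    pose proof (cexp_remainder w) as Hw.
    rewrite (Rabs_pos_eq N), (Rabs_pos_eq (4 * (2 * PI) ^ 2)) by nra.
    pose proof (Cmod_ge_0 (a n)). pose proof (Cmod_ge_0 h).
    assert (Hexp : exp (Cmod w) <= exp (2 * PI * (N * (/ 2 * Im z)))).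
    { apply exp_le_mono. rewrite Ew.
      assert (PI * N * Cmod h <= PI * N * (Im z / 2)).
      { apply Rmult_le_compat_l; [nra | lra]. }
      lra. }
    assert (E1 : exp (- (2 * PI * (N * Im z))) * exp (2 * PI * (N * (/ 2 * Im z)))
                 = exp (- (2 * PI * (N * (/ 2 * Im z))))).
    { rewrite <- exp_plus. f_equal. field. }
    apply Rle_trans with (Cmod (a n) * exp (- (2 * PI * (N * Im z))) *
       (4 * Cmod w ^ 2 * exp (2 * PI * (N * (/ 2 * Im z))))).
    + apply Rmult_le_compat_l.
      * apply Rmult_le_pos; [assumption | left; apply exp_pos].
      * eapply Rle_trans; [apply Hw|]. apply Rmult_le_compat_l; [|assumption].
        pose proof (pow2_ge_0 (Cmod w)). lra.
    + rewrite <- E1, Ew. right. ring.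
  - exact HK.
Qed.

(** * The Lipschitz formula *)

Lemma Cmod_neq (a b : C) : Cmod a < Cmod b -> a <> b.
Proof. intros H ->. lra. Qed.

Lemma Cmod_e_lt_1 (w : C) : 0 < Im w -> Cmod (e w) < 1.
Proof.
  intros H. rewrite Cmod_e, <- exp_0. apply exp_increasing.
  pose proof PI_RGT_0. nra.
Qed.

Lemma one_sub_neq_0 (u : C) : Cmod u < 1 -> (1 - u)%C <> 0.
Proof.
  intros H E. apply (Cmod_neq u 1).
  - now rewrite Cmod_1.
  - replace u with (1 - (1 - u))%C by ring. rewrite E. ring.
Qed.

(* [csc2 w = - 1 / (2 sin (PI w))^2] *)
Definition csc2 (w : C) : C := (e w / (1 - e w) ^ 2)%C.

(** With [u = e (w / 2)] this is [u / (1 - u)^2 - u / (1 + u)^2 = 4 u^2 / (1 - u^2)^2], the shift by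
    1/2 changing the sign of [u]. *)
Lemma csc2_double (w : C) :
  0 < Im w -> (csc2 (w / 2) + csc2 ((w + 1) / 2))%C = (4 * csc2 w)%C.
Proof.
  intros Hw. unfold csc2.
  assert (H2 : 0 < Im (w / 2)%C).
  { replace (w / 2)%C with (RtoC (/ 2) * w)%C by (rewrite RtoC_inv by lra; field).
    rewrite Im_scal. lra. }
  pose proof (Cmod_e_lt_1 _ H2) as Hu.
  replace ((w + 1) / 2)%C with (w / 2 + / 2)%C by field.
  rewrite e_plus, e_half.
  assert (Ew : e w = (e (w / 2) ^ 2)%C).
  { replace w with (w / 2 + w / 2)%C at 1 by field. rewrite e_plus. ring. }
  rewrite Ew. set (u := e (w / 2)) in *.
  assert (U1 : (1 - u)%C <> 0) by now apply one_sub_neq_0.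
  assert (U2 : (1 + u)%C <> 0).
  { replace (1 + u)%C with (1 - (- u))%C by ring. apply one_sub_neq_0. now rewrite Cmod_opp. }
  field. repeat split.
  - replace (1 - u ^ 2)%C with ((1 - u) * (1 + u))%C by ring. now apply Cmult_neq_0.
  - replace (1 - u * -1)%C with (1 + u)%C by ring. assumption.
  - assumption.
Qed.

(** Iterated duplication spreads [csc2 tau] over [2^j] points. For fixed [n] the rescaled term tends
    to [1 / (2 PI i (tau + n))^2], a term of the lattice sum. *)
Lemma csc2_dyadic (tau : C) (j : nat) :
  0 < Im tau ->
  csc2 tau = ((/ 4) ^ j * lsum (fun n : nat => csc2 ((tau + INR n) / 2 ^ j)) (List.seq 0 (2 ^ j)))%C.
Proof.
  intros Ht. induction j as [|j IH].
  - simpl. replace ((tau + 0) / 1)%C with tau by field. ring.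
  - rewrite IH.
    replace (2 ^ S j)%nat with (2 ^ j + 2 ^ j)%nat by (simpl; lia).
    rewrite seq_app, lsum_app, Nat.add_0_l.
    replace (List.seq (2 ^ j) (2 ^ j)) with (map (fun n => n + 2 ^ j)%nat (List.seq 0 (2 ^ j))).
    2:{ clear. generalize (2 ^ j)%nat at 2 4 as m. intros m.
        assert (G : forall k, map (fun n => n + 2 ^ j)%nat (List.seq k m) = List.seq (k + 2 ^ j) m).
        { induction m as [|m IH]; intros k; simpl; [reflexivity|]. now rewrite IH. }
        apply G. }
    rewrite lsum_map, <- lsum_plus.
    rewrite (lsum_ext (fun n => csc2 ((tau + INR n) / 2 ^ S j) +
      csc2 ((tau + INR (n + 2 ^ j)%nat) / 2 ^ S j))%C (fun n => 4 * csc2 ((tau + INR n) / 2 ^ j))%C).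
    + rewrite lsum_scal, Cpow_S. field.
    + intros n _.
      assert (P : (RtoC 2 ^ j)%C <> 0) by (apply Cpow_nz; intros E; apply RtoC_inj in E; lra).
      rewrite <- csc2_double.
      * f_equal; f_equal; rewrite ?Cpow_S; [field; assumption|].
        rewrite plus_INR, pow_INR, RtoC_plus, RtoC_pow.
        change (INR 2) with 2. field. assumption.
      * replace ((tau + INR n) / 2 ^ j)%C with (RtoC (/ 2 ^ j) * (tau + INR n))%C.
        -- rewrite Im_scal, Im_plus. change (Im (INR n)) with 0.
           apply Rmult_lt_0_compat; [|lra]. apply Rinv_0_lt_compat, pow_lt. lra.
        -- rewrite RtoC_inv, RtoC_pow by (apply pow_nonzero; lra). field. assumption.
Qed.

Lemma one_sub_cos_lower (t : R) : Rabs t <= 3 * (PI / 2) -> t ^ 2 / 288 <= 1 - cos t.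
Proof.
  intros Ht.
  (* Near 0 the quadratic bound for the sine suffices. Beyond 1 it is enough that
     [1 - cos s >= 1/8], because [s <= 6] gives [s^2 / 288 <= 1/8]. *)
  assert (Q : forall s, Rabs s <= 1 -> s ^ 2 / 8 <= 1 - cos s).
  { intros s Hs. rewrite one_sub_cos. pose proof (sin_sub_bound (s / 2)) as H.
    assert (E : Rabs (s / 2) = Rabs s / 2).
    { unfold Rdiv. rewrite Rabs_mult, (Rabs_pos_eq (/ 2)); lra. }
    assert (H2 : Rabs (s / 2) <= Rabs (sin (s / 2)) + (s / 2) ^ 2).
    { replace (s / 2) with (sin (s / 2) - (sin (s / 2) - s / 2)) at 1 by ring.
      eapply Rle_trans; [apply Rabs_triang|]. rewrite Rabs_Ropp. lra. }
    rewrite <- (pow2_abs (s / 2)), E in H2. rewrite <- (pow2_abs s), <- (pow2_abs (sin _)).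
    pose proof (Rabs_pos s). pose proof (Rabs_pos (sin (s / 2))).
    assert (Rabs s / 4 <= Rabs (sin (s / 2))) by nra. nra. }
  pose proof PI_4 as HPI. pose proof PI2_3_2.
  assert (Ec : cos t = cos (Rabs t)).
  { unfold Rabs. destruct (Rcase_abs t); [now rewrite cos_neg | reflexivity]. }
  rewrite Ec, <- (pow2_abs t). pose proof (Rabs_pos t).
  set (s := Rabs t) in *.
  destruct (Rle_dec s 1) as [H1|H1].
  - specialize (Q s). rewrite Rabs_pos_eq in Q by assumption. specialize (Q H1). nra.
  - assert (1 / 8 <= 1 - cos s); [|nra].
    destruct (Rle_dec s PI) as [H2|H2].
    + assert (cos s <= cos 1) by (apply cos_decr_1; lra).
      specialize (Q 1). rewrite Rabs_R1 in Q. specialize (Q (Rle_refl 1)). lra.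
    + assert (cos s <= 0) by (apply cos_le_0; lra). lra.
Qed.

(** In the closure of this rectangle [e w = 1] only at [w = 0]. The width 3/4, more than half a
    period, leaves room for the real part of [tau] later on. With [v = 2 PI Im w] and
    [t = 2 PI Re w], one has [|1 - e w|^2 = (1 - exp(-v))^2 + 2 exp(-v) (1 - cos t)]; the two parts
    of [c0] come from [1 - exp(-v) >= v / 9], valid as [v <= 8], and from the bound for the
    cosine. *)
Lemma one_sub_e_lower :
  exists c, 0 < c /\ forall w, Rabs (Re w) <= 3 / 4 -> 0 < Im w <= 1 ->
    c * Cmod (twopii * w) <= Cmod (1 - e w).
Proof.
  set (c0 := Rmin (/ 81) (exp (- (2 * PI)) / 144)).
  assert (P0 : 0 < c0).
  { apply Rmin_glb_lt; [lra|]. apply Rdiv_lt_0_compat; [apply exp_pos | lra]. }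
  assert (P1 : c0 <= / 81) by apply Rmin_l.
  assert (P2 : c0 <= exp (- (2 * PI)) / 144) by apply Rmin_r.
  exists c0. split; [assumption|]. intros w HR HI.
  pose proof PI_RGT_0 as HPI. pose proof PI_4 as HPI4.
  set (v := 2 * PI * Im w). set (t := 2 * PI * Re w).
  assert (Hv : 0 < v <= 2 * PI) by (unfold v; split; nra).
  assert (Ht : Rabs t <= 3 * (PI / 2)).
  { unfold t. rewrite Rabs_mult, Rabs_pos_eq by lra. nra. }
  apply Rsqr_incr_0_var; [|apply Cmod_ge_0].
  rewrite !Rsqr_pow2, Rpow_mult_distr.
  replace (Cmod (twopii * w) ^ 2) with (v ^ 2 + t ^ 2).
  2:{ rewrite Cmod_mult, Cmod_twopii, Rpow_mult_distr, Cmod2_alt. unfold v, t. ring. }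
  replace (Cmod (1 - e w) ^ 2) with ((1 - exp (- v)) ^ 2 + 2 * exp (- v) * (1 - cos t)).
  2:{ rewrite Cmod2_alt. unfold e, cexp.
      replace (Re (RtoC (2 * PI) * (Ci * w))%C) with (- v)
        by (unfold v, Ci, RtoC, Cmult, Re, Im; simpl; ring).
      replace (Im (RtoC (2 * PI) * (Ci * w))%C) with t
        by (unfold t, Ci, RtoC, Cmult, Re, Im; simpl; ring).
      unfold Cminus, Cplus, Copp, RtoC; simpl.
      pose proof (sin2_cos2 t) as E. unfold Rsqr in E.
      replace ((1 + - (exp (- v) * cos t)) * ((1 + - (exp (- v) * cos t)) * 1) +
        (0 + - (exp (- v) * sin t)) * ((0 + - (exp (- v) * sin t)) * 1))
        with (1 - 2 * exp (- v) * cos t + exp (- v) ^ 2 * (sin t * sin t + cos t * cos t)) by ring.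
      rewrite E. ring. }
  pose proof (one_sub_cos_lower t Ht).
  assert (E1 : v / 9 <= 1 - exp (- v)).
  { pose proof (exp_ineq1_le v). pose proof (exp_pos (- v)).
    assert (exp v * exp (- v) = 1) by (rewrite <- exp_plus, Rplus_opp_r; apply exp_0).
    assert ((1 + v) * exp (- v) <= 1) by nra. nra. }
  assert (E2 : exp (- (2 * PI)) <= exp (- v)) by (apply exp_le_mono; lra).
  pose proof (pow2_ge_0 t).
  assert (A1 : c0 * v ^ 2 <= (1 - exp (- v)) ^ 2) by nra.
  assert (A2 : c0 * t ^ 2 <= 2 * exp (- v) * (1 - cos t)).
  { apply Rle_trans with (2 * exp (- v) * (t ^ 2 / 288)).
    - apply Rle_trans with (exp (- v) / 144 * t ^ 2); [|right; field].
      apply Rmult_le_compat_r; [assumption | lra].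
    - apply Rmult_le_compat_l; [|assumption]. pose proof (exp_pos (- v)). lra. }
  assert (c0 ^ 2 <= c0) by nra.
  pose proof (pow2_ge_0 v). nra.
Qed.

(** The double pole at 0, with a remainder of order [1 / |w|]. With [y = 2 PI i w] and
    [exp y = 1 + y + r], the numerator of the difference is of order [|y|^3] and its denominator of
    order [|y|^4]. *)
Lemma csc2_approx :
  exists K, 0 <= K /\ forall w, Rabs (Re w) <= 3 / 4 -> 0 < Im w <= 1 ->
    Cmod (csc2 w - / (twopii * w) ^ 2) <= K / Cmod w.
Proof.
  destruct one_sub_e_lower as [c [Hc HL]].
  (* [B] bounds [|2 PI i w|]: on the rectangle [|w| <= 7/4], and [PI <= 4]. *)
  set (B := 14). set (A := 4 * exp B).
  assert (PA : 0 <= A) by (unfold A; pose proof (exp_pos B); lra).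
  set (M := 1 + A * B + 2 * A + A ^ 2 * B).
  assert (PM : 0 <= M) by (unfold M, B; nra).
  exists (M / c ^ 2). split.
  { apply Rmult_le_pos; [assumption|]. left. apply Rinv_0_lt_compat, pow_lt. assumption. }
  intros w HR HI. specialize (HL w HR HI).
  pose proof PI_RGT_0 as HPI. pose proof PI_4 as HPI4. pose proof PI2_3_2 as HPI2.
  assert (Pw : 0 < Cmod w).
  { eapply Rlt_le_trans; [|apply Rabs_im_le_Cmod]. rewrite Rabs_pos_eq; lra. }
  assert (Hw0 : w <> 0) by now apply Cmod_gt_0.
  set (y := (twopii * w)%C) in *.
  assert (Ey : Cmod y = 2 * PI * Cmod w) by (unfold y; now rewrite Cmod_mult, Cmod_twopii).
  assert (Hwb : Cmod w <= 7 / 4).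
  { eapply Rle_trans; [apply Cmod_le_parts|]. rewrite (Rabs_pos_eq (Im w)) by lra. lra. }
  assert (HyB : Cmod y <= B) by (unfold B; nra).
  assert (Hwy : Cmod w <= Cmod y) by nra.
  assert (Py : 0 < Cmod y) by lra.
  assert (Hy0 : y <> 0) by now apply Cmod_gt_0.
  replace (e w) with (cexp y) in HL by (unfold e, y, twopii; f_equal; ring).
  unfold csc2. replace (e w) with (cexp y) by (unfold e, y, twopii; f_equal; ring).
  pose proof (cexp_remainder y) as Hr. set (E := cexp y) in *.
  set (r := (E - 1 - y)%C) in *.
  assert (HE0 : (1 - E)%C <> 0).
  { apply Cmod_gt_0. eapply Rlt_le_trans; [|apply HL]. now apply Rmult_lt_0_compat. }
  set (Y := Cmod y) in *.
  assert (Hr' : Cmod r <= A * Y ^ 2).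
  { eapply Rle_trans; [apply Hr|]. unfold A.
    assert (exp Y <= exp B) by now apply exp_le_mono.
    pose proof (pow2_ge_0 Y). nra. }
  replace (E / (1 - E) ^ 2 - / y ^ 2)%C
    with ((y ^ 2 * (y + r) - 2 * y * r - r ^ 2) * / (y ^ 2 * (1 - E) ^ 2))%C.
  2:{ unfold r. field. split; assumption. }
  rewrite Cmod_mult, Cmod_inv, Cmod_mult, !Cmod_pow by (apply Cmult_neq_0; apply Cpow_nz; assumption).
  fold Y.
  assert (Hnum : Cmod (y ^ 2 * (y + r) - 2 * y * r - r ^ 2) <= M * Y ^ 3).
  { assert (N1 : Cmod (y ^ 2 * (y + r)) <= Y ^ 2 * (Y + A * Y ^ 2)).
    { rewrite Cmod_mult, Cmod_pow. fold Y. apply Rmult_le_compat_l; [apply pow2_ge_0|].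
      eapply Rle_trans; [apply Cmod_triangle|]. fold Y. lra. }
    assert (N2 : Cmod (2 * y * r) <= 2 * Y * (A * Y ^ 2)).
    { rewrite !Cmod_mult, Cmod_R, Rabs_pos_eq by lra. fold Y.
      apply Rmult_le_compat_l; [lra | assumption]. }
    assert (N3 : Cmod (r ^ 2) <= (A * Y ^ 2) ^ 2).
    { rewrite Cmod_pow. apply pow_incr. split; [apply Cmod_ge_0 | assumption]. }
    assert (T : Cmod (y ^ 2 * (y + r) - 2 * y * r - r ^ 2) <=
       Cmod (y ^ 2 * (y + r)) + Cmod (2 * y * r) + Cmod (r ^ 2)).
    { eapply Rle_trans; [apply Cmod_triangle|]. rewrite Cmod_opp. apply Rplus_le_compat_r.
      eapply Rle_trans; [apply Cmod_triangle|]. rewrite Cmod_opp. lra. }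
    assert (Y4 : Y ^ 4 <= B * Y ^ 3).
    { replace (Y ^ 4) with (Y * Y ^ 3) by ring. apply Rmult_le_compat_r; [|assumption].
      apply pow_le. lra. }
    assert (A * Y ^ 4 <= A * (B * Y ^ 3)) by now apply Rmult_le_compat_l.
    assert (A ^ 2 * Y ^ 4 <= A ^ 2 * (B * Y ^ 3)) by (apply Rmult_le_compat_l; [apply pow2_ge_0 | assumption]).
    unfold M. simpl in *. lra. }
  assert (Hden : Y ^ 2 * (c * Y) ^ 2 <= Y ^ 2 * Cmod (1 - E) ^ 2).
  { apply Rmult_le_compat_l; [apply pow2_ge_0|]. apply pow_incr. split; [|assumption].
    apply Rmult_le_pos; lra. }
  assert (Pd : 0 < Y ^ 2 * (c * Y) ^ 2).
  { apply Rmult_lt_0_compat; apply pow_lt; [lra|]. apply Rmult_lt_0_compat; lra. }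
  apply Rle_trans with (M * Y ^ 3 * / (Y ^ 2 * (c * Y) ^ 2)).
  - apply Rmult_le_compat; try assumption; try apply Cmod_ge_0.
    + left. apply Rinv_0_lt_compat. lra.
    + now apply Rinv_le_contravar.
  - replace (M * Y ^ 3 * / (Y ^ 2 * (c * Y) ^ 2)) with (M / c ^ 2 * / Y) by (field; lra).
    apply Rmult_le_compat_l; [|now apply Rinv_le_contravar].
    apply Rmult_le_pos; [assumption|]. left. apply Rinv_0_lt_compat, pow_lt. assumption.
Qed.

(** [tau] and 1 are independent over the reals: the imaginary part controls [a], then the triangle
    inequality controls [b]. *)
Lemma lattice_lower (tau : C) :
  0 < Im tau -> exists c, 0 < c /\ forall a b : R,
    c * (Rabs a + Rabs b) <= Cmod (a * tau + b).
Proof.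
  intros Ht. set (y := Im tau) in *. pose proof (Cmod_ge_0 tau) as P.
  set (Q := 1 + (1 + Cmod tau) / y).
  assert (PQ : 0 < Q).
  { unfold Q. assert (0 < (1 + Cmod tau) / y) by (apply Rdiv_lt_0_compat; lra). lra. }
  exists (/ Q). split; [now apply Rinv_0_lt_compat|]. intros a b.
  set (X := Cmod (a * tau + b)).
  assert (H1 : Rabs a * y <= X).
  { eapply Rle_trans; [|apply Rabs_im_le_Cmod]. rewrite Im_plus, Im_scal.
    change (Im b) with 0. rewrite Rplus_0_r, Rabs_mult, (Rabs_pos_eq (Im tau)); fold y; lra. }
  assert (H2 : Rabs b <= X + Rabs a * Cmod tau).
  { replace (Rabs b) with (Cmod ((a * tau + b) - a * tau)).
    - eapply Rle_trans; [apply Cmod_triangle|]. rewrite Cmod_opp, Cmod_mult, Cmod_R.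
      unfold X. lra.
    - rewrite <- Cmod_R. f_equal. ring. }
  assert (H3 : Rabs a <= X / y).
  { apply Rmult_le_reg_r with y; [assumption|]. replace (X / y * y) with X by (field; lra). assumption. }
  apply Rmult_le_reg_l with Q; [assumption|]. rewrite <- Rmult_assoc, Rinv_r, Rmult_1_l by lra.
  unfold Q. assert (Rabs a * Cmod tau <= X / y * Cmod tau) by now apply Rmult_le_compat_r.
  replace ((1 + (1 + Cmod tau) / y) * X) with (X + X / y + X / y * Cmod tau) by (field; lra).
  lra.
Qed.

Lemma upper_plus_R_neq_0 (tau : C) (x : R) : 0 < Im tau -> (tau + x)%C <> 0.
Proof.
  intros H E. apply (f_equal Im) in E. rewrite Im_plus in E.
  change (Im x) with 0 in E. change (Im 0) with 0 in E. lra.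
Qed.

Lemma inv_pow_sum_bounded {I : Type} (x : I -> C) (rho : I -> R) (c K : R) (m d : nat) :
  0 < c -> (forall i, 1 <= rho i) -> (forall i, c * rho i <= Cmod (x i)) ->
  sum_bounded (fun i => / rho i ^ d) K -> (d <= m)%nat ->
  sum_bounded (fun i => / Cmod (x i) ^ m) (/ c ^ m * K).
Proof.
  intros Hc Hr Hx HK Hm.
  assert (Pc : 0 < c ^ m) by now apply pow_lt.
  apply sum_bounded_le with (fun i => / c ^ m * / rho i ^ d).
  - intros i. rewrite <- Rinv_mult. specialize (Hr i). specialize (Hx i).
    assert (P : 0 < rho i ^ d) by (apply pow_lt; lra).
    apply Rinv_le_contravar; [now apply Rmult_lt_0_compat|].
    apply Rle_trans with (c ^ m * rho i ^ m).
    + apply Rmult_le_compat_l; [lra|]. now apply Rle_pow.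
    + rewrite <- Rpow_mult_distr. apply pow_incr. split; [|assumption].
      apply Rmult_le_pos; lra.
  - apply sum_bounded_scal; [|assumption]. left. now apply Rinv_0_lt_compat.
Qed.

Lemma row_sum_bounded (tau : C) (m : nat) :
  0 < Im tau -> (2 <= m)%nat ->
  exists K, sum_bounded (fun n : Z => / Cmod (tau + IZR n) ^ m) K.
Proof.
  intros Ht Hm. destruct (lattice_lower tau Ht) as [c [Hc H]].
  exists (/ c ^ m * 4).
  apply inv_pow_sum_bounded with (fun n : Z => 1 + Rabs (IZR n)) 2%nat; try assumption.
  - intros n. pose proof (Rabs_pos (IZR n)). lra.
  - intros n. specialize (H 1 (IZR n)). rewrite Rabs_R1 in H.
    now replace (1 * tau + IZR n)%C with (tau + IZR n)%C in H by ring.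
  - apply sum_bounded_Z_inv_square.
Qed.

Lemma row_summable (tau : C) (m : nat) :
  0 < Im tau -> (2 <= m)%nat -> summable (fun n : Z => / (tau + IZR n) ^ m)%C.
Proof.
  intros Ht Hm. destruct (row_sum_bounded tau m Ht Hm) as [K HK].
  apply summable_le with (2 := HK). intros n.
  rewrite Cmod_inv, Cmod_pow by (apply Cpow_nz; now apply upper_plus_R_neq_0). lra.
Qed.

(** Partial fraction expansion of [1 / sin^2]. The sum exists by absolute convergence. To identify
    it, the dyadic formula with [2 N] points, [N = 2^j], recentred on [-N <= n < N], is compared
    with the lattice sum term by term. Each error is at most [A / (2 N)] times [1 / |tau + n|];
    bounding the latter by [d + 1 / (d |tau + n|^2)] makes the total at most
    [A d + A K / (2 N d)]. *)
Lemma csc2_lattice_sum (tau : C) :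
  0 < Im tau -> has_sum (fun n : Z => / (twopii * (tau + IZR n)) ^ 2)%C (csc2 tau).
Proof.
  intros Ht.
  destruct (row_sum_bounded tau 2 Ht (le_n _)) as [K HK].
  pose proof (row_summable tau 2 Ht (le_n _)) as Hsum.
  apply summable_has_sum in Hsum. destruct Hsum as [s Hs].
  apply (has_sum_scal (/ twopii ^ 2)) in Hs.
  set (s' := (/ twopii ^ 2 * s)%C) in *.
  apply (has_sum_ext _ (fun n : Z => / (twopii * (tau + IZR n)) ^ 2)%C) in Hs.
  2:{ intros n. pose proof twopii_neq_0. pose proof (upper_plus_R_neq_0 tau (IZR n) Ht).
      field. split; assumption. }
  replace (csc2 tau) with s'; [assumption|].
  destruct csc2_approx as [A [HA Happ]].
  apply NNPP. intros Hn.
  set (eps := Cmod (s' - csc2 tau)).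
  assert (Heps : 0 < eps).
  { apply Cmod_gt_0. intros E. apply Hn.
    replace s' with ((s' - csc2 tau) + csc2 tau)%C by ring. rewrite E. ring. }
  destruct (Hs (eps / 3)) as [l0 Hl0]; [lra|].
  assert (PK : 0 <= K) by (specialize (HK nil (NoDup_nil _)); exact HK).
  set (d := eps / (3 * (A + 1))).
  assert (Pd : 0 < d) by (unfold d; apply Rdiv_lt_0_compat; lra).
  (* The summands ensure in turn that the rescaled points have real part at most 3/4 in absolute
     value and imaginary part at most 1, that [A K / (2 N d)] is at most [eps / 3], and that the
     range of [n] contains [l0]. *)
  destruct (INR_unbounded (2 * Rabs (Re tau) + Im tau + A * K / d * 3 / eps
     + INR (list_max (map Z.abs_nat l0)))) as [j Hj].
  assert (P1 : 0 <= A * K / d * 3 / eps).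
  { repeat apply Rmult_le_pos; try lra; left; apply Rinv_0_lt_compat; lra. }
  pose proof (Rabs_pos (Re tau)) as P2.
  pose proof (pos_INR (list_max (map Z.abs_nat l0))) as P3.
  assert (Hjp : INR j < 2 ^ j).
  { change 2 with (INR 2). rewrite <- pow_INR. apply lt_INR. apply Nat.pow_gt_lin_r. lia. }
  set (N := 2 ^ j) in *.
  assert (PN : 0 < N) by (unfold N; apply pow_lt; lra).
  assert (EN : IZR (2 ^ Z.of_nat j) = N) by (unfold N; symmetry; apply pow_IZR).
  set (L := map (fun n : nat => (Z.of_nat n - 2 ^ Z.of_nat j)%Z) (List.seq 0 (2 ^ S j))).
  assert (NL : NoDup L).
  { apply NoDup_map_NoDup_ForallPairs; [|apply seq_NoDup]. intros x y _ _ E. lia. }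
  assert (HinL : forall n : Z, In n L <-> (- 2 ^ Z.of_nat j <= n < 2 ^ Z.of_nat j)%Z).
  { intros n. unfold L. rewrite in_map_iff.
    assert (E2 : Z.of_nat (2 ^ S j) = (2 * 2 ^ Z.of_nat j)%Z).
    { rewrite Nat.pow_succ_r', Nat2Z.inj_mul, Nat2Z.inj_pow. reflexivity. }
    split.
    - intros [x [<- Hx]]. apply in_seq in Hx. lia.
    - intros Hx. exists (Z.to_nat (n + 2 ^ Z.of_nat j)). split; [lia|]. apply in_seq. lia. }
  assert (HL : incl l0 L).
  { intros n Hin. apply HinL.
    assert (Hm : (list_max (map Z.abs_nat l0) <= list_max (map Z.abs_nat l0))%nat) by lia.
    rewrite list_max_le, Forall_forall in Hm.
    specialize (Hm _ (in_map Z.abs_nat _ _ Hin)). apply le_INR in Hm.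
    rewrite abs_nat_IZR in Hm.
    assert (Hlt : Rabs (IZR n) < N) by lra.
    apply Rabs_def2 in Hlt. rewrite <- EN, <- opp_IZR in Hlt.
    destruct Hlt as [L1 L2]. apply lt_IZR in L1. apply lt_IZR in L2. lia. }
  specialize (Hl0 L NL HL).
  assert (Pz : RtoC (2 * N) <> 0) by (intros E; apply RtoC_inj in E; lra).
  assert (Ecsc : csc2 tau = lsum (fun n : Z => / RtoC (2 * N) ^ 2 * csc2 ((tau + IZR n) / RtoC (2 * N)))%C L).
  { rewrite lsum_scal.
    (* The period 1 allows the shift by [-N] that centres the range at 0. *)
    replace (csc2 tau) with (csc2 (tau + IZR (- 2 ^ Z.of_nat j))).
    2:{ unfold csc2. now rewrite e_period. }
    rewrite (csc2_dyadic _ (S j)).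
    2:{ rewrite Im_plus. change (Im (IZR (- 2 ^ Z.of_nat j))) with 0. lra. }
    unfold L. rewrite lsum_map. f_equal.
    - rewrite <- RtoC_pow, <- RtoC_inv, <- RtoC_inv by (try apply pow_nonzero; lra).
      rewrite <- RtoC_pow. f_equal. unfold N.
      replace (/ 4) with (/ 2 * / 2) by field.
      rewrite Rpow_mult_distr, !pow_inv. simpl. field. apply pow_nonzero. lra.
    - apply lsum_ext. intros n _. f_equal. f_equal.
      + rewrite minus_IZR, opp_IZR, RtoC_minus, RtoC_opp, INR_IZR_INZ. ring.
      + rewrite <- RtoC_pow. reflexivity. }
  assert (Hdiff : Cmod (csc2 tau - lsum (fun n : Z => / (twopii * (tau + IZR n)) ^ 2)%C L)
            <= eps / 3 + eps / 3).
  { rewrite Ecsc.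
    replace (_ - _)%C with (lsum (fun n : Z => / RtoC (2 * N) ^ 2 *
       (csc2 ((tau + IZR n) / RtoC (2 * N)) - / (twopii * ((tau + IZR n) / RtoC (2 * N))) ^ 2))%C L).
    2:{ symmetry. rewrite <- (Cplus_0_r (_ - _)), <- (lsum_zero L).
        replace (lsum (fun n : Z => / (twopii * (tau + IZR n)) ^ 2)%C L) with
         (lsum (fun n : Z => / RtoC (2 * N) ^ 2 * / (twopii * ((tau + IZR n) / RtoC (2 * N))) ^ 2)%C L).
        - rewrite !lsum_scal, lsum_zero.
          replace (lsum (fun i : Z => _ - _)%C L) with
            (lsum (fun n : Z => csc2 ((tau + IZR n) / RtoC (2 * N))) L +
             -1 * lsum (fun n : Z => / (twopii * ((tau + IZR n) / RtoC (2 * N))) ^ 2) L)%C.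
          + ring.
          + rewrite <- lsum_scal, <- lsum_plus. apply lsum_ext. intros. ring.
        - apply lsum_ext. intros n _. pose proof twopii_neq_0.
          pose proof (upper_plus_R_neq_0 tau (IZR n) Ht). field. repeat split; assumption. }
    eapply Rle_trans; [apply Cmod_lsum|].
    apply Rle_trans with (rsum (fun n : Z => A / (2 * N) * (d + / d * / Cmod (tau + IZR n) ^ 2)) L).
    - apply rsum_le. intros n Hin. apply HinL in Hin.
      pose proof (upper_plus_R_neq_0 tau (IZR n) Ht) as Hz. apply Cmod_gt_0 in Hz.
      rewrite Cmod_mult, Cmod_inv, Cmod_pow, Cmod_R, Rabs_pos_eq by (try (apply Cpow_nz; assumption); lra).
      assert (HnN : Rabs (IZR n) <= N).
      { rewrite <- EN. apply Rabs_le. rewrite <- opp_IZR. split; apply IZR_le; lia. }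
      replace ((tau + IZR n) / RtoC (2 * N))%C with (RtoC (/ (2 * N)) * (tau + IZR n))%C
        by (rewrite RtoC_inv by lra; field; assumption).
      assert (Pi : 0 < / (2 * N)) by (apply Rinv_0_lt_compat; lra).
      apply Rle_trans with (/ (2 * N) ^ 2 * (A / Cmod (RtoC (/ (2 * N)) * (tau + IZR n)))).
      + apply Rmult_le_compat_l; [left; apply Rinv_0_lt_compat, pow_lt; lra|].
        apply Happ.
        * rewrite Re_scal, Re_plus, Rabs_mult, (Rabs_pos_eq (/ (2 * N))) by lra.
          change (Re (IZR n)) with (IZR n).
          apply Rmult_le_reg_l with (2 * N); [lra|].
          rewrite <- Rmult_assoc, Rinv_r, Rmult_1_l by lra.
          eapply Rle_trans; [apply Rabs_triang|]. lra.
        * rewrite Im_scal, Im_plus. change (Im (IZR n)) with 0. split.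
          -- apply Rmult_lt_0_compat; lra.
          -- apply Rmult_le_reg_l with (2 * N); [lra|].
             rewrite <- Rmult_assoc, Rinv_r, Rmult_1_l by lra. lra.
      + rewrite Cmod_mult, Cmod_R, (Rabs_pos_eq (/ (2 * N))) by lra.
        set (x := Cmod (tau + IZR n)) in *.
        replace (/ (2 * N) ^ 2 * (A / (/ (2 * N) * x))) with (A / (2 * N) * / x) by (field; lra).
        apply Rmult_le_compat_l; [apply Rmult_le_pos; lra|].
        set (u := / x). replace (/ x ^ 2) with (u ^ 2) by (unfold u; field; lra).
        (* AM-GM: [u <= d + u^2 / d] *)
        apply Rmult_le_reg_l with d; [assumption|].
        replace (d * (d + / d * u ^ 2)) with (d ^ 2 + u ^ 2) by (field; lra).
        pose proof (pow2_ge_0 (d - u)). pose proof (pow2_ge_0 (d + u)). lra.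
    - rewrite rsum_scal, rsum_plus, rsum_const, rsum_scal.
      specialize (HK L NL).
      assert (EL : INR (length L) = 2 * N).
      { unfold L. rewrite length_map, length_seq, pow_INR. change (INR 2) with 2. unfold N. simpl. ring. }
      rewrite EL. rewrite Rmult_plus_distr_l. apply Rplus_le_compat.
      + replace (A / (2 * N) * (2 * N * d)) with (A * d) by (field; lra).
        unfold d. apply Rle_trans with ((A + 1) * (eps / (3 * (A + 1)))).
        * apply Rmult_le_compat_r; [fold d; lra | lra].
        * right. field. lra.
      + apply Rle_trans with (A / (2 * N) * (/ d * K)).
        * apply Rmult_le_compat_l.
          -- apply Rmult_le_pos; [assumption|]. left. apply Rinv_0_lt_compat. lra.
          -- apply Rmult_le_compat_l; [|assumption]. left. now apply Rinv_0_lt_compat.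
        * assert (HN : A * K / d * 3 / eps <= 2 * N) by lra.
          apply Rmult_le_reg_r with (2 * N * 3 / eps).
          { apply Rdiv_lt_0_compat; lra. }
          replace (A / (2 * N) * (/ d * K) * (2 * N * 3 / eps)) with (A * K / d * 3 / eps) by (field; lra).
          replace (eps / 3 * (2 * N * 3 / eps)) with (2 * N) by (field; lra). assumption. }
  assert (eps <= Cmod (csc2 tau - lsum (fun n : Z => / (twopii * (tau + IZR n)) ^ 2)%C L)
      + Cmod (lsum (fun n : Z => / (twopii * (tau + IZR n)) ^ 2)%C L - s')); [|lra].
  unfold eps. rewrite <- (Cmod_opp (s' - csc2 tau)).
  replace (- (s' - csc2 tau))%C with
   ((csc2 tau - lsum (fun n : Z => / (twopii * (tau + IZR n)) ^ 2)%C L) +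
    (lsum (fun n : Z => / (twopii * (tau + IZR n)) ^ 2)%C L - s'))%C by ring.
  apply Cmod_triangle.
Qed.

Lemma has_sum_shift (f : nat -> C) (s : C) :
  f 0%nat = 0 -> has_sum (fun n => f (S n)) s -> has_sum f s.
Proof.
  intros H0. apply (has_sum_extend S f).
  - intros i j E. now injection E.
  - intros [|j] Hj; [assumption|]. now destruct (Hj j).
Qed.

Lemma poly_growth_pow (p : nat) : poly_growth p (fun n => RtoC (INR (S n)) ^ p)%C.
Proof.
  exists 1. split; [lra|]. intros n.
  rewrite Cmod_pow, Cmod_R, Rabs_pos_eq by apply pos_INR. lra.
Qed.

(** [u / (1 - u)^2] is the sum of [N u^N]. The series is multiplied twice by [1 - u], each time as a
    shift of the index: the first product is the geometric series, the second its leading term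
    [u]. *)
Lemma csc2_qser (tau : C) :
  0 < Im tau -> csc2 tau = qser (fun n => RtoC (INR (S n)) ^ 1)%C tau.
Proof.
  intros Ht. pose proof (qser_has_sum _ 1 tau (poly_growth_pow 1) Ht) as H.
  set (s := qser _ tau) in *. pose proof (Cmod_e_lt_1 tau Ht) as Hu.
  set (u := e tau) in *.
  apply (has_sum_ext _ (fun n => INR (S n) * u ^ S n)%C) in H.
  2:{ intros n. unfold qterm. rewrite e_mul_nat. fold u. now rewrite Cpow_1_r. }
  assert (H1 : has_sum (fun n => u ^ S n)%C (s - u * s)%C).
  { assert (H2 : has_sum (fun n => INR n * u ^ S n)%C (u * s)%C).
    { apply has_sum_shift; [simpl; ring|].
      refine (has_sum_ext _ _ _ _ (has_sum_scal u _ _ H)).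
      intros n. rewrite !Cpow_S. ring. }
    refine (has_sum_ext _ _ _ _ (has_sum_minus _ _ _ _ H H2)).
    intros n. rewrite S_INR, RtoC_plus. ring. }
  assert (H2 : has_sum (fun n => if Nat.eqb n 0 then 0 else u ^ S n)%C (u * (s - u * s))%C).
  { apply has_sum_shift; [reflexivity|].
    refine (has_sum_ext _ _ _ _ (has_sum_scal u _ _ H1)). intros n. reflexivity. }
  pose proof (has_sum_minus _ _ _ _ H1 H2) as H3.
  assert (H4 : has_sum (fun n => u ^ S n - (if Nat.eqb n 0 then 0 else u ^ S n))%C u).
  { set (F := fun n : nat => _).
    replace u with (lsum F (0%nat :: nil)) by (unfold F; simpl; ring).
    apply has_sum_finite; [repeat constructor; simpl; tauto|].
    intros [|n] Hn; [destruct Hn; now left | unfold F; simpl; ring]. }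
  pose proof (has_sum_unique _ _ _ H3 H4) as E.
  unfold csc2. fold u. assert (U : (1 - u)%C <> 0) by now apply one_sub_neq_0.
  rewrite <- E at 1. field. assumption.
Qed.

Lemma inv_pow_remainder (m : nat) :
  exists K, 0 <= K /\ forall x : C, Cmod x <= / 2 ->
    Cmod (/ (1 + x) ^ m - 1 + INR m * x) <= K * Cmod x ^ 2.
Proof.
  induction m as [|m [K [HK IH]]].
  - exists 0. split; [lra|]. intros x _. simpl.
    replace (/ 1 - 1 + 0 * x)%C with (RtoC 0) by field. rewrite Cmod_0. lra.
  - exists (2 * (K + INR (S m))). pose proof (pos_INR (S m)) as Pm.
    split; [lra|]. intros x Hx. specialize (IH x Hx).
    assert (Hx1 : / 2 <= Cmod (1 + x)).
    { assert (1 <= Cmod (1 + x) + Cmod x); [|lra].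
      rewrite <- Cmod_1 at 1. replace (Cmod 1) with (Cmod ((1 + x) + - x)) by (f_equal; ring).
      eapply Rle_trans; [apply Cmod_triangle|]. rewrite Cmod_opp. lra. }
    assert (N : (1 + x)%C <> 0) by (apply Cmod_gt_0; lra).
    assert (Hi : Cmod (/ (1 + x)) <= 2).
    { rewrite Cmod_inv by assumption. replace 2 with (/ / 2) by field.
      apply Rinv_le_contravar; lra. }
    rewrite S_INR in *. rewrite RtoC_plus.
    replace (/ (1 + x) ^ S m - 1 + (RtoC (INR m) + 1) * x)%C with
     (/ (1 + x) * ((/ (1 + x) ^ m - 1 + INR m * x) + (INR m + 1) * x ^ 2))%C.
    2:{ rewrite (Cpow_S (1 + x) m). pose proof (Cpow_nz _ m N).
        set (P := ((1 + x) ^ m)%C) in *. field. split; assumption. }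
    rewrite Cmod_mult.
    apply Rle_trans with (2 * ((K + (INR m + 1)) * Cmod x ^ 2)); [|right; ring].
    apply Rmult_le_compat; try apply Cmod_ge_0; [assumption|].
    eapply Rle_trans; [apply Cmod_triangle|].
    rewrite Cmod_mult, Cmod_pow, <- RtoC_plus, Cmod_R, Rabs_pos_eq by lra. lra.
Qed.

(** Rescaling by [x] turns the expansion at 1 into a remainder bound with one constant [K] for all
    lattice points, as termwise differentiation requires. *)
Lemma inv_pow_remainder_at (m : nat) :
  exists K, 0 <= K /\ forall x h : C, x <> 0 -> Cmod h <= Cmod x / 2 ->
    Cmod (/ (x + h) ^ m - / x ^ m - h * (- INR m * / x ^ S m))
      <= Cmod h ^ 2 * (K * / Cmod x ^ (m + 2)).
Proof.
  destruct (inv_pow_remainder m) as [K [HK H]]. exists K. split; [assumption|].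
  intros x h Hx Hh. assert (Px : 0 < Cmod x) by now apply Cmod_gt_0.
  assert (Hr : Cmod (h / x) <= / 2).
  { rewrite Cmod_div by assumption. apply Rmult_le_reg_r with (Cmod x); [assumption|].
    unfold Rdiv. rewrite Rmult_assoc, Rinv_l by lra. lra. }
  specialize (H (h / x)%C Hr).
  assert (N : (1 + h / x)%C <> 0).
  { intros E. assert (EE : (h / x)%C = (-1)%C) by (replace (h / x)%C with ((1 + h / x) - 1)%C by ring; rewrite E; ring).
    rewrite EE, Cmod_R, Rabs_left in Hr; lra. }
  replace (_ - _ - _)%C with (/ x ^ m * (/ (1 + h / x) ^ m - 1 + INR m * (h / x)))%C.
  2:{ replace (x + h)%C with (x * (1 + h / x))%C by (field; assumption).
      rewrite Cpow_mult_l, Cpow_S. field. repeat split; try apply Cpow_nz; assumption. }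
  rewrite Cmod_mult, Cmod_inv, Cmod_pow by (apply Cpow_nz; assumption).
  apply Rle_trans with (/ Cmod x ^ m * (K * Cmod (h / x) ^ 2)).
  - apply Rmult_le_compat_l; [|assumption]. left. apply Rinv_0_lt_compat. now apply pow_lt.
  - rewrite Cmod_div, pow_add by assumption. right.
    pose proof (pow_lt _ m Px). field. split; lra.
Qed.

(** Induction on the weight. Weight 2 is the expansion of [csc2]; differentiating both sides raises
    the exponent by one, and uniqueness of the derivative equates the results. The constant is
    [(-2 PI i)^(m+2) / (m+1)!], recorded only as nonzero. *)
Lemma lipschitz_formula (m : nat) :
  exists c : C, c <> 0 /\ forall tau, 0 < Im tau ->
    has_sum (fun n : Z => / (tau + IZR n) ^ (m + 2))%C
            (c * qser (fun n => RtoC (INR (S n)) ^ (m + 1)) tau)%C.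
Proof.
  induction m as [|m [c [Hc IH]]].
  - exists (twopii ^ 2)%C. split; [apply Cpow_nz, twopii_neq_0|]. intros tau Ht.
    rewrite Nat.add_0_l, <- csc2_qser by assumption.
    refine (has_sum_ext _ _ _ _ (has_sum_scal (twopii ^ 2) _ _ (csc2_lattice_sum tau Ht))).
    intros n. pose proof twopii_neq_0. pose proof (upper_plus_R_neq_0 tau (IZR n) Ht).
    simpl (0 + 2)%nat. field. split; assumption.
  - set (a := fun n => (RtoC (INR (S n)) ^ (m + 1))%C).
    assert (PM : 0 < INR (m + 2)) by (apply lt_0_INR; lia).
    assert (NM : (- INR (m + 2))%C <> 0).
    { rewrite <- RtoC_opp. intros E. apply RtoC_inj in E. lra. }
    exists (/ (- INR (m + 2)) * (c * twopii))%C. split.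
    { apply Cmult_neq_0; [|apply Cmult_neq_0; [assumption | apply twopii_neq_0]].
      intros E. apply (Cmult_neq_0 _ _ NM NM).
      replace (- INR (m + 2) * - INR (m + 2))%C
        with ((- INR (m + 2)) ^ 3 * / (- INR (m + 2)))%C by (field; intros E'; apply RtoC_inj in E'; lra).
      rewrite E. ring. }
    intros tau Ht.
    destruct (inv_pow_remainder_at (m + 2)) as [K [HK Hrem]].
    destruct (row_sum_bounded tau (m + 2 + 2) Ht) as [K2 HK2]; [lia|].
    destruct (summable_has_sum _ (row_summable tau (S (m + 2)) Ht ltac:(lia))) as [s Hs].
    assert (D1 : cder (fun w => c * qser a w)%C tau (- INR (m + 2) * s)%C).
    { apply (has_sum_cder (fun (n : Z) w => / (w + IZR n) ^ (m + 2))%C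
        (fun n : Z => - INR (m + 2) * / (tau + IZR n) ^ S (m + 2))%C _ tau _
        (fun n : Z => K * / Cmod (tau + IZR n) ^ (m + 2 + 2)) (Im tau / 2) (K * K2)).
      - lra.
      - intros h Hh. apply IH. apply Im_near. lra.
      - now apply has_sum_scal.
      - intros n h Hh. replace (tau + h + IZR n)%C with (tau + IZR n + h)%C by ring.
        apply Hrem; [now apply upper_plus_R_neq_0|].
        assert (Im tau <= Cmod (tau + IZR n)); [|lra].
        eapply Rle_trans; [|apply Rabs_im_le_Cmod]. rewrite Im_plus.
        change (Im (IZR n)) with 0. rewrite Rplus_0_r. apply Rle_abs.
      - now apply sum_bounded_scal. }
    assert (D2 : cder (fun w => c * qser a w)%C tau
       (c * qser (fun n => twopii * INR (S n) * a n)%C tau)%C).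
    { apply cder_scal. apply qser_cder with (m + 1)%nat; [apply poly_growth_pow | assumption]. }
    pose proof (cder_unique _ _ _ _ D1 D2) as E.
    assert (Eq : qser (fun n => twopii * INR (S n) * a n)%C tau =
                 (twopii * qser (fun n => RtoC (INR (S n)) ^ (S m + 1)) tau)%C).
    { apply has_sum_unique with (qterm (fun n => twopii * INR (S n) * a n)%C tau).
      - apply qser_has_sum with (S (m + 1)); [|assumption].
        apply poly_growth_mul_n, poly_growth_pow.
      - refine (has_sum_ext _ _ _ _ (has_sum_scal twopii _ _
          (qser_has_sum _ _ _ (poly_growth_pow (S m + 1)) Ht))).
        intros n. unfold qterm, a. simpl (S m + 1)%nat. rewrite Cpow_S. ring. }
    rewrite Eq in E.
    replace (/ - INR (m + 2) * (c * twopii) * qser (fun n => RtoC (INR (S n)) ^ (S m + 1)) tau)%C with s.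
    + exact Hs.
    + replace (/ - INR (m + 2) * (c * twopii) * qser (fun n => RtoC (INR (S n)) ^ (S m + 1)) tau)%C
        with (/ - INR (m + 2) * (c * (twopii * qser (fun n => RtoC (INR (S n)) ^ (S m + 1)) tau)))%C by ring.
      rewrite <- E. field. intros E'. apply RtoC_inj in E'. lra.
Qed.

(** * Finite Fourier transform *)

Definition zrange (q : Z) : list Z := map Z.of_nat (List.seq 0 (Z.to_nat q)).

Lemma in_zrange (q x : Z) : In x (zrange q) <-> (0 <= x < q)%Z.
Proof.
  unfold zrange. rewrite in_map_iff. split.
  - intros [n [<- Hn]]. apply in_seq in Hn. lia.
  - intros H. exists (Z.to_nat x). split; [lia|]. apply in_seq. lia.
Qed.

Lemma zrange_nodup (q : Z) : NoDup (zrange q).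
Proof.
  apply NoDup_map_NoDup_ForallPairs; [|apply seq_NoDup]. intros x y _ _. lia.
Qed.

Lemma periodic_mul (q : Z) (f : Z -> C) :
  (forall n, f (n + q)%Z = f n) -> forall n j, f (n + q * j)%Z = f n.
Proof.
  intros H n j.
  assert (P : forall i n, f (n + q * Z.of_nat i)%Z = f n).
  { clear n j. intros i n. induction i as [|i IH]; [f_equal; lia|].
    rewrite <- IH, <- (H (n + q * Z.of_nat i)%Z). f_equal. lia. }
  destruct (Z_le_dec 0 j).
  - rewrite <- (Z2Nat.id j) by assumption. apply P.
  - rewrite <- (P (Z.to_nat (- j)) (n + q * j)%Z). f_equal. lia.
Qed.

Lemma periodic_mod (q : Z) (f : Z -> C) :
  (forall n, f (n + q)%Z = f n) -> forall n, f (n mod q)%Z = f n.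
Proof.
  intros H n. destruct (Z.eq_dec q 0) as [->|Hq].
  - now rewrite Zmod_0_r.
  - rewrite (Z.div_mod n q Hq) at 2. rewrite Z.add_comm. symmetry. now apply periodic_mul.
Qed.

Lemma lsum_zrange_opp (q : Z) (f : Z -> C) :
  (forall n, f (n + q)%Z = f n) -> (0 < q)%Z ->
  lsum (fun n => f (- n)%Z) (zrange q) = lsum f (zrange q).
Proof.
  intros H Hq.
  transitivity (lsum f (map (fun n => (- n) mod q)%Z (zrange q))).
  - rewrite lsum_map. apply lsum_ext. intros n _. symmetry. now apply periodic_mod.
  - apply lsum_perm, NoDup_Permutation.
    + apply NoDup_map_NoDup_ForallPairs; [|apply zrange_nodup].
      intros x y Hx Hy E. apply in_zrange in Hx, Hy.
      pose proof (Z.div_mod (- x) q). pose proof (Z.div_mod (- y) q).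
      rewrite E in H0.
      assert (x - y = q * ((- y) / q - (- x) / q))%Z by lia.
      assert (((- y) / q - (- x) / q) = 0)%Z by nia. lia.
    + apply zrange_nodup.
    + intros x. rewrite in_map_iff, in_zrange. split.
      * intros [y [<- _]]. now apply Z.mod_pos_bound.
      * intros Hx. exists ((- x) mod q)%Z. split.
        -- rewrite <- (Z.mod_small x q) at 2 by assumption.
           replace x with (- - x)%Z at 2 by lia.
           rewrite <- (Z.sub_0_l ((- x) mod q)), <- (Z.sub_0_l (- x)).
           apply Zminus_mod_idemp_r.
        -- apply in_zrange. now apply Z.mod_pos_bound.
Qed.

(** Euclidean division embeds the integers into pairs; [F] is the extension by 0 to all pairs, to
    which Fubini applies. *)
Lemma has_sum_mod (q : Z) (f : Z -> C) (s : C) :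
  (0 < q)%Z -> has_sum f s ->
  has_sum (fun n => lsum (fun r => f (q * n + r)%Z) (zrange q)) s.
Proof.
  intros Hq H.
  set (F := fun p : Z * Z => if (andb (0 <=? snd p) (snd p <? q))%Z
                             then f (q * fst p + snd p)%Z else RtoC 0).
  apply has_sum_fubini with F.
  - apply (has_sum_extend (fun x : Z => (x / q, x mod q)%Z)).
    + intros x y E. injection E as E1 E2.
      rewrite (Z.div_mod x q), (Z.div_mod y q), E1, E2 by lia. reflexivity.
    + intros [n r] Hnr. unfold F; simpl.
      destruct (Z.leb_spec 0 r), (Z.ltb_spec r q); simpl; try reflexivity.
      exfalso. apply (Hnr (q * n + r)%Z). f_equal.
      * symmetry. apply Z.div_unique with r; lia.
      * symmetry. apply Z.mod_unique with n; lia.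
    + refine (has_sum_ext _ _ _ _ H). intros x. unfold F; simpl.
      pose proof (Z.mod_pos_bound x q Hq).
      destruct (Z.leb_spec 0 (x mod q)), (Z.ltb_spec (x mod q) q); simpl; try lia.
      f_equal. apply Z.div_mod. lia.
  - intros n.
    replace (lsum (fun r : Z => f (q * n + r)%Z) (zrange q))
      with (lsum (fun r : Z => F (n, r)) (zrange q)).
    + apply has_sum_finite; [apply zrange_nodup|]. intros r Hr. unfold F; simpl.
      destruct (Z.leb_spec 0 r), (Z.ltb_spec r q); simpl; try reflexivity.
      destruct Hr. apply in_zrange. lia.
    + apply lsum_ext. intros r Hr. apply in_zrange in Hr. unfold F; simpl.
      destruct (Z.leb_spec 0 r), (Z.ltb_spec r q); simpl; try lia. reflexivity.
Qed.

Lemma e_eq_1 (x : R) : e x = 1 -> exists n : Z, x = IZR n.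
Proof.
  intros E. assert (Ec : cos (2 * PI * x) = 1).
  { apply (f_equal Re) in E. unfold e, cexp in E.
    replace (Re (RtoC (2 * PI) * (Ci * x))%C) with 0 in E
      by (unfold Ci, RtoC, Cmult, Re; simpl; ring).
    replace (Im (RtoC (2 * PI) * (Ci * x))%C) with (2 * PI * x) in E
      by (unfold Ci, RtoC, Cmult, Im; simpl; ring).
    rewrite exp_0 in E. unfold Re, RtoC in E; simpl in E. lra. }
  pose proof (one_sub_cos (2 * PI * x)) as Hs. rewrite Ec in Hs.
  assert (E0 : sin (2 * PI * x / 2) = 0) by nra.
  apply sin_eq_0_0 in E0. destruct E0 as [n Hn]. exists n.
  pose proof PI_RGT_0. nra.
Qed.

Lemma lsum_const {I : Type} (c : C) (l : list I) :
  lsum (fun _ => c) l = (INR (length l) * c)%C.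
Proof.
  induction l as [|a l IH]; [simpl; ring|].
  change (length (a :: l)) with (S (length l)).
  rewrite S_INR, RtoC_plus. simpl. rewrite IH. ring.
Qed.

Lemma geometric_lsum (u : C) (n : nat) :
  (lsum (fun i => u ^ i) (List.seq 0 n) * (1 - u))%C = (1 - u ^ n)%C.
Proof.
  induction n as [|n IH]; [simpl; ring|].
  rewrite seq_S, lsum_app, Cmult_plus_distr_r, IH. simpl. ring.
Qed.

(** A geometric sum in [u = e (j / q)], where [u ^ q = 1] and [u = 1] exactly when [q] divides
    [j]. *)
Lemma e_orthogonality (q j : Z) : (0 < q)%Z ->
  lsum (fun s => e (IZR j * (IZR s / IZR q))) (zrange q) =
  if Z.eqb (j mod q) 0 then RtoC (IZR q) else RtoC 0.
Proof.
  intros Hq. assert (Pq : 0 < IZR q) by now apply IZR_lt.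
  assert (Nq : RtoC (IZR q) <> 0) by (intros E; apply RtoC_inj in E; lra).
  set (u := e (RtoC (IZR j / IZR q))).
  assert (Eu : forall s : nat, e (IZR j * (IZR (Z.of_nat s) / IZR q)) = (u ^ s)%C).
  { intros s. unfold u. rewrite <- e_mul_nat. f_equal. rewrite INR_IZR_INZ.
    rewrite RtoC_div by lra. field. assumption. }
  unfold zrange. rewrite lsum_map, (lsum_ext _ (fun s => (u ^ s)%C)) by (intros; apply Eu).
  destruct (Z.eqb_spec (j mod q) 0) as [E|E].
  - assert (E1 : u = 1).
    { unfold u. apply Z.mod_divide in E; [|lia]. destruct E as [t ->].
      rewrite mult_IZR. replace (IZR t * IZR q / IZR q) with (IZR t) by (field; lra). apply e_Z. }
    rewrite (lsum_ext _ (fun _ => RtoC 1)) by (intros; rewrite E1; apply Cpow_1_l).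
    rewrite lsum_const, length_seq, INR_IZR_INZ, Z2Nat.id by lia. ring.
  - assert (N1 : (1 - u)%C <> 0).
    { intros E1. assert (E2 : u = 1) by (replace u with (1 - (1 - u))%C by ring; rewrite E1; ring).
      apply e_eq_1 in E2. destruct E2 as [n Hn]. apply E.
      assert (Ej : j = (n * q)%Z).
      { apply eq_IZR. rewrite mult_IZR, <- Hn. field. lra. }
      rewrite Ej. now apply Z_mod_mult. }
    assert (Uq : (u ^ Z.to_nat q)%C = 1).
    { rewrite <- Eu, Z2Nat.id by lia.
      replace (IZR j * (IZR q / IZR q))%C with (RtoC (IZR j)) by (field; assumption). apply e_Z. }
    pose proof (geometric_lsum u (Z.to_nat q)) as G. rewrite Uq in G.
    replace (lsum _ _) with (lsum (fun i => u ^ i) (List.seq 0 (Z.to_nat q)) * (1 - u) * / (1 - u))%C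
      by (field; assumption).
    rewrite G. ring.
Qed.

(** For the conjugate of a primitive character of conductor [q] this is, up to sign, the character
    times a Gauss sum divided by [q]. *)
Definition dft (q : Z) (f : Z -> C) (s : Z) : C :=
  (/ IZR q * lsum (fun m => f m * e (- (IZR m * (IZR s / IZR q))))%C (zrange q))%C.

Lemma dft_inversion (q : Z) (f : Z -> C) :
  (0 < q)%Z -> (forall n, f (n + q)%Z = f n) ->
  forall m, f m = lsum (fun s => dft q f s * e (IZR m * (IZR s / IZR q)))%C (zrange q).
Proof.
  intros Hq Hf m. assert (Pq : 0 < IZR q) by now apply IZR_lt.
  assert (Nq : RtoC (IZR q) <> 0) by (intros E; apply RtoC_inj in E; lra).
  unfold dft.
  rewrite (lsum_ext _ (fun s => / IZR q * lsum (fun m' => f m' *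
        e (IZR (m - m')%Z * (IZR s / IZR q))) (zrange q))%C).
  - rewrite lsum_scal, lsum_swap.
    rewrite (lsum_ext _ (fun m' => f m' * (if Z.eqb ((m - m') mod q) 0 then RtoC (IZR q) else RtoC 0))%C).
    2:{ intros m' _. rewrite lsum_scal. f_equal. now apply e_orthogonality. }
    assert (Hin : In (m mod q)%Z (zrange q)).
    { apply in_zrange. now apply Z.mod_pos_bound. }
    (* The sum over the whole range and the single term at [m mod q] are both values of the
       unordered sum of the same family; uniqueness collapses one to the other. *)
    assert (Hs : has_sum (fun m' => if (andb (0 <=? m') (m' <? q))%Z then
        f m' * (if Z.eqb ((m - m') mod q) 0 then RtoC (IZR q) else RtoC 0) else 0)%C
        (lsum (fun m' => if (andb (0 <=? m') (m' <? q))%Z then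
        f m' * (if Z.eqb ((m - m') mod q) 0 then RtoC (IZR q) else RtoC 0) else 0)%C (zrange q))).
    { apply has_sum_finite; [apply zrange_nodup|]. intros i Hi.
      destruct (Z.leb_spec 0 i), (Z.ltb_spec i q); simpl; try reflexivity.
      destruct Hi. apply in_zrange. lia. }
    set (G := fun m' => if (andb (0 <=? m') (m' <? q))%Z then
        (f m' * (if Z.eqb ((m - m') mod q) 0 then RtoC (IZR q) else RtoC 0))%C else RtoC 0) in *.
    rewrite (lsum_ext _ G).
    2:{ intros i Hi. apply in_zrange in Hi. unfold G.
        destruct (Z.leb_spec 0 i), (Z.ltb_spec i q); simpl; try lia. reflexivity. }
    replace (lsum G (zrange q)) with (lsum G ((m mod q)%Z :: nil)).
    2:{ apply has_sum_unique with G; [|assumption].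
        apply has_sum_finite; [repeat constructor; simpl; tauto|].
        intros i Hi. unfold G.
        destruct (Z.leb_spec 0 i), (Z.ltb_spec i q); simpl; try reflexivity.
        destruct (Z.eqb_spec ((m - i) mod q) 0) as [E|E]; [|ring].
        destruct Hi. left. apply Z.mod_divide in E; [|lia]. destruct E as [t Et].
        symmetry. apply Z.mod_unique with t; lia. }
    apply in_zrange in Hin. unfold G; simpl.
    destruct (Z.leb_spec 0 (m mod q)), (Z.ltb_spec (m mod q) q); simpl; try lia.
    replace ((m - m mod q) mod q)%Z with 0%Z.
    + simpl. rewrite periodic_mod by assumption. field. assumption.
    + rewrite Zminus_mod_idemp_r, Z.sub_diag. reflexivity.
  - intros s _. rewrite (Cmult_comm (_ * _)), Cmult_assoc, (Cmult_comm (e _)), <- Cmult_assoc.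
    f_equal. rewrite <- lsum_scal. apply lsum_ext. intros m' _.
    rewrite minus_IZR, RtoC_minus.
    replace ((IZR m - IZR m') * (IZR s / IZR q))%C with
     (IZR m * (IZR s / IZR q) + - (IZR m' * (IZR s / IZR q)))%C by ring.
    rewrite e_plus. ring.
Qed.

(** For the conjugate of [chi2] the total is the conjugate of [chi2 0], hence 0: this is the
    cancellation among the residues [s]. *)
Lemma dft_sum (q : Z) (f : Z -> C) :
  (0 < q)%Z -> (forall n, f (n + q)%Z = f n) -> lsum (dft q f) (zrange q) = f 0%Z.
Proof.
  intros Hq Hf. rewrite (dft_inversion q f Hq Hf 0%Z). apply lsum_ext. intros s _.
  replace (IZR 0 * (IZR s / IZR q))%C with (RtoC 0) by ring. rewrite e_0. ring.
Qed.

Lemma dft_periodic (q : Z) (f : Z -> C) (s : Z) :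
  (0 < q)%Z -> dft q f (s + q)%Z = dft q f s.
Proof.
  intros Hq. assert (Pq : 0 < IZR q) by now apply IZR_lt.
  assert (Nq : RtoC (IZR q) <> 0) by (intros E; apply RtoC_inj in E; lra).
  unfold dft. f_equal. apply lsum_ext. intros m _. f_equal.
  rewrite <- (e_period (- (IZR m * (IZR s / IZR q))) (- m)). f_equal.
  rewrite plus_IZR, opp_IZR, RtoC_plus, RtoC_opp. field. assumption.
Qed.

Lemma dft_opp (q : Z) (f : Z -> C) (eta : C) (s : Z) :
  (0 < q)%Z -> (forall n, f (n + q)%Z = f n) -> (forall n, f (- n)%Z = (eta * f n)%C) ->
  dft q f (- s)%Z = (eta * dft q f s)%C.
Proof.
  intros Hq Hf He. assert (Pq : 0 < IZR q) by now apply IZR_lt.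
  assert (Nq : RtoC (IZR q) <> 0) by (intros E; apply RtoC_inj in E; lra).
  unfold dft.
  rewrite <- (lsum_zrange_opp q (fun m => f m * e (- (IZR m * (IZR (- s) / IZR q))))%C); try assumption.
  - rewrite (lsum_ext _ (fun m => eta * (f m * e (- (IZR m * (IZR s / IZR q)))))%C).
    + rewrite lsum_scal. ring.
    + intros m _. rewrite He, !opp_IZR, !RtoC_opp.
      replace (- (- IZR m * (- IZR s / IZR q)))%C with (- (IZR m * (IZR s / IZR q)))%C by (field; assumption).
      ring.
  - intros n. rewrite Hf. f_equal.
    rewrite <- (e_period (- (IZR n * (IZR (- s) / IZR q))) s). f_equal.
    rewrite plus_IZR, opp_IZR, RtoC_plus, RtoC_opp. field. assumption.
Qed.

(** * Modularity of the lattice sum *)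

(** A difference of inverse powers gains one power of [a], which is why differences of lattice terms
    are summable already for [k = 2]. *)
Lemma inv_pow_diff (X Y : C) (a d : R) (k : nat) :
  0 < a -> a <= Cmod X -> a <= Cmod Y -> Cmod (X - Y) <= d ->
  Cmod (/ X ^ k - / Y ^ k) <= INR k * d * / a ^ (k + 1).
Proof.
  intros Ha HX HY Hd.
  assert (NX : X <> 0) by (apply Cmod_gt_0; lra).
  assert (NY : Y <> 0) by (apply Cmod_gt_0; lra).
  assert (Pd : 0 <= d) by (eapply Rle_trans; [apply Cmod_ge_0 | eassumption]).
  assert (Pa : 0 < / a) by now apply Rinv_0_lt_compat.
  assert (IX : Cmod (/ X) <= / a) by (rewrite Cmod_inv by assumption; now apply Rinv_le_contravar).
  assert (IY : Cmod (/ Y) <= / a) by (rewrite Cmod_inv by assumption; now apply Rinv_le_contravar).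
  rewrite <- pow_inv.
  induction k as [|k IH].
  - simpl. replace (/ 1 - / 1)%C with (RtoC 0) by ring. rewrite Cmod_0. lra.
  - rewrite !Cpow_S, S_INR.
    replace (/ (X * X ^ k) - / (Y * Y ^ k))%C with
      ((/ X) ^ k * (/ X * / Y * - (X - Y)) + / Y * (/ X ^ k - / Y ^ k))%C.
    2:{ rewrite Cpow_inv by assumption. field. repeat split; try apply Cpow_nz; assumption. }
    eapply Rle_trans; [apply Cmod_triangle|].
    rewrite !Cmod_mult, Cmod_pow, Cmod_opp.
    assert (H1 : Cmod (/ X) ^ k <= (/ a) ^ k) by (apply pow_incr; split; [apply Cmod_ge_0 | assumption]).
    assert (H2 : Cmod (/ X) ^ k * (Cmod (/ X) * Cmod (/ Y) * Cmod (X - Y)) <= (/ a) ^ k * (/ a * / a * d)).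
    { apply Rmult_le_compat; try assumption.
      - apply pow_le, Cmod_ge_0.
      - repeat apply Rmult_le_pos; apply Cmod_ge_0.
      - apply Rmult_le_compat; try assumption; [apply Rmult_le_pos; apply Cmod_ge_0 | apply Cmod_ge_0 |].
        apply Rmult_le_compat; try assumption; apply Cmod_ge_0. }
    assert (H3 : Cmod (/ Y) * Cmod (/ X ^ k - / Y ^ k) <= / a * (INR k * d * (/ a) ^ (k + 1))).
    { apply Rmult_le_compat; try assumption; apply Cmod_ge_0. }
    rewrite pow_add in *. simpl in *. lra.
Qed.

(** With [p = (m, n)] this is [A z + B / q2], where [A = q1 m + r] and [B = q2 n + s]: the residues
    are fixed and [p] runs over the quotients. *)
Definition latpt (q1 q2 : Z) (z : C) (r s : Z) (p : Z * Z) : C :=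
  (RtoC (IZR (q1 * fst p + r)) * z + RtoC (IZR (snd p) + IZR s / IZR q2))%C.

Definition latterm (q1 q2 : Z) (k : nat) (z : C) (r s : Z) (p : Z * Z) : C :=
  (/ latpt q1 q2 z r s p ^ k)%C.

(** As [q1] does not divide [r], the integer [q1 m + r] is at least 1 in absolute value; this pays
    for the summand 1 on the left. *)
Lemma latpt_lower (q1 q2 : Z) (z : C) (r s : Z) :
  (0 < q1)%Z -> (0 < q2)%Z -> 0 < Im z -> ~ (q1 | r)%Z ->
  exists c, 0 < c /\ forall p,
    c * (1 + Rabs (IZR (fst p)) + Rabs (IZR (snd p))) <= Cmod (latpt q1 q2 z r s p).
Proof.
  intros H1 H2 Hz Hr. destruct (lattice_lower z Hz) as [c [Hc H]].
  set (b := IZR s / IZR q2).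
  set (B := 2 + Rabs (IZR r) + Rabs b).
  pose proof (Rabs_pos (IZR r)) as P1. pose proof (Rabs_pos b) as P2.
  exists (c / B). split; [apply Rdiv_lt_0_compat; unfold B; lra|].
  intros [m n]. unfold latpt; simpl fst; simpl snd. fold b.
  specialize (H (IZR (q1 * m + r)) (IZR n + b)).
  eapply Rle_trans; [|apply H].
  set (al := Rabs (IZR (q1 * m + r))). set (be := Rabs (IZR n + b)).
  assert (A1 : 1 <= al).
  { unfold al. rewrite <- abs_IZR. apply IZR_le.
    assert (q1 * m + r <> 0)%Z; [|lia]. intros E. apply Hr. exists (- m)%Z. lia. }
  assert (A2 : Rabs (IZR m) <= al + Rabs (IZR r)).
  { unfold al. rewrite <- !abs_IZR, <- plus_IZR. apply IZR_le. nia. }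
  assert (A3 : Rabs (IZR n) <= be + Rabs b).
  { unfold be. replace (IZR n) with ((IZR n + b) - b) at 1 by ring.
    eapply Rle_trans; [apply Rabs_triang|]. rewrite Rabs_Ropp. lra. }
  assert (Pbe : 0 <= be) by apply Rabs_pos.
  unfold Rdiv. rewrite Rmult_assoc. apply Rmult_le_compat_l; [lra|].
  apply Rmult_le_reg_l with B; [unfold B; lra|].
  rewrite <- Rmult_assoc, Rinv_r, Rmult_1_l by (unfold B; lra).
  unfold B. nra.
Qed.

(** The two lattice points differ by a vector independent of [p], so the difference decays with
    exponent [k + 1 >= 3]. *)
Lemma latterm_diff_summable (q1 q2 : Z) (k : nat) (z : C) (r s r' s' : Z) :
  (0 < q1)%Z -> (0 < q2)%Z -> (2 <= k)%nat -> 0 < Im z -> ~ (q1 | r)%Z -> ~ (q1 | r')%Z ->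
  summable (fun p => latterm q1 q2 k z r s p - latterm q1 q2 k z r' s' p)%C.
Proof.
  intros H1 H2 Hk Hz Hr Hr'.
  destruct (latpt_lower q1 q2 z r s H1 H2 Hz Hr) as [c1 [Hc1 L1]].
  destruct (latpt_lower q1 q2 z r' s' H1 H2 Hz Hr') as [c2 [Hc2 L2]].
  set (c := Rmin c1 c2).
  assert (Pc : 0 < c) by now apply Rmin_glb_lt.
  set (d := Cmod (RtoC (IZR r - IZR r') * z + RtoC (IZR s / IZR q2 - IZR s' / IZR q2))).
  apply summable_le with (fun p : Z * Z => INR k * d * / c ^ (k + 1) *
     / (1 + Rabs (IZR (fst p)) + Rabs (IZR (snd p))) ^ 3) (INR k * d * / c ^ (k + 1) * 16).
  - intros p. pose proof (Rabs_pos (IZR (fst p))). pose proof (Rabs_pos (IZR (snd p))).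
    specialize (L1 p). specialize (L2 p).
    set (rho := 1 + Rabs (IZR (fst p)) + Rabs (IZR (snd p))) in *.
    assert (Prho : 1 <= rho) by (unfold rho; lra).
    assert (M1 : c * rho <= c1 * rho) by (apply Rmult_le_compat_r; [lra | apply Rmin_l]).
    assert (M2 : c * rho <= c2 * rho) by (apply Rmult_le_compat_r; [lra | apply Rmin_r]).
    unfold latterm. eapply Rle_trans.
    + apply inv_pow_diff with (a := c * rho) (d := d); try lra.
      * apply Rmult_lt_0_compat; lra.
      * right. unfold d. f_equal. unfold latpt.
        rewrite !plus_IZR, !RtoC_plus, !RtoC_minus. ring.
    + rewrite Rpow_mult_distr, Rinv_mult, <- Rmult_assoc.
      apply Rmult_le_compat_l.
      * repeat apply Rmult_le_pos; [apply pos_INR | apply Cmod_ge_0 |].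
        left. apply Rinv_0_lt_compat. now apply pow_lt.
      * apply Rinv_le_contravar; [apply pow_lt; lra|]. apply Rle_pow; [assumption | lia].
  - apply sum_bounded_scal; [|apply sum_bounded_Z2_inv_cube].
    repeat apply Rmult_le_pos; [apply pos_INR | apply Cmod_ge_0 |].
    left. apply Rinv_0_lt_compat. now apply pow_lt.
Qed.

Lemma latterm_shift (q1 q2 : Z) (k : nat) (z : C) (r s u v m n : Z) :
  (0 < q2)%Z ->
  latterm q1 q2 k z r s (m + u, n + v)%Z = latterm q1 q2 k z (r + q1 * u) (s + q2 * v) (m, n).
Proof.
  intros H2. assert (0 < IZR q2) by now apply IZR_lt.
  unfold latterm, latpt; simpl. do 2 f_equal. f_equal.
  - f_equal. f_equal. f_equal. ring.
  - f_equal. rewrite !plus_IZR, mult_IZR. field. lra.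
Qed.

Lemma not_divide_shift (q r u : Z) : ~ (q | r)%Z -> ~ (q | r + q * u)%Z.
Proof.
  intros H [t Ht]. apply H. exists (t - u)%Z. lia.
Qed.

(** Along a one-parameter family of lattice points the exponent 2 is enough for absolute
    convergence. *)
Lemma latterm_line_summable (q1 q2 : Z) (k : nat) (z : C) (r s : Z) (phi : Z -> Z * Z) :
  (0 < q1)%Z -> (0 < q2)%Z -> (2 <= k)%nat -> 0 < Im z -> ~ (q1 | r)%Z ->
  (forall i, Rabs (IZR i) <= Rabs (IZR (fst (phi i))) + Rabs (IZR (snd (phi i)))) ->
  summable (fun i => latterm q1 q2 k z r s (phi i)).
Proof.
  intros H1 H2 Hk Hz Hr Hphi.
  destruct (latpt_lower q1 q2 z r s H1 H2 Hz Hr) as [c [Hc L]].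
  assert (HL : forall i, c * (1 + Rabs (IZR i)) <= Cmod (latpt q1 q2 z r s (phi i))).
  { intros i. eapply Rle_trans; [|apply L]. apply Rmult_le_compat_l; [lra|].
    specialize (Hphi i). lra. }
  exists (/ c ^ k * 4).
  apply sum_bounded_le with (fun i => / Cmod (latpt q1 q2 z r s (phi i)) ^ k).
  - intros i. unfold latterm. rewrite Cmod_inv, Cmod_pow; [lra|].
    apply Cpow_nz, Cmod_gt_0. eapply Rlt_le_trans; [|apply HL].
    pose proof (Rabs_pos (IZR i)). apply Rmult_lt_0_compat; lra.
  - apply inv_pow_sum_bounded with (fun i => 1 + Rabs (IZR i)) 2%nat; try assumption.
    + intros i. pose proof (Rabs_pos (IZR i)). lra.
    + apply sum_bounded_Z_inv_square.
Qed.

Lemma has_sum_translate_diff (f : Z -> C) (u : Z) :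
  summable f -> has_sum (fun i => f (i + u)%Z - f i)%C 0.
Proof.
  intros H. apply summable_has_sum in H. destruct H as [s Hs].
  replace (RtoC 0) with (s - s)%C by ring. apply has_sum_minus; [|assumption].
  apply (has_sum_bij (fun i => i + u)%Z (fun i => i - u)%Z f); [intros; lia | intros; lia | assumption].
Qed.

(** For [k = 2] the two families cannot be summed separately over the plane. Their difference is
    summable, and Fubini evaluates it along lines, each absolutely summable and with the same sum as
    its translate. The shifts of the two coordinates are treated in turn. *)
Lemma latterm_translate (q1 q2 : Z) (k : nat) (z : C) (r s u v : Z) :
  (0 < q1)%Z -> (0 < q2)%Z -> (2 <= k)%nat -> 0 < Im z -> ~ (q1 | r)%Z ->
  has_sum (fun p => latterm q1 q2 k z r s (fst p + u, snd p + v)%Z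
                    - latterm q1 q2 k z r s p)%C 0.
Proof.
  intros H1 H2 Hk Hz Hr.
  assert (A : has_sum (fun p => latterm q1 q2 k z r s (fst p + u, snd p)%Z
                    - latterm q1 q2 k z r s p)%C 0).
  { pose proof (latterm_diff_summable q1 q2 k z (r + q1 * u) s r s H1 H2 Hk Hz
       (not_divide_shift _ _ u Hr) Hr) as S.
    apply summable_has_sum in S. destruct S as [S HS].
    apply (has_sum_ext _ (fun p => latterm q1 q2 k z r s (fst p + u, snd p)%Z
                    - latterm q1 q2 k z r s p)%C) in HS.
    2:{ intros [m n]. simpl. rewrite <- (Z.add_0_r n) at 3. rewrite latterm_shift by assumption.
        now rewrite Z.mul_0_r, Z.add_0_r. }
    replace (RtoC 0) with S; [assumption|].
    (* The coordinates are exchanged because a shift of the first one must be summed over that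
       coordinate first. *)
    apply (has_sum_bij (fun p : Z * Z => (snd p, fst p)) (fun p : Z * Z => (snd p, fst p))) in HS;
      [|intros [m n]; reflexivity|intros [m n]; reflexivity].
    apply has_sum_unique with (fun _ : Z => RtoC 0); [|apply has_sum_zero].
    apply (has_sum_fubini _ _ _ HS). intros n. simpl.
    apply (has_sum_translate_diff (fun m => latterm q1 q2 k z r s (m, n)) u).
    apply latterm_line_summable; try assumption. intros i. simpl.
    pose proof (Rabs_pos (IZR n)). lra. }
  assert (B : has_sum (fun p => latterm q1 q2 k z r s (fst p + u, snd p + v)%Z
                    - latterm q1 q2 k z r s (fst p + u, snd p)%Z)%C 0).
  { assert (Hr' : ~ (q1 | r + q1 * u)%Z) by now apply not_divide_shift.
    pose proof (latterm_diff_summable q1 q2 k z (r + q1 * u) (s + q2 * v) (r + q1 * u) s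
       H1 H2 Hk Hz Hr' Hr') as S.
    apply summable_has_sum in S. destruct S as [S HS].
    apply (has_sum_ext _ (fun p => latterm q1 q2 k z r s (fst p + u, snd p + v)%Z
                    - latterm q1 q2 k z r s (fst p + u, snd p)%Z)%C) in HS.
    2:{ intros [m n]. simpl. rewrite <- (Z.add_0_r n) at 4. rewrite !latterm_shift by assumption.
        now rewrite Z.mul_0_r, Z.add_0_r. }
    replace (RtoC 0) with S; [assumption|].
    apply has_sum_unique with (fun _ : Z => RtoC 0); [|apply has_sum_zero].
    apply (has_sum_fubini _ _ _ HS). intros m. simpl.
    apply (has_sum_translate_diff (fun n => latterm q1 q2 k z r s (m + u, n)%Z) v).
    apply latterm_line_summable; try assumption. intros i. simpl.
    pose proof (Rabs_pos (IZR (m + u))). lra. }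
  pose proof (has_sum_plus _ _ _ _ A B) as P. replace (RtoC 0) with (0 + 0)%C by ring.
  refine (has_sum_ext _ _ _ _ P). intros p. ring.
Qed.

(* For [k = 2] the double series converges only conditionally; summing each
   block of residues [(r, s)] first makes it absolutely convergent. *)
Definition latblock (q1 q2 : Z) (f g : Z -> C) (k : nat) (z : C) (p : Z * Z) : C :=
  lsum (fun r => lsum (fun s => f r * g s * latterm q1 q2 k z r s p)%C (zrange q2)) (zrange q1).

Lemma has_sum_lsum_ex {I J : Type} (f : J -> I -> C) (l : list J) :
  (forall j, In j l -> exists s, has_sum (f j) s) ->
  exists s, has_sum (fun i => lsum (fun j => f j i) l) s.
Proof.
  induction l as [|a l IH]; intros H.
  - exists (RtoC 0). apply has_sum_zero.
  - destruct (H a (or_introl eq_refl)) as [s Hs].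
    destruct IH as [t Ht]; [intros j Hj; apply H; now right|].
    exists (s + t)%C. now apply has_sum_plus.
Qed.

Lemma zrange_not_divide (q r : Z) : In r (zrange q) -> r <> 0%Z -> ~ (q | r)%Z.
Proof.
  intros H Hr [t Ht]. apply in_zrange in H.
  assert (t = 0 \/ 1 <= t \/ t <= -1)%Z as [T|[T|T]] by lia; nia.
Qed.

(** Every term is compared with the term of residues [(1, 0)]. Subtracting that one changes nothing
    since [g] has total 0, and each difference is summable; the residue [r = 0], where a lattice
    point may vanish, is removed by [f 0 = 0]. *)
Lemma latblock_has_sum (q1 q2 : Z) (f g : Z -> C) (k : nat) (z : C) :
  (1 < q1)%Z -> (0 < q2)%Z -> (2 <= k)%nat -> 0 < Im z ->
  f 0%Z = 0 -> lsum g (zrange q2) = 0 ->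
  exists T, has_sum (latblock q1 q2 f g k z) T.
Proof.
  intros H1 H2 Hk Hz Hf Hg.
  assert (N1 : ~ (q1 | 1)%Z) by (apply zrange_not_divide; [apply in_zrange|]; lia).
  destruct (has_sum_lsum_ex (fun r p => lsum (fun s => f r * g s *
     (latterm q1 q2 k z r s p - latterm q1 q2 k z 1 0 p))%C (zrange q2)) (zrange q1)) as [T HT].
  - intros r Hr.
    apply (has_sum_lsum_ex (fun s p => f r * g s *
     (latterm q1 q2 k z r s p - latterm q1 q2 k z 1 0 p))%C (zrange q2)).
    intros s _. destruct (Z.eq_dec r 0) as [->|Hr0].
    + exists (RtoC 0). rewrite Hf. refine (has_sum_ext _ _ _ _ has_sum_zero). intros p. ring.
    + pose proof (latterm_diff_summable q1 q2 k z r s 1 0 ltac:(lia) H2 Hk Hz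
        (zrange_not_divide _ _ Hr Hr0) N1) as S.
      apply summable_has_sum in S. destruct S as [S HS].
      exists (f r * g s * S)%C. now apply has_sum_scal.
  - exists T. refine (has_sum_ext _ _ _ _ HT). intros p. unfold latblock.
    apply lsum_ext. intros r _.
    rewrite (lsum_ext _ (fun s => f r * g s * latterm q1 q2 k z r s p +
        (- f r * latterm q1 q2 k z 1 0 p) * g s)%C) by (intros; ring).
    rewrite lsum_plus, lsum_scal, Hg. ring.
Qed.

Lemma Cmult_reg_r (c x y : C) : c <> 0 -> (x * c)%C = (y * c)%C -> x = y.
Proof.
  intros Hc E. replace x with (x * c / c)%C by (field; assumption).
  rewrite E. field. assumption.
Qed.

(** * Action of integral matrices on the half-plane and on the lattice *)

Definition mob (a b c d : Z) (z : C) : C := ((IZR a * z + IZR b) / (IZR c * z + IZR d))%C.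

Definition jfac (c d : Z) (z : C) : C := (IZR c * z + IZR d)%C.

Lemma jfac_neq_0 (a b c d : Z) (z : C) :
  (a * d - b * c = 1)%Z -> 0 < Im z -> jfac c d z <> 0.
Proof.
  intros H Hz E. unfold jfac in E.
  assert (Ei : IZR c * Im z = 0).
  { apply (f_equal Im) in E. rewrite Im_plus, Im_scal in E.
    change (Im (IZR d)) with 0 in E. change (Im 0) with 0 in E. lra. }
  assert (Ec : IZR c = 0) by (apply Rmult_integral in Ei; lra).
  rewrite Ec in E. assert (Ed : RtoC (IZR d) = 0) by (rewrite <- E; ring).
  apply RtoC_inj in Ed. apply eq_IZR in Ec. apply eq_IZR in Ed. subst. lia.
Qed.

Lemma Im_mob (a b c d : Z) (z : C) :
  (a * d - b * c = 1)%Z -> 0 < Im z ->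
  Im (mob a b c d z) = Im z / Cmod (jfac c d z) ^ 2.
Proof.
  intros H Hz. pose proof (jfac_neq_0 a b c d z H Hz) as N.
  assert (HR : IZR a * IZR d - IZR b * IZR c = 1).
  { rewrite <- !mult_IZR, <- minus_IZR. now rewrite H. }
  pose proof (Cmod_gt_0 (jfac c d z)) as [P _]. specialize (P N).
  assert (E : (mob a b c d z * RtoC (Cmod (jfac c d z) ^ 2))%C =
              ((IZR a * z + IZR b) * Cconj (jfac c d z))%C).
  { rewrite Cmod2_conj. unfold mob. fold (jfac c d z). field. assumption. }
  apply (f_equal Im) in E.
  rewrite Cmult_comm, Im_scal in E.
  replace (Im ((IZR a * z + IZR b) * Cconj (jfac c d z))%C) with (Im z) in E.
  - rewrite <- E. field. lra.
  - unfold jfac. destruct z as [x y]. unfold Cconj, Cmult, Cplus, RtoC, Im in *; simpl in *.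
    replace y with ((IZR a * IZR d - IZR b * IZR c) * y) at 1 by (rewrite HR; ring). ring.
Qed.

Lemma Im_mob_pos (a b c d : Z) (z : C) :
  (a * d - b * c = 1)%Z -> 0 < Im z -> 0 < Im (mob a b c d z).
Proof.
  intros H Hz. rewrite Im_mob by assumption.
  apply Rdiv_lt_0_compat; [assumption|]. apply pow_lt, Cmod_gt_0.
  now apply jfac_neq_0 with a b.
Qed.

Lemma in_Gamma1_forms (N a b c d : Z) : (1 < N)%Z -> in_Gamma1 N a b c d ->
  exists a' c' d', (a = 1 + N * a' /\ c = N * c' /\ d = 1 + N * d' /\ a * d - b * c = 1)%Z.
Proof.
  intros HN [Hdet [[c' Hc] [Ha Hd]]].
  rewrite (Z.mod_small 1 N) in Ha, Hd by lia.
  exists (a / N)%Z, c', (d / N)%Z. repeat split.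
  - rewrite (Z.div_mod a N) at 1 by lia. lia.
  - lia.
  - rewrite (Z.div_mod d N) at 1 by lia. lia.
  - assumption.
Qed.

(** [jfac] times a lattice point of [mob z] is a lattice point of [z] with the same residues, as [a]
    and [d] are 1 and [c] is 0 modulo [q1 q2]. The induced map on [(m, n)] is a linear bijection
    common to all residues, followed by a translation by [(u, v)] that depends on them. Only a
    common map may reindex the blocks, so the translations are removed beforehand. *)
Lemma latblock_modular (q1 q2 : Z) (f g : Z -> C) (k : nat) (z T : C) (a b c d : Z) :
  (1 < q1)%Z -> (1 < q2)%Z -> (2 <= k)%nat -> 0 < Im z -> f 0%Z = 0 ->
  in_Gamma1 (q1 * q2) a b c d ->
  has_sum (latblock q1 q2 f g k z) T ->
  has_sum (latblock q1 q2 f g k (mob a b c d z)) (jfac c d z ^ k * T)%C.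
Proof.
  intros H1 H2 Hk Hz Hf HG HT.
  destruct (in_Gamma1_forms (q1 * q2) a b c d ltac:(nia) HG) as [a' [c' [d' [Ea [Ec [Ed Hdet]]]]]].
  pose proof (jfac_neq_0 a b c d z Hdet Hz) as NJ.
  assert (P2 : 0 < IZR q2) by (apply IZR_lt; lia).
  (* These solve [a r + c s / q2 = r + q1 u] and [b r + d s / q2 = s / q2 + v]. *)
  set (u := fun r s : Z => (q2 * a' * r + s * c')%Z).
  set (v := fun r s : Z => (r * b + q1 * d' * s)%Z).
  assert (HS : has_sum (fun p => lsum (fun r => lsum (fun s => f r * g s *
     latterm q1 q2 k z r s (fst p + u r s, snd p + v r s)%Z)%C (zrange q2)) (zrange q1)) T).
  { assert (HZ : has_sum (fun p => lsum (fun r => lsum (fun s => f r * g s *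
      (latterm q1 q2 k z r s (fst p + u r s, snd p + v r s)%Z - latterm q1 q2 k z r s p))%C
      (zrange q2)) (zrange q1)) 0).
    { rewrite <- (lsum_zero (zrange q1)).
      apply (has_sum_lsum (fun r p => lsum (fun s => f r * g s *
      (latterm q1 q2 k z r s (fst p + u r s, snd p + v r s)%Z - latterm q1 q2 k z r s p))%C (zrange q2))).
      intros r Hr. rewrite <- (lsum_zero (zrange q2)).
      apply (has_sum_lsum (fun s p => f r * g s *
      (latterm q1 q2 k z r s (fst p + u r s, snd p + v r s)%Z - latterm q1 q2 k z r s p))%C).
      intros s Hs. destruct (Z.eq_dec r 0) as [->|Hr0].
      - rewrite Hf. refine (has_sum_ext _ _ _ _ has_sum_zero). intros p. ring.
      - replace (RtoC 0) with (f r * g s * 0)%C by ring. apply has_sum_scal.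
        apply latterm_translate; try assumption; try lia.
        now apply zrange_not_divide. }
    pose proof (has_sum_plus _ _ _ _ HT HZ) as P. rewrite Cplus_0_r in P.
    refine (has_sum_ext _ _ _ _ P). intros p. unfold latblock.
    rewrite <- lsum_plus. apply lsum_ext. intros r _.
    rewrite <- lsum_plus. apply lsum_ext. intros s _. ring. }
  (* The matrix with rows [(a, q2 c')] and [(q1 b, d)] has determinant [a d - b c = 1]. *)
  apply (has_sum_bij
    (fun p : Z * Z => (a * fst p + q2 * c' * snd p, q1 * b * fst p + d * snd p)%Z)
    (fun p : Z * Z => (d * fst p - q2 * c' * snd p, - q1 * b * fst p + a * snd p)%Z)) in HS.
  - apply (has_sum_scal (jfac c d z ^ k)) in HS.
    refine (has_sum_ext _ _ _ _ HS). intros [m n]. unfold latblock. simpl fst; simpl snd.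
    rewrite <- lsum_scal. apply lsum_ext. intros r _.
    rewrite <- lsum_scal. apply lsum_ext. intros s _.
    unfold latterm.
    replace (latpt q1 q2 (mob a b c d z) r s (m, n)) with
     (latpt q1 q2 z r s (a * m + q2 * c' * n + u r s, q1 * b * m + d * n + v r s)%Z / jfac c d z)%C.
    + unfold Cdiv. rewrite Cpow_mult_l, Cpow_inv by assumption.
      set (Q := latpt q1 q2 z r s _).
      pose proof (Cpow_nz _ k NJ) as NJk.
      destruct (classic (Q = 0)) as [EQ|NQ].
      * (* division by zero is harmless: [/ 0 = 0] in [C] *)
        rewrite EQ. destruct k as [|k']; [lia|].
        rewrite !Cpow_S, !Cmult_0_l.
        assert (I0 : (/ 0)%C = 0).
        { unfold Cinv, RtoC; simpl. unfold Rdiv. f_equal; ring. }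
        rewrite I0. ring.
      * pose proof (Cpow_nz _ k NQ). field. split; assumption.
    + unfold latpt; simpl fst; simpl snd. unfold mob. fold (jfac c d z).
      apply (Cmult_reg_r (jfac c d z)); [assumption|].
      replace (RtoC (IZR (q1 * (a * m + q2 * c' * n + u r s) + r)))
        with (RtoC (IZR a * IZR (q1 * m + r) + IZR c * (IZR n + IZR s / IZR q2))).
      replace (RtoC (IZR (q1 * b * m + d * n + v r s) + IZR s / IZR q2))
        with (RtoC (IZR b * IZR (q1 * m + r) + IZR d * (IZR n + IZR s / IZR q2))).
      * rewrite !RtoC_plus, !RtoC_mult, RtoC_plus.
        replace (_ / jfac c d z * jfac c d z)%C with
          ((IZR a * IZR (q1 * m + r) + IZR c * (IZR n + (IZR s / IZR q2)%R)) * z +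
           (IZR b * IZR (q1 * m + r) + IZR d * (IZR n + (IZR s / IZR q2)%R)))%C
          by (field; assumption).
        transitivity (IZR (q1 * m + r) * (IZR a * z + IZR b) +
           (IZR n + (IZR s / IZR q2)%R) * jfac c d z)%C.
        -- unfold jfac. ring.
        -- field. assumption.
      * f_equal. unfold v. rewrite Ed. rewrite !plus_IZR, !mult_IZR, !plus_IZR, !mult_IZR. field. lra.
      * f_equal. unfold u. rewrite Ec, Ea. rewrite !plus_IZR, !mult_IZR, !plus_IZR, !mult_IZR.
        rewrite !plus_IZR, !mult_IZR. field. lra.
  - rewrite Ec in Hdet. intros [m n]; simpl. f_equal.
    + transitivity ((a * d - b * (q1 * q2 * c')) * m)%Z; [ring | rewrite Hdet; ring].
    + transitivity ((a * d - b * (q1 * q2 * c')) * n)%Z; [ring | rewrite Hdet; ring].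
  - rewrite Ec in Hdet. intros [m n]; simpl. f_equal.
    + transitivity ((a * d - b * (q1 * q2 * c')) * m)%Z; [ring | rewrite Hdet; ring].
    + transitivity ((a * d - b * (q1 * q2 * c')) * n)%Z; [ring | rewrite Hdet; ring].
Qed.

(** * Lattice expansion of the Eisenstein series *)

Lemma periodic_bounded (q : Z) (f : Z -> C) :
  (0 < q)%Z -> (forall n, f (n + q)%Z = f n) ->
  exists M, 0 <= M /\ forall n, Cmod (f n) <= M.
Proof.
  intros Hq Hf. exists (rsum (fun n => Cmod (f n)) (zrange q)). split.
  - apply rsum_nonneg. intros. apply Cmod_ge_0.
  - intros n. rewrite <- (periodic_mod q f Hf n).
    replace (Cmod (f (n mod q)%Z)) with (rsum (fun n => Cmod (f n)) ((n mod q)%Z :: nil))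
      by (simpl; ring).
    apply rsum_incl.
    + intros. apply Cmod_ge_0.
    + repeat constructor. simpl. tauto.
    + intros x [<-|[]]. apply in_zrange. now apply Z.mod_pos_bound.
Qed.

Definition eis_term (chi1 chi2 : Z -> C) (k i j : nat) : C :=
  (chi1 (Z.of_nat (S i)) * Cconj (chi2 (Z.of_nat (S j))) * RtoC (INR (S j) ^ (k - 1)))%C.

Definition divisor_term (chi1 chi2 : Z -> C) (k n i : nat) : C :=
  if Nat.eqb (S n mod S i) 0 then
    (chi1 (Z.of_nat (S i)) * Cconj (chi2 (Z.of_nat (S n / S i))) * RtoC (INR (S n / S i) ^ (k - 1)))%C
  else RtoC 0.

Lemma eis_coeff_lsum (chi1 chi2 : Z -> C) (k n : nat) :
  eis_coeff chi1 chi2 k (S n) = lsum (divisor_term chi1 chi2 k n) (List.seq 0 (S n)).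
Proof.
  unfold eis_coeff. rewrite sum_n_lsum. replace (S (S n - 1)) with (S n) by lia. reflexivity.
Qed.

Lemma eis_coeff_growth (q1 q2 : Z) (chi1 chi2 : Z -> C) (k : nat) :
  (0 < q1)%Z -> (0 < q2)%Z ->
  (forall n, chi1 (n + q1)%Z = chi1 n) -> (forall n, chi2 (n + q2)%Z = chi2 n) ->
  poly_growth (S (k - 1)) (fun n => eis_coeff chi1 chi2 k (S n)).
Proof.
  intros H1 H2 P1 P2.
  destruct (periodic_bounded q1 chi1 H1 P1) as [M1 [HM1 B1]].
  destruct (periodic_bounded q2 chi2 H2 P2) as [M2 [HM2 B2]].
  exists (M1 * M2). split; [now apply Rmult_le_pos|]. intros n.
  rewrite eis_coeff_lsum. eapply Rle_trans; [apply Cmod_lsum|].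
  apply Rle_trans with (rsum (fun _ => M1 * M2 * INR (S n) ^ (k - 1)) (List.seq 0 (S n))).
  - apply rsum_le. intros i _. unfold divisor_term. pose proof (pos_INR (S n)).
    destruct (Nat.eqb _ _).
    + rewrite !Cmod_mult, Cmod_conj, Cmod_R, Rabs_pos_eq by (apply pow_le, pos_INR).
      apply Rmult_le_compat.
      * apply Rmult_le_pos; apply Cmod_ge_0.
      * apply pow_le, pos_INR.
      * apply Rmult_le_compat; auto; apply Cmod_ge_0.
      * apply pow_incr. split; [apply pos_INR|]. apply le_INR, Nat.Div0.div_le_upper_bound. nia.
    + rewrite Cmod_0. apply Rmult_le_pos; [now apply Rmult_le_pos | now apply pow_le].
  - rewrite rsum_const, length_seq. simpl. lra.
Qed.

Lemma eis_double_summable (q1 q2 : Z) (chi1 chi2 : Z -> C) (k : nat) (z : C) :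
  (0 < q1)%Z -> (0 < q2)%Z ->
  (forall n, chi1 (n + q1)%Z = chi1 n) -> (forall n, chi2 (n + q2)%Z = chi2 n) -> 0 < Im z ->
  summable (fun p : nat * nat =>
    eis_term chi1 chi2 k (fst p) (snd p) * e (INR (S (fst p) * S (snd p)) * z))%C.
Proof.
  intros H1 H2 P1 P2 Hz.
  destruct (periodic_bounded q1 chi1 H1 P1) as [M1 [HM1 B1]].
  destruct (periodic_bounded q2 chi2 H2 P2) as [M2 [HM2 B2]].
  destruct (qterm_bound _ (k - 1) (k - 1 + 2) (poly_growth_pow (k - 1)) (le_n _)) as [M [HM B]].
  assert (Py : 0 < Im z ^ (k - 1 + 2)) by now apply pow_lt.
  set (Y := Im z ^ (k - 1 + 2)) in *.
  assert (PM : 0 <= M1 * M2 * (M / Y)).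
  { repeat apply Rmult_le_pos; try assumption. left. now apply Rinv_0_lt_compat. }
  apply summable_le with (fun p : nat * nat => M1 * M2 * (M / Y) *
     (/ INR (S (fst p)) ^ 2 * / INR (S (snd p)) ^ 2)) (M1 * M2 * (M / Y) * (2 * 2)).
  - intros [i j]. simpl fst; simpl snd.
    assert (EN : S (S i * S j - 1) = (S i * S j)%nat) by lia.
    specialize (B z (S i * S j - 1)%nat Hz). unfold qterm in B. rewrite EN in B.
    rewrite Cmod_mult, Cmod_pow, Cmod_R, (Rabs_pos_eq (INR _)) in B by apply pos_INR.
    unfold eis_term. rewrite !Cmod_mult, Cmod_conj, Cmod_R, Rabs_pos_eq by (apply pow_le, pos_INR).
    set (E := Cmod (e (INR (S i * S j) * z))) in *.
    assert (PE : 0 <= E) by apply Cmod_ge_0.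
    assert (Pij : 0 < INR (S i * S j)) by (apply lt_0_INR; lia).
    rewrite <- Rinv_mult, <- Rpow_mult_distr, <- mult_INR.
    assert (B' : INR (S i * S j) ^ (k - 1) * E <= M / Y * / INR (S i * S j) ^ 2).
    { apply Rmult_le_reg_r with Y; [assumption|].
      replace (M / Y * / INR (S i * S j) ^ 2 * Y) with (M * / INR (S i * S j) ^ 2)
        by (field; split; [lra | apply pow_nonzero; lra]).
      fold Y in B. assumption. }
    apply Rle_trans with (M1 * M2 * (INR (S i * S j) ^ (k - 1) * E)).
    + rewrite Rmult_assoc. apply Rmult_le_compat.
      * apply Rmult_le_pos; apply Cmod_ge_0.
      * apply Rmult_le_pos; [apply pow_le, pos_INR | assumption].
      * apply Rmult_le_compat; auto; apply Cmod_ge_0.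
      * apply Rmult_le_compat_r; [assumption|]. apply pow_incr. split; [apply pos_INR|].
        apply le_INR. nia.
    + rewrite (Rmult_assoc (M1 * M2)). apply Rmult_le_compat_l; [now apply Rmult_le_pos | assumption].
  - apply sum_bounded_scal; [assumption|].
    apply sum_bounded_fubini with (fun i => 2 * / INR (S i) ^ 2).
    + intros p. apply Rmult_le_pos; left; apply Rinv_0_lt_compat, pow_lt, lt_0_INR; lia.
    + intros i. cbn [fst snd]. rewrite Rmult_comm.
      apply (sum_bounded_scal _ (fun j => / INR (S j) ^ 2)); [|apply sum_bounded_inv_square].
      left. apply Rinv_0_lt_compat, pow_lt, lt_0_INR. lia.
    + apply sum_bounded_scal; [lra | apply sum_bounded_inv_square].
Qed.

(** The sum over [N] and the divisors [A] of [N] becomes a sum over all pairs [(A, N / A)]. Indices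
    are shifted by one: the pair [(i, j)] stands for [N = (i + 1) (j + 1)], which has index
    [N - 1]. *)
Lemma eis_double_has_sum (q1 q2 : Z) (chi1 chi2 : Z -> C) (k : nat) (z : C) :
  (0 < q1)%Z -> (0 < q2)%Z ->
  (forall n, chi1 (n + q1)%Z = chi1 n) -> (forall n, chi2 (n + q2)%Z = chi2 n) -> 0 < Im z ->
  has_sum (fun p : nat * nat =>
    eis_term chi1 chi2 k (fst p) (snd p) * e (INR (S (fst p) * S (snd p)) * z))%C
    (qser (fun n => eis_coeff chi1 chi2 k (S n)) z).
Proof.
  intros H1 H2 P1 P2 Hz.
  pose proof (eis_double_summable q1 q2 chi1 chi2 k z H1 H2 P1 P2 Hz) as S0.
  apply summable_has_sum in S0. destruct S0 as [s Hs].
  replace (qser (fun n => eis_coeff chi1 chi2 k (S n)) z) with s; [assumption|].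
  set (F := fun p : nat * nat => (divisor_term chi1 chi2 k (fst p) (snd p) * e (INR (S (fst p)) * z))%C).
  assert (HF : has_sum F s).
  { apply (has_sum_extend (fun p : nat * nat => (S (fst p) * S (snd p) - 1, fst p)%nat)).
    - intros [i j] [i' j'] E; simpl in E. injection E as E1 E2. subst i'. f_equal.
      assert (E3 : (S i * S j = S i * S j')%nat) by (simpl; lia).
      apply Nat.mul_cancel_l in E3; lia.
    - intros [n i] Hni. unfold F; simpl fst; simpl snd. unfold divisor_term.
      destruct (Nat.eqb_spec (S n mod S i) 0) as [E|E]; [|ring].
      exfalso. apply (Hni (i, S n / S i - 1)%nat). cbn [fst snd]. f_equal.
      pose proof (Nat.div_mod_eq (S n) (S i)) as D. rewrite E in D.
      set (t := (S n / S i)%nat) in *. destruct t as [|t]; [lia|].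
      replace (S (S t - 1)) with (S t) by lia. rewrite Nat.add_0_r in D. rewrite <- D. lia.
    - refine (has_sum_ext _ _ _ _ Hs). intros [i j]. unfold F. cbn [fst snd].
      assert (EN : S (S i * S j - 1) = (S i * S j)%nat) by lia. rewrite EN.
      f_equal. unfold divisor_term, eis_term. rewrite EN.
      replace (S i * S j)%nat with (S j * S i)%nat by lia.
      rewrite Nat.Div0.mod_mul, Nat.div_mul by lia. reflexivity. }
  apply has_sum_unique with (qterm (fun n => eis_coeff chi1 chi2 k (S n)) z).
  - apply (has_sum_fubini F _ _ HF). intros n. unfold qterm.
    rewrite eis_coeff_lsum, Cmult_comm, <- lsum_scal.
    rewrite (lsum_ext _ (fun i => F (n, i))) by (intros; unfold F; simpl; ring).
    apply has_sum_finite; [apply seq_NoDup|]. intros i Hi. unfold F; simpl fst; simpl snd.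
    unfold divisor_term. destruct (Nat.eqb_spec (S n mod S i) 0) as [E|E]; [|ring].
    rewrite Nat.mod_small in E; [discriminate|].
    destruct (Nat.le_gt_cases i n); [|lia]. destruct Hi. apply in_seq. lia.
  - apply qser_has_sum with (S (k - 1)); [|assumption].
    now apply eis_coeff_growth with q1 q2.
Qed.

(** When [g] is the Fourier transform of the conjugate of [chi2], inversion shows that this is the
    part of the divisor sum with fixed [A], up to the factor [chi1 A]. *)
Definition dft_qser (q : Z) (g : Z -> C) (p : nat) (z : C) (A : Z) : C :=
  lsum (fun s => g s * qser (fun n => RtoC (INR (S n)) ^ p) (IZR A * z + IZR s / IZR q))%C
       (zrange q).

Lemma Im_mul_add (A : Z) (x : R) (z : C) : (0 < A)%Z -> 0 < Im z -> 0 < Im (IZR A * z + x).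
Proof.
  intros HA Hz. rewrite Im_plus, Im_scal. change (Im x) with 0.
  apply IZR_lt in HA. nra.
Qed.

Lemma eis_rows_has_sum (q1 q2 : Z) (chi1 chi2 : Z -> C) (k : nat) (z : C) :
  (0 < q1)%Z -> (0 < q2)%Z ->
  (forall n, chi1 (n + q1)%Z = chi1 n) -> (forall n, chi2 (n + q2)%Z = chi2 n) -> 0 < Im z ->
  has_sum (fun i : nat => chi1 (Z.of_nat (S i)) *
     dft_qser q2 (dft q2 (fun n => Cconj (chi2 n))) (k - 1) z (Z.of_nat (S i)))%C
    (qser (fun n => eis_coeff chi1 chi2 k (S n)) z).
Proof.
  intros H1 H2 P1 P2 Hz.
  pose proof (eis_double_has_sum q1 q2 chi1 chi2 k z H1 H2 P1 P2 Hz) as H.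
  apply (has_sum_fubini _ _ _ H). intros i. cbn [fst snd].
  assert (N2 : RtoC (IZR q2) <> 0) by (intros E; apply RtoC_inj in E; apply eq_IZR in E; lia).
  set (A := Z.of_nat (S i)).
  assert (HA : (0 < A)%Z) by (unfold A; lia).
  set (g := dft q2 (fun n => Cconj (chi2 n))).
  assert (HI : forall s, 0 < Im (IZR A * z + IZR s / IZR q2)).
  { intros s. rewrite <- RtoC_div by (intros E; apply N2; now rewrite E). now apply Im_mul_add. }
  assert (HS : has_sum (fun j => chi1 A * lsum (fun s => g s *
     qterm (fun n => RtoC (INR (S n)) ^ (k - 1)) (IZR A * z + IZR s / IZR q2) j) (zrange q2))%C
     (chi1 A * dft_qser q2 g (k - 1) z A)%C).
  { apply has_sum_scal. unfold dft_qser.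
    apply (has_sum_lsum (fun s j => g s *
     qterm (fun n => RtoC (INR (S n)) ^ (k - 1)) (IZR A * z + IZR s / IZR q2) j)%C).
    intros s _. apply has_sum_scal. apply qser_has_sum with (k - 1)%nat; [apply poly_growth_pow | apply HI]. }
  refine (has_sum_ext _ _ _ _ HS). intros j. unfold eis_term. fold A.
  assert (Pc : forall n, Cconj (chi2 (n + q2)%Z) = Cconj (chi2 n)) by (intros; now rewrite P2).
  rewrite (dft_inversion q2 (fun n => Cconj (chi2 n)) H2 Pc (Z.of_nat (S j))). fold g.
  transitivity (chi1 A * (RtoC (INR (S j) ^ (k - 1)) * e (INR (S i * S j) * z) *
     lsum (fun s => g s * e (IZR (Z.of_nat (S j)) * (IZR s / IZR q2))) (zrange q2)))%C; [|ring].
  f_equal. rewrite <- lsum_scal. apply lsum_ext. intros s _. unfold qterm.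
  rewrite RtoC_pow, mult_INR, RtoC_mult.
  replace (INR (S j) * (IZR A * z + IZR s / IZR q2))%C with
    (INR (S i) * INR (S j) * z + IZR (Z.of_nat (S j)) * (IZR s / IZR q2))%C
    by (unfold A; rewrite <- !INR_IZR_INZ; ring).
  rewrite e_plus. ring.
Qed.

Lemma dft_row_has_sum (q : Z) (g : Z -> C) (m : nat) (c : C) (A : Z) (z : C) :
  (0 < q)%Z -> 0 < Im z -> (0 < A)%Z ->
  (forall tau, 0 < Im tau -> has_sum (fun n : Z => / (tau + IZR n) ^ (m + 2))%C
            (c * qser (fun n => RtoC (INR (S n)) ^ (m + 1)) tau)%C) ->
  has_sum (fun n : Z => lsum (fun s => g s *
      / (IZR A * z + RtoC (IZR n + IZR s / IZR q)) ^ (m + 2)) (zrange q))%C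
    (c * dft_qser q g (m + 1) z A)%C.
Proof.
  intros Hq Hz HA Hc. assert (Nq : IZR q <> 0) by (intros E; apply eq_IZR in E; lia).
  unfold dft_qser. rewrite <- lsum_scal.
  apply (has_sum_lsum (fun s n => g s *
      / (IZR A * z + RtoC (IZR n + IZR s / IZR q)) ^ (m + 2))%C).
  intros s _. rewrite <- RtoC_div by assumption.
  replace (c * (g s * qser (fun n => RtoC (INR (S n)) ^ (m + 1)) (IZR A * z + (IZR s / IZR q)%R)))%C
    with (g s * (c * qser (fun n => RtoC (INR (S n)) ^ (m + 1)) (IZR A * z + (IZR s / IZR q)%R)))%C by ring.
  apply has_sum_scal.
  refine (has_sum_ext _ _ _ _ (Hc _ (Im_mul_add A (IZR s / IZR q) z HA Hz))).
  intros n. do 2 f_equal. rewrite RtoC_plus. ring.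
Qed.

(** Negating the lattice point gives the sign [(-1)^k], with [k = m + 2], and exchanging [s] with
    [-s] gives the parity [eta] of [g]. *)
Lemma dft_row_has_sum_neg (q : Z) (g : Z -> C) (eta : C) (m : nat) (c : C) (A : Z) (z : C) :
  (0 < q)%Z -> 0 < Im z -> (0 < A)%Z ->
  (forall n, g (n + q)%Z = g n) -> (forall n, g (- n)%Z = (eta * g n)%C) ->
  (forall tau, 0 < Im tau -> has_sum (fun n : Z => / (tau + IZR n) ^ (m + 2))%C
            (c * qser (fun n => RtoC (INR (S n)) ^ (m + 1)) tau)%C) ->
  has_sum (fun n : Z => lsum (fun s => g s *
      / (IZR (- A) * z + RtoC (IZR n + IZR s / IZR q)) ^ (m + 2)) (zrange q))%C
    ((-1) ^ (m + 2) * eta * (c * dft_qser q g (m + 1) z A))%C.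
Proof.
  intros Hq Hz HA Hper Hg Hc. assert (Nq : IZR q <> 0) by (intros E; apply eq_IZR in E; lia).
  set (Q := fun x : R => qser (fun n => RtoC (INR (S n)) ^ (m + 1))%C (IZR A * z + x)%C).
  (* Period 1 in the real shift makes the summand periodic in [s], so that [s] may be replaced by
     [-s] modulo [q]. *)
  assert (HP : forall x (n : Z), Q (x + IZR n) = Q x).
  { intros x n. assert (HI : forall x : R, 0 < Im (IZR A * z + x)) by (intros; now apply Im_mul_add).
    apply has_sum_unique with (qterm (fun n => RtoC (INR (S n)) ^ (m + 1))%C (IZR A * z + x)%C).
    - refine (has_sum_ext _ _ _ _ (qser_has_sum _ _ _ (poly_growth_pow (m + 1)) (HI (x + IZR n)))).
      intros i. unfold qterm. f_equal.
      rewrite <- (e_period (INR (S i) * (IZR A * z + x)) (Z.of_nat (S i) * n)). f_equal.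
      rewrite mult_IZR, <- INR_IZR_INZ, RtoC_plus, RtoC_mult. ring.
    - apply qser_has_sum with (m + 1)%nat; [apply poly_growth_pow | apply HI]. }
  assert (E : (eta * dft_qser q g (m + 1) z A)%C = lsum (fun s => g s * Q (- (IZR s / IZR q))%R)%C (zrange q)).
  { rewrite <- (lsum_zrange_opp q (fun s => g s * Q (- (IZR s / IZR q))%R)%C); [|intros n|assumption].
    - unfold dft_qser. rewrite <- lsum_scal. apply lsum_ext. intros s _. rewrite Hg.
      unfold Q. rewrite opp_IZR. replace (- (- IZR s / IZR q)) with (IZR s / IZR q) by (field; assumption).
      rewrite RtoC_div by assumption. ring.
    - rewrite Hper. f_equal. rewrite <- (HP (- (IZR n / IZR q)) (- 1)%Z). f_equal.
      rewrite plus_IZR. change (IZR (-1)) with (-1). field. assumption. }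
  replace ((-1) ^ (m + 2) * eta * (c * dft_qser q g (m + 1) z A))%C
    with ((-1) ^ (m + 2) * (c * (eta * dft_qser q g (m + 1) z A)))%C by ring.
  rewrite E, <- !lsum_scal.
  apply (has_sum_lsum (fun s n => g s *
      / (IZR (- A) * z + RtoC (IZR n + IZR s / IZR q)) ^ (m + 2))%C).
  intros s _. unfold Q.
  replace ((-1) ^ (m + 2) * (c * (g s * qser (fun n => RtoC (INR (S n)) ^ (m + 1)) (IZR A * z + (- (IZR s / IZR q))%R))))%C
    with (g s * ((-1) ^ (m + 2) * (c * qser (fun n => RtoC (INR (S n)) ^ (m + 1)) (IZR A * z + (- (IZR s / IZR q))%R))))%C by ring.
  apply has_sum_scal.
  pose proof (Hc _ (Im_mul_add A (- (IZR s / IZR q)) z HA Hz)) as HS.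
  apply (has_sum_bij Z.opp Z.opp) in HS; [|intros; lia|intros; lia].
  apply (has_sum_scal ((-1) ^ (m + 2))) in HS.
  refine (has_sum_ext _ _ _ _ HS). intros n. cbv beta.
  set (X := (IZR (- A) * z + RtoC (IZR n + IZR s / IZR q))%C).
  replace (IZR A * z + (- (IZR s / IZR q))%R + IZR (- n))%C with (-1 * X)%C.
  2:{ unfold X. rewrite !opp_IZR, RtoC_plus, !RtoC_opp. ring. }
  rewrite Cpow_mult_l.
  assert (NX : X <> 0).
  { unfold X. intros EX. apply (f_equal Im) in EX. rewrite Im_plus, Im_scal in EX.
    change (Im (RtoC _)) with 0 in EX. change (Im 0) with 0 in EX.
    rewrite opp_IZR in EX. apply IZR_lt in HA. nra. }
  assert (Nm : RtoC (-1) <> 0) by (intros E1; apply RtoC_inj in E1; lra).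
  pose proof (Cpow_nz _ (m + 2) NX). pose proof (Cpow_nz _ (m + 2) Nm).
  field. split; assumption.
Qed.

(** By the Lipschitz formula the rows with [A > 0] add up to [c] times the series, those with
    [A < 0] to the same value by [Heta], and the row [A = 0] is killed by [chi1 0 = 0]; hence
    [kappa = 1 / (2 c)]. *)
Lemma eis_qser_lattice (q1 q2 : Z) (chi1 chi2 : Z -> C) (eta1 eta2 : C) (k : nat) :
  (1 < q1)%Z -> (1 < q2)%Z -> (2 <= k)%nat ->
  (forall n, chi1 (n + q1)%Z = chi1 n) -> (forall n, chi2 (n + q2)%Z = chi2 n) ->
  chi1 0%Z = 0 ->
  (forall n, chi1 (- n)%Z = (eta1 * chi1 n)%C) ->
  (forall n, Cconj (chi2 (- n)%Z) = (eta2 * Cconj (chi2 n))%C) ->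
  (eta1 * ((-1) ^ k * eta2))%C = 1 ->
  exists kappa, forall z T, 0 < Im z ->
    has_sum (latblock q1 q2 chi1 (dft q2 (fun n => Cconj (chi2 n))) k z) T ->
    qser (fun n => eis_coeff chi1 chi2 k (S n)) z = (kappa * T)%C.
Proof.
  intros H1 H2 Hk P1 P2 H0 Hpar1 Hpar2 Heta.
  destruct (lipschitz_formula (k - 2)) as [c [Nc Hc]].
  assert (N2 : RtoC 2 <> 0) by (intros E; apply RtoC_inj in E; lra).
  exists (/ (2 * c))%C. intros z T Hz HT.
  set (S := qser _ z).
  assert (Hq2 : (0 < q2)%Z) by lia.
  set (g := dft q2 (fun n => Cconj (chi2 n))) in *.
  assert (Gper : forall n, g (n + q2)%Z = g n) by (intros; apply dft_periodic; lia).
  assert (Gpar : forall n, g (- n)%Z = (eta2 * g n)%C).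
  { intros n. unfold g. apply dft_opp; [lia | | assumption]. intros; now rewrite P2. }
  pose proof (eis_rows_has_sum q1 q2 chi1 chi2 k z ltac:(lia) Hq2 P1 P2 Hz) as HS.
  fold S g in HS.
  set (H := fun A => (c * dft_qser q2 g (k - 1) z A)%C).
  set (pos := fun A : Z => if (0 <? A)%Z then (chi1 A * H A)%C else RtoC 0).
  assert (Hpos : has_sum pos (c * S)%C).
  { apply (has_sum_extend (fun i => Z.of_nat (Datatypes.S i))).
    - intros i j E. lia.
    - intros j Hj. unfold pos. destruct (Z.ltb_spec 0 j); [|reflexivity].
      exfalso. apply (Hj (Z.to_nat (j - 1))). lia.
    - refine (has_sum_ext _ _ _ _ (has_sum_scal c _ _ HS)). intros i. unfold pos, H.
      destruct (Z.ltb_spec 0 (Z.of_nat (Datatypes.S i))); [ring | lia]. }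
  assert (Hneg : has_sum (fun A => pos (- A)%Z) (c * S)%C).
  { apply (has_sum_bij Z.opp Z.opp); [intros; lia | intros; lia | assumption]. }
  pose proof (has_sum_mod q1 _ _ ltac:(lia) (has_sum_plus _ _ _ _ Hpos Hneg)) as Hall.
  assert (ET : T = (c * S + c * S)%C).
  { apply has_sum_unique with (2 := Hall).
    apply (has_sum_fubini _ _ _ HT). intros n1. unfold latblock.
    apply (has_sum_lsum (fun r b => lsum (fun s => chi1 r * g s *
       latterm q1 q2 k z r s (n1, b))%C (zrange q2))).
    intros r Hr.
    destruct (Z.eq_dec r 0) as [->|Hr0].
    - rewrite H0. replace (pos _ + pos _)%C with (RtoC 0).
      + refine (has_sum_ext _ _ _ _ has_sum_zero). intros n.
        rewrite (lsum_ext _ (fun _ => RtoC 0)) by (intros; ring). now rewrite lsum_zero.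
      + assert (E0 : forall t, chi1 (q1 * t + 0)%Z = 0).
        { intros t. rewrite Z.add_comm, periodic_mul; assumption. }
        unfold pos. replace (- (q1 * n1 + 0))%Z with (q1 * - n1 + 0)%Z by ring. rewrite !E0.
        destruct (_ <? _)%Z, (_ <? _)%Z; ring.
    - assert (E1 : chi1 r = chi1 (q1 * n1 + r)%Z).
      { rewrite Z.add_comm. symmetry. now apply periodic_mul. }
      assert (HA0 : (q1 * n1 + r <> 0)%Z).
      { intros E. apply (zrange_not_divide _ _ Hr Hr0). exists (- n1)%Z. lia. }
      rewrite E1. set (A := (q1 * n1 + r)%Z) in *.
      assert (HR : has_sum (fun n => chi1 A * lsum (fun s => g s *
         / (IZR A * z + RtoC (IZR n + IZR s / IZR q2)) ^ k) (zrange q2))%C (pos A + pos (- A)%Z)%C).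
      { assert (Ek2 : (k - 2 + 2)%nat = k) by lia.
        assert (Ek1 : (k - 2 + 1)%nat = (k - 1)%nat) by lia.
        unfold pos.
        destruct (Z.ltb_spec 0 A), (Z.ltb_spec 0 (- A)); try lia.
        - rewrite Cplus_0_r. apply has_sum_scal. unfold H.
          pose proof (dft_row_has_sum q2 g (k - 2) c A z Hq2 Hz ltac:(assumption) Hc) as HQ.
          rewrite Ek2, Ek1 in HQ. exact HQ.
        - rewrite Cplus_0_l, Hpar1.
          replace (eta1 * chi1 A * H (- A)%Z)%C with
            (chi1 A * ((-1) ^ k * eta2 * H (- A)%Z))%C.
          + apply has_sum_scal. unfold H.
            pose proof (dft_row_has_sum_neg q2 g eta2 (k - 2) c (- A) z Hq2 Hz
              ltac:(lia) Gper Gpar Hc) as HQ.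
            rewrite Ek2, Ek1, Z.opp_involutive in HQ. exact HQ.
          (* [eta1] is known through [chi1 (-A) = eta1 chi1 A]; applied twice, this yields
             [eta1^2 = 1] wherever [chi1 A] is nonzero. *)
          + assert (Esq : (eta1 * eta1)%C = 1 \/ chi1 A = 0).
            { destruct (classic (chi1 A = 0)) as [E|E]; [now right|]. left.
              apply (Cmult_reg_r (chi1 A)); [assumption|].
              rewrite <- Cmult_assoc, <- Hpar1, <- Hpar1, Z.opp_involutive. ring. }
            destruct Esq as [Esq|Esq].
            * replace ((-1) ^ k * eta2)%C with eta1; [ring|].
              replace ((-1) ^ k * eta2)%C with (eta1 * eta1 * ((-1) ^ k * eta2))%C by (rewrite Esq; ring).
              rewrite <- Cmult_assoc, Heta. ring.
            * rewrite Esq. ring. }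
      refine (has_sum_ext _ _ _ _ HR). intros n. rewrite <- lsum_scal.
      apply lsum_ext. intros s _. unfold latterm, latpt. cbn [fst snd]. fold A. ring. }
  rewrite ET. field. assumption.
Qed.

(** * Eichler integrals and their cocycle *)

Lemma qser_ext (a b : nat -> C) (p : nat) (z : C) :
  poly_growth p a -> 0 < Im z -> (forall n, a n = b n) -> qser a z = qser b z.
Proof.
  intros Ha Hz E. apply has_sum_unique with (qterm a z).
  - now apply qser_has_sum with p.
  - refine (has_sum_ext _ _ _ _ (qser_has_sum b p z _ Hz)).
    + intros n. unfold qterm. now rewrite E.
    + destruct Ha as [K [HK H]]. exists K. split; [assumption|]. intros n. now rewrite <- E.
Qed.

(** Coefficients of the [j]-fold antiderivative that vanishes at [i oo]. *)
Definition qint (a : nat -> C) (j n : nat) : C := (a n * / (twopii * INR (S n)) ^ j)%C.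

Lemma twopii_INR_neq_0 (n : nat) : (twopii * INR (S n))%C <> 0.
Proof.
  apply Cmult_neq_0; [apply twopii_neq_0|]. intros E. apply RtoC_inj in E.
  apply (not_0_INR (S n)); [lia | assumption].
Qed.

Lemma qint_growth (a : nat -> C) (p j : nat) : poly_growth p a -> poly_growth p (qint a j).
Proof.
  intros [K [HK H]]. exists K. split; [assumption|]. intros n. unfold qint.
  rewrite Cmod_mult, Cmod_inv, Cmod_pow by (apply Cpow_nz, twopii_INR_neq_0).
  rewrite Cmod_mult, Cmod_twopii, Cmod_R, Rabs_pos_eq by apply pos_INR.
  apply Rle_trans with (Cmod (a n)); [|apply H].
  rewrite <- (Rmult_1_r (Cmod (a n))) at 2.
  apply Rmult_le_compat_l; [apply Cmod_ge_0|].
  rewrite <- Rinv_1. apply Rinv_le_contravar; [lra|].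
  apply pow_R1_Rle. pose proof PI2_3_2.
  assert (1 <= INR (S n)) by (rewrite S_INR; pose proof (pos_INR n); lra). nra.
Qed.

Lemma qint_cder (a : nat -> C) (p j : nat) (z : C) :
  poly_growth p a -> 0 < Im z -> cder (qser (qint a (S j))) z (qser (qint a j) z).
Proof.
  intros Ha Hz.
  pose proof (qser_cder _ p z (qint_growth a p (S j) Ha) Hz) as H.
  rewrite (qser_ext _ (qint a j) (S p)) in H; [assumption | | assumption |].
  - now apply poly_growth_mul_n, qint_growth.
  - intros n. unfold qint. rewrite Cpow_S.
    pose proof (twopii_INR_neq_0 n) as N. pose proof (Cpow_nz _ j N).
    set (u := (twopii * INR (S n))%C) in *. field. split; assumption.
Qed.

(* Iterated integration by parts: [eich a X Y m j] is the antiderivative, vanishing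
   at [i oo], of [(X z + Y)^m] times the [j]-fold antiderivative of [qser a]. *)
Fixpoint eich (a : nat -> C) (X Y : C) (m j : nat) (z : C) : C :=
  match m with
  | O => qser (qint a (S j)) z
  | S m' => ((X * z + Y) ^ m * qser (qint a (S j)) z
             - INR m * X * eich a X Y m' (S j) z)%C
  end.

Lemma cder_affine_pow (X Y z : C) (m : nat) :
  cder (fun w => (X * w + Y) ^ S m)%C z (INR (S m) * X * (X * z + Y) ^ m)%C.
Proof.
  induction m as [|m IH].
  - replace (INR 1 * X * (X * z + Y) ^ 0)%C with X by (simpl; ring).
    apply cder_ext with (fun w => X * w + Y)%C 1; [lra | | apply cder_affine].
    intros h _. now rewrite Cpow_1_r.
  - pose proof (cder_mult _ _ z _ _ (cder_affine X Y z) IH) as H.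
    replace (INR (S (S m)) * X * (X * z + Y) ^ S m)%C with
      (X * (X * z + Y) ^ S m + (X * z + Y) * (INR (S m) * X * (X * z + Y) ^ m))%C; [exact H|].
    rewrite (S_INR (S m)), RtoC_plus, (Cpow_S _ m). ring.
Qed.

(** The derivative of the leading product is the desired value plus a term cancelled by the
    induction hypothesis at [j + 1], which is why [j] is quantified inside the induction. *)
Lemma eich_cder (a : nat -> C) (p : nat) (X Y z : C) (m : nat) :
  poly_growth p a -> 0 < Im z -> forall j,
  cder (eich a X Y m j) z ((X * z + Y) ^ m * qser (qint a j) z)%C.
Proof.
  intros Ha Hz. induction m as [|m IH]; intros j.
  - simpl. rewrite Cmult_1_l. now apply qint_cder with p.
  - pose proof (cder_minus _ _ z _ _
      (cder_mult _ _ z _ _ (cder_affine_pow X Y z m) (qint_cder a p j z Ha Hz))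
      (cder_scal (INR (S m) * X) _ _ _ (IH (S j)))) as H.
    replace ((X * z + Y) ^ S m * qser (qint a j) z)%C with
     (INR (S m) * X * (X * z + Y) ^ m * qser (qint a (S j)) z +
     (X * z + Y) ^ S m * qser (qint a j) z -
     INR (S m) * X * ((X * z + Y) ^ m * qser (qint a (S j)) z))%C by ring.
    exact H.
Qed.

Lemma eich_homogeneous (a : nat -> C) (t X Y z : C) (m : nat) : forall j,
  eich a (t * X) (t * Y) m j z = (t ^ m * eich a X Y m j z)%C.
Proof.
  induction m as [|m IH]; intros j; [simpl; ring|].
  cbn [eich]. rewrite IH.
  replace (t * X * z + t * Y)%C with (t * (X * z + Y))%C by ring.
  rewrite Cpow_mult_l, (Cpow_S t). ring.
Qed.

(** The case [X = 0] arises for the form [(1, -x) s] with [x = s oo], and for matrices fixing [oo];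
    a single antiderivative then remains. *)
Lemma eich_0_l (a : nat -> C) (Y z : C) (m j : nat) :
  eich a 0 Y m j z = (Y ^ m * qser (qint a (S j)) z)%C.
Proof.
  destruct m as [|m]; cbn [eich]; [simpl; ring|].
  replace (0 * z + Y)%C with Y by ring. ring.
Qed.

(** [eich] is a polynomial in [(X, Y)]. Continuity in the cusp will be derived from this
    differentiability along affine lines. *)
Lemma cder_eich_coeffs (a : nat -> C) (A B A' B' z w : C) (m : nat) : forall j,
  exists D, cder (fun w => eich a (A * w + B) (A' * w + B') m j z)%C w D.
Proof.
  induction m as [|m IH]; intros j.
  - exists (RtoC 0). apply (cder_const (qser (qint a (S j)) z)).
  - destruct (IH (S j)) as [D HD].
    assert (H1 : cder (fun w => ((A * w + B) * z + (A' * w + B')) ^ S m)%C w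
       (INR (S m) * (A * z + A') * ((A * z + A') * w + (B * z + B')) ^ m)%C).
    { apply cder_ext with (fun w => ((A * z + A') * w + (B * z + B')) ^ S m)%C 1;
        [lra | | apply cder_affine_pow].
      intros h _. f_equal. ring. }
    eexists. cbn [eich]. apply cder_minus.
    + apply cder_mult; [exact H1 | apply cder_const].
    + apply cder_mult; [|exact HD]. apply cder_scal, cder_affine.
Qed.

Lemma cder_continuous (f : C -> C) (z D : C) (eps : R) :
  cder f z D -> 0 < eps ->
  exists delta, 0 < delta /\ forall h, Cmod h < delta -> Cmod (f (z + h)%C - f z) < eps.
Proof.
  intros [d [K [Hd [HK H]]]] He. pose proof (Cmod_ge_0 D) as PD.
  set (B := Cmod D + K + 1).
  exists (Rmin (Rmin 1 d) (eps / B)). split.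
  - repeat apply Rmin_glb_lt; try lra. apply Rdiv_lt_0_compat; unfold B; lra.
  - intros h Hh. pose proof (Rmin_l 1 d). pose proof (Rmin_r 1 d).
    pose proof (Rmin_l (Rmin 1 d) (eps / B)). pose proof (Rmin_r (Rmin 1 d) (eps / B)).
    specialize (H h ltac:(lra)). pose proof (Cmod_ge_0 h).
    replace (f (z + h)%C - f z)%C with ((f (z + h)%C - f z - h * D) + h * D)%C by ring.
    eapply Rle_lt_trans; [apply Cmod_triangle|]. rewrite Cmod_mult.
    assert (K * Cmod h ^ 2 <= K * Cmod h) by (apply Rmult_le_compat_l; nra).
    apply Rle_lt_trans with (B * Cmod h); [unfold B; lra|].
    apply Rlt_le_trans with (B * (eps / B)).
    + apply Rmult_lt_compat_l; [unfold B; lra|]. lra.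
    + right. field. unfold B. lra.
Qed.

Lemma cder_mob (a b c d : Z) (z : C) :
  (a * d - b * c = 1)%Z -> 0 < Im z -> cder (mob a b c d) z (/ jfac c d z ^ 2)%C.
Proof.
  intros Hdet Hz. pose proof (jfac_neq_0 a b c d z Hdet Hz) as N.
  assert (HR : (IZR a * IZR d - IZR b * IZR c)%C = 1).
  { rewrite <- !RtoC_mult, <- RtoC_minus. f_equal. rewrite <- !mult_IZR, <- minus_IZR. now rewrite Hdet. }
  set (J := jfac c d z) in *. set (cc := RtoC (IZR c)) in *.
  pose proof (proj1 (Cmod_gt_0 J) N) as PJ. pose proof (Cmod_ge_0 cc) as Pc.
  assert (PJ3 : 0 < Cmod J ^ 3) by now apply pow_lt.
  (* This radius keeps [|J + c h| >= |J| / 2]. *)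
  exists (Cmod J / (2 * (Cmod cc + 1))), (2 * Cmod cc * / Cmod J ^ 3). repeat split.
  - apply Rdiv_lt_0_compat; lra.
  - apply Rmult_le_pos; [lra|]. left. now apply Rinv_0_lt_compat.
  - intros h Hh.
    assert (Hch : Cmod (cc * h) <= Cmod J / 2).
    { rewrite Cmod_mult. apply Rle_trans with ((Cmod cc + 1) * (Cmod J / (2 * (Cmod cc + 1)))).
      - pose proof (Cmod_ge_0 h). apply Rmult_le_compat; lra.
      - right. field. lra. }
    assert (HJ2 : Cmod J / 2 <= Cmod (J + cc * h)).
    { assert (Cmod J <= Cmod (J + cc * h) + Cmod (cc * h)); [|lra].
      replace J with ((J + cc * h) + - (cc * h))%C at 1 by ring.
      eapply Rle_trans; [apply Cmod_triangle|]. rewrite Cmod_opp. lra. }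
    assert (N2 : (J + cc * h)%C <> 0) by (apply Cmod_gt_0; lra).
    replace (mob a b c d (z + h) - mob a b c d z - h * / J ^ 2)%C with
      (- (cc * h ^ 2) * / (J ^ 2 * (J + cc * h)))%C.
    + rewrite Cmod_mult, Cmod_opp, Cmod_inv, !Cmod_mult, !Cmod_pow
        by (apply Cmult_neq_0; [apply Cpow_nz|]; assumption).
      rewrite (Rmult_comm (2 * Cmod cc * / Cmod J ^ 3)), (Rmult_comm (Cmod cc)), !Rmult_assoc.
      apply Rmult_le_compat_l; [apply pow2_ge_0|].
      replace (2 * (Cmod cc * / Cmod J ^ 3)) with (Cmod cc * / (Cmod J ^ 2 * (Cmod J / 2))) by (field; lra).
      apply Rmult_le_compat_l; [assumption|].
      apply Rinv_le_contravar; [apply Rmult_lt_0_compat; [now apply pow_lt | lra]|].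
      apply Rmult_le_compat_l; [apply pow2_ge_0 | assumption].
    + transitivity (h * (IZR a * IZR d - IZR b * cc) / (J * (J + cc * h)) - h * / J ^ 2)%C.
      * rewrite HR. field. split; assumption.
      * f_equal. unfold mob.
        replace (IZR c * (z + h) + IZR d)%C with (J + cc * h)%C by (unfold J, jfac, cc; ring).
        change (IZR c * z + IZR d)%C with J.
        transitivity (((IZR a * (z + h) + IZR b) * J - (IZR a * z + IZR b) * (J + cc * h)) / (J * (J + cc * h)))%C.
        -- unfold Cdiv. f_equal. unfold J, jfac, cc. ring.
        -- field. split; assumption.
Qed.

Definition weight_invariant (a : nat -> C) (k : nat) (N : Z) : Prop :=
  forall A B C' D z, in_Gamma1 N A B C' D -> 0 < Im z ->
    qser a (mob A B C' D z) = (jfac C' D z ^ k * qser a z)%C.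

(** The base point [Ci] is an arbitrary choice; the coefficients in the second term are the
    components of [(X, Y) g]. *)
Definition cocycle (a : nat -> C) (m : nat) (A B C' D : Z) (X Y : C) : C :=
  (eich a X Y m 0 (mob A B C' D Ci)
   - eich a (IZR A * X + IZR C' * Y) (IZR B * X + IZR D * Y) m 0 Ci)%C.

Lemma qser_qint_0 (a : nat -> C) (p : nat) (z : C) :
  poly_growth p a -> 0 < Im z -> qser (qint a 0) z = qser a z.
Proof.
  intros Ha Hz. apply qser_ext with p; [now apply qint_growth | assumption|].
  intros n. unfold qint. simpl. field.
Qed.

(** The derivative in [w] vanishes: the weight factor [J^(m+2)] times the derivative [J^(-2)] of [g]
    leaves [J^m], and [J (X g w + Y)] is the form [(X, Y) g] at [w]. *)
Lemma cocycle_const (a : nat -> C) (p m : nat) (N A B C' D : Z) (X Y w : C) :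
  poly_growth p a -> weight_invariant a (m + 2) N -> in_Gamma1 N A B C' D -> 0 < Im w ->
  (eich a X Y m 0 (mob A B C' D w)
   - eich a (IZR A * X + IZR C' * Y) (IZR B * X + IZR D * Y) m 0 w)%C
  = cocycle a m A B C' D X Y.
Proof.
  intros Ha Hinv HG Hw. pose proof (proj1 HG) as Hdet. unfold cocycle.
  apply (cder_zero_const (fun w => eich a X Y m 0 (mob A B C' D w)
   - eich a (IZR A * X + IZR C' * Y) (IZR B * X + IZR D * Y) m 0 w)%C);
    [|assumption | simpl; lra].
  clear w Hw. intros w Hw.
  pose proof (Im_mob_pos _ _ _ _ w Hdet Hw) as Hgw.
  pose proof (jfac_neq_0 _ _ _ _ w Hdet Hw) as NJ.
  pose proof (cder_minus _ _ w _ _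
    (cder_comp _ _ w _ _ (eich_cder a p X Y (mob A B C' D w) m Ha Hgw 0)
       (cder_mob A B C' D w Hdet Hw))
    (eich_cder a p (IZR A * X + IZR C' * Y) (IZR B * X + IZR D * Y) w m Ha Hw 0)) as H.
  replace (RtoC 0) with ((X * mob A B C' D w + Y) ^ m * qser (qint a 0) (mob A B C' D w) *
     / jfac C' D w ^ 2 - ((IZR A * X + IZR C' * Y) * w + (IZR B * X + IZR D * Y)) ^ m *
     qser (qint a 0) w)%C; [exact H|].
  rewrite !(qser_qint_0 a p) by assumption. rewrite (Hinv A B C' D w HG Hw).
  set (J := jfac C' D w) in *.
  replace ((IZR A * X + IZR C' * Y) * w + (IZR B * X + IZR D * Y))%C
    with (J * (X * mob A B C' D w + Y))%C.
  - rewrite Cpow_mult_l, Cpow_add_r. field. assumption.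
  - unfold mob. change (IZR C' * w + IZR D)%C with J.
    transitivity (X * (IZR A * w + IZR B) + J * Y)%C; [field; assumption|].
    unfold J, jfac. ring.
Qed.

Lemma mob_comp (A B C1 D A' B' C' D' : Z) (z : C) :
  (A * D - B * C1 = 1)%Z -> (A' * D' - B' * C' = 1)%Z -> 0 < Im z ->
  mob (A * A' + B * C') (A * B' + B * D') (C1 * A' + D * C') (C1 * B' + D * D') z
  = mob A B C1 D (mob A' B' C' D' z).
Proof.
  intros H H' Hz.
  pose proof (jfac_neq_0 _ _ _ _ z H' Hz) as N1.
  pose proof (Im_mob_pos _ _ _ _ z H' Hz) as Hw.
  pose proof (jfac_neq_0 _ _ _ _ _ H Hw) as N2.
  set (w := mob A' B' C' D' z) in *.
  assert (Ew : (w * jfac C' D' z)%C = (IZR A' * z + IZR B')%C).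
  { unfold w, mob. fold (jfac C' D' z). field. assumption. }
  unfold mob at 1. change (mob A B C1 D w) with ((IZR A * w + IZR B) / jfac C1 D w)%C.
  replace (IZR (A * A' + B * C') * z + IZR (A * B' + B * D'))%C
    with ((IZR A * w + IZR B) * jfac C' D' z)%C.
  - replace (IZR (C1 * A' + D * C') * z + IZR (C1 * B' + D * D'))%C
      with (jfac C1 D w * jfac C' D' z)%C.
    + field. split; assumption.
    + unfold jfac at 1.
      transitivity (IZR C1 * (w * jfac C' D' z) + IZR D * jfac C' D' z)%C; [ring|].
      rewrite Ew. unfold jfac. rewrite !plus_IZR, !mult_IZR, !RtoC_plus, !RtoC_mult. ring.
  - transitivity (IZR A * (w * jfac C' D' z) + IZR B * jfac C' D' z)%C; [ring|].
    rewrite Ew. unfold jfac. rewrite !plus_IZR, !mult_IZR, !RtoC_plus, !RtoC_mult. ring.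
Qed.

Lemma in_Gamma1_mul (N A B C1 D A' B' C' D' : Z) : (1 < N)%Z ->
  in_Gamma1 N A B C1 D -> in_Gamma1 N A' B' C' D' ->
  in_Gamma1 N (A * A' + B * C') (A * B' + B * D') (C1 * A' + D * C') (C1 * B' + D * D').
Proof.
  intros HN H H'.
  apply in_Gamma1_forms in H; [|assumption]. apply in_Gamma1_forms in H'; [|assumption].
  destruct H as [a [c [d [-> [-> [-> H]]]]]]. destruct H' as [a' [c' [d' [-> [-> [-> H']]]]]].
  split; [|split; [|split]].
  - transitivity (((1 + N * a) * (1 + N * d) - B * (N * c)) *
                  ((1 + N * a') * (1 + N * d') - B' * (N * c')))%Z; [ring|].
    rewrite H, H'. reflexivity.
  - exists (c * (1 + N * a') + (1 + N * d) * c')%Z. ring.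
  - replace ((1 + N * a) * (1 + N * a') + B * (N * c'))%Z
      with (1 + (a + a' + N * a * a' + B * c') * N)%Z by ring. apply Z_mod_plus_full.
  - replace (N * c * B' + (1 + N * d) * (1 + N * d'))%Z
      with (1 + (c * B' + d + d' + N * d * d') * N)%Z by ring. apply Z_mod_plus_full.
Qed.

(** With base point [g' i] for the first cocycle and [i] for the second, the middle terms cancel. *)
Lemma cocycle_mul (a : nat -> C) (p m : nat) (N A B C1 D A' B' C' D' : Z) (X Y : C) :
  (1 < N)%Z -> poly_growth p a -> weight_invariant a (m + 2) N ->
  in_Gamma1 N A B C1 D -> in_Gamma1 N A' B' C' D' ->
  cocycle a m (A * A' + B * C') (A * B' + B * D') (C1 * A' + D * C') (C1 * B' + D * D') X Y
  = (cocycle a m A B C1 D X Y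
     + cocycle a m A' B' C' D' (IZR A * X + IZR C1 * Y) (IZR B * X + IZR D * Y))%C.
Proof.
  intros HN Ha Hinv H H'.
  assert (Pi : 0 < Im Ci) by (simpl; lra).
  pose proof (Im_mob_pos _ _ _ _ Ci (proj1 H') Pi) as Hw.
  rewrite <- (cocycle_const a p m N A B C1 D X Y _ Ha Hinv H Hw).
  unfold cocycle. rewrite mob_comp by (try apply H; try apply H'; assumption).
  replace (IZR (A * A' + B * C') * X + IZR (C1 * A' + D * C') * Y)%C with
    (IZR A' * (IZR A * X + IZR C1 * Y) + IZR C' * (IZR B * X + IZR D * Y))%C.
  2:{ rewrite !plus_IZR, !mult_IZR, !RtoC_plus, !RtoC_mult. ring. }
  replace (IZR (A * B' + B * D') * X + IZR (C1 * B' + D * D') * Y)%C with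
    (IZR B' * (IZR A * X + IZR C1 * Y) + IZR D' * (IZR B * X + IZR D * Y))%C.
  2:{ rewrite !plus_IZR, !mult_IZR, !RtoC_plus, !RtoC_mult. ring. }
  ring.
Qed.

Lemma cocycle_homogeneous (a : nat -> C) (m : nat) (A B C1 D : Z) (t X Y : C) :
  cocycle a m A B C1 D (t * X) (t * Y) = (t ^ m * cocycle a m A B C1 D X Y)%C.
Proof.
  unfold cocycle.
  replace (IZR A * (t * X) + IZR C1 * (t * Y))%C with (t * (IZR A * X + IZR C1 * Y))%C by ring.
  replace (IZR B * (t * X) + IZR D * (t * Y))%C with (t * (IZR B * X + IZR D * Y))%C by ring.
  rewrite !eich_homogeneous. ring.
Qed.

(** A matrix fixing [oo] preserves the imaginary part, so both terms tend to 0 as [w = i y] rises.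
    This matches the value 0 of [Shat] at [oo]. *)
Lemma cocycle_parabolic (a : nat -> C) (p m : nat) (N A B D : Z) (Y : C) :
  poly_growth p a -> weight_invariant a (m + 2) N -> in_Gamma1 N A B 0 D ->
  cocycle a m A B 0 D 0 Y = 0.
Proof.
  intros Ha Hinv HG.
  assert (HD : (D * D = 1)%Z).
  { destruct HG as [Hdet _]. rewrite Z.mul_0_r, Z.sub_0_r in Hdet.
    destruct (Z.eq_mul_1 A D Hdet); subst; lia. }
  set (a1 := qint a 1).
  destruct (qser_decay a1 p (p + 2) (qint_growth a p 1 Ha) (le_n _)) as [M [HM Hdec]].
  set (W := Cmod (Y ^ m) * M + Cmod ((IZR D * Y) ^ m) * M).
  assert (PW : 0 <= W).
  { unfold W. apply Rplus_le_le_0_compat; apply Rmult_le_pos; try assumption; apply Cmod_ge_0. }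
  set (kap := cocycle a m A B 0 D 0 Y).
  assert (Hk : forall y, 1 <= y -> Cmod kap * y <= W).
  { intros y Hy. set (w := (RtoC y * Ci)%C).
    assert (Iw : Im w = y) by (unfold w; rewrite Im_scal; simpl; ring).
    assert (Hw : 0 < Im w) by lra.
    unfold kap. rewrite <- (cocycle_const a p m N A B 0 D 0 Y w Ha Hinv HG Hw).
    replace (IZR A * 0 + IZR 0 * Y)%C with (RtoC 0) by ring.
    replace (IZR B * 0 + IZR D * Y)%C with (IZR D * Y)%C by ring.
    rewrite !eich_0_l. fold a1.
    assert (Igw : Im (mob A B 0 D w) = y).
    { rewrite Im_mob; [|apply HG | assumption]. rewrite Iw. unfold jfac.
      replace (IZR 0 * w + IZR D)%C with (RtoC (IZR D)) by ring.
      rewrite Cmod_R, pow2_abs. replace (IZR D ^ 2) with (IZR (D * D)) by (rewrite mult_IZR; ring).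
      rewrite HD. field. }
    assert (T : forall u, Im u = y -> Cmod (qser a1 u) * y <= M).
    { intros u Hu. assert (Hu0 : 0 < Im u) by lra. specialize (Hdec u Hu0). rewrite Hu in Hdec.
      eapply Rle_trans; [|exact Hdec]. apply Rmult_le_compat_l; [apply Cmod_ge_0|].
      rewrite <- (pow_1 y) at 1. apply Rle_pow; [assumption | lia]. }
    pose proof (T _ Iw) as T1. pose proof (T _ Igw) as T2.
    apply Rle_trans with ((Cmod (Y ^ m) * Cmod (qser a1 (mob A B 0 D w)) +
        Cmod ((IZR D * Y) ^ m) * Cmod (qser a1 w)) * y).
    - apply Rmult_le_compat_r; [lra|]. eapply Rle_trans; [apply Cmod_triangle|].
      rewrite Cmod_opp, (Cmod_mult (Y ^ m)), (Cmod_mult ((IZR D * Y) ^ m)). lra.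
    - rewrite Rmult_plus_distr_r, !Rmult_assoc. unfold W.
      apply Rplus_le_compat; apply Rmult_le_compat_l; try assumption; apply Cmod_ge_0. }
  apply NNPP. intros Hn. apply Cmod_gt_0 in Hn.
  specialize (Hk (1 + W / Cmod kap)).
  assert (0 <= W / Cmod kap) by (apply Rmult_le_pos; [assumption | left; now apply Rinv_0_lt_compat]).
  specialize (Hk ltac:(lra)).
  replace (Cmod kap * (1 + W / Cmod kap)) with (Cmod kap + W) in Hk by (field; lra). lra.
Qed.

(** * Integrals up to a cusp *)

(** Fundamental theorem of calculus on the open half-line: the primitive tends to [l] at 0 and to 0
    at infinity. *)
Lemma RInt_gen_primitive (Psi f : R -> C) (l : C) :
  (forall t, 0 < t -> @is_derive R_AbsRing C_R_NormedModule Psi t (f t)) ->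
  (forall t, 0 < t -> @continuous R_UniformSpace C_R_NormedModule f t) ->
  (forall eps, 0 < eps -> exists delta, 0 < delta /\
     forall t, 0 < t < delta -> Cmod (Psi t - l) < eps) ->
  (forall eps, 0 < eps -> exists B, forall t, B < t -> Cmod (Psi t) < eps) ->
  @RInt_gen C_R_CompleteNormedModule f (at_right 0) (Rbar_locally p_infty) = (- l)%C.
Proof.
  intros HD HC H0 Hinf.
  apply (@is_RInt_gen_unique C_R_CompleteNormedModule);
    [apply Proper_StrongProper; typeclasses eauto
    |apply Proper_StrongProper; typeclasses eauto |].
  intros P HP.
  change (@locally C_R_NormedModule (- l)%C P) in HP.
  apply (locally_norm_le_locally (V := C_R_NormedModule)) in HP.
  destruct HP as [eps HP].
  destruct (H0 (eps / 2)) as [delta [Hdelta Hl]]; [pose proof (cond_pos eps); lra|].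
  destruct (Hinf (eps / 2)) as [B HB]; [pose proof (cond_pos eps); lra|].
  apply Filter_prod with (fun t => 0 < t < delta) (fun t => Rmax 0 B < t).
  - exists (mkposreal delta Hdelta). intros y Hy Hy0. split; [assumption|].
    change (Rabs (y - 0) < delta) in Hy. rewrite Rminus_0_r in Hy.
    apply Rabs_def2 in Hy. lra.
  - exists (Rmax 0 B). auto.
  - intros t0 t1 [Ht0 Ht0'] Ht1. cbn [fst snd].
    pose proof (Rmax_l 0 B). pose proof (Rmax_r 0 B).
    exists (Cminus (Psi t1) (Psi t0)). split.
    + apply (@is_RInt_derive C_R_CompleteNormedModule).
      * intros t Ht. apply HD. apply Rlt_le_trans with (2 := proj1 Ht).
        apply Rmin_glb_lt; lra.
      * intros t Ht. apply HC. apply Rlt_le_trans with (2 := proj1 Ht).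
        apply Rmin_glb_lt; lra.
    + apply HP. unfold ball_norm. rewrite C_R_norm.
      change (Cmod (Cminus (Cminus (Psi t1) (Psi t0)) (- l)%C) < eps).
      replace (Psi t1 - Psi t0 - - l)%C with (Psi t1 - (Psi t0 - l))%C by ring.
      eapply Rle_lt_trans; [apply Cmod_triangle|]. rewrite Cmod_opp.
      specialize (Hl t0 (conj Ht0 Ht0')). specialize (HB t1 ltac:(lra)). lra.
Qed.

(** On the vertical line over [x] the form [z - x] equals [i t], and the decay of the series
    outweighs any power of [t]. *)
Lemma eich_vertical_decay (a : nat -> C) (p m : nat) (x : R) :
  poly_growth p a -> forall j, exists M, 0 <= M /\ forall t, 1 <= t ->
    Cmod (eich a 1 (RtoC (- x)) m j (x + Ci * t)) * t <= M.
Proof.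
  intros Ha.
  assert (Q : forall n j, exists M, 0 <= M /\ forall t, 1 <= t ->
     Cmod (qser (qint a j) (x + Ci * t)) * t ^ n <= M).
  { intros n j.
    destruct (qser_decay (qint a j) p (p + 2 + n) (qint_growth a p j Ha) ltac:(lia)) as [M [HM H]].
    exists M. split; [assumption|]. intros t Ht.
    assert (It : Im (x + Ci * t) = t) by (unfold Im; simpl; ring).
    specialize (H (x + Ci * t)%C). rewrite It in H. specialize (H ltac:(lra)).
    eapply Rle_trans; [|exact H]. apply Rmult_le_compat_l; [apply Cmod_ge_0|].
    apply Rle_pow; [assumption | lia]. }
  induction m as [|m IH]; intros j.
  - destruct (Q 1%nat (S j)) as [M [HM H]]. exists M. split; [assumption|].
    intros t Ht. specialize (H t Ht). now rewrite pow_1 in H.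
  - destruct (Q (S (S m)) (S j)) as [M [HM H]].
    destruct (IH (S j)) as [M' [HM' H']].
    exists (M + INR (S m) * M'). pose proof (pos_INR (S m)) as Pm.
    split; [pose proof (Rmult_le_pos _ _ Pm HM'); lra|].
    intros t Ht. specialize (H t Ht). specialize (H' t Ht). cbn [eich].
    replace (1 * (x + Ci * t) + RtoC (- x))%C with (Ci * t)%C
      by (rewrite RtoC_opp; ring).
    apply Rle_trans with ((Cmod ((Ci * t) ^ S m * qser (qint a (S j)) (x + Ci * t)) +
      Cmod (INR (S m) * 1 * eich a 1 (RtoC (- x)) m (S j) (x + Ci * t))) * t).
    + apply Rmult_le_compat_r; [lra|]. eapply Rle_trans; [apply Cmod_triangle|].
      rewrite Cmod_opp. lra.
    + rewrite !Cmod_mult, Cmod_pow, Cmod_mult, Cmod_Ci, Cmod_1, !Cmod_R.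
      rewrite (Rabs_pos_eq t), (Rabs_pos_eq (INR (S m))), Rmult_1_l, Rmult_1_r by lra.
      rewrite Rmult_plus_distr_r. apply Rplus_le_compat.
      * replace (t ^ S m * Cmod (qser (qint a (S j)) (x + Ci * t)) * t) with
          (Cmod (qser (qint a (S j)) (x + Ci * t)) * t ^ S (S m)) by (simpl; ring). assumption.
      * rewrite Rmult_assoc. now apply Rmult_le_compat_l.
Qed.

(** For [z = x + i t] and [w = s^(-1) z], independence of the base point writes the difference as
    [eich] at [w] for the form [(1, -x) s], whose first component is 0. As [Im w = 1 / (C1^2 t)]
    tends to infinity, this decays. *)
Lemma eich_cusp_limit (a : nat -> C) (p m : nat) (N A B C1 D : Z) (x : R) :
  poly_growth p a -> weight_invariant a (m + 2) N -> in_Gamma1 N A B C1 D ->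
  C1 <> 0%Z -> x = IZR A / IZR C1 ->
  exists M, 0 <= M /\ forall t, 0 < t <= 1 ->
    Cmod (eich a 1 (RtoC (- x)) m 0 (x + Ci * t) - cocycle a m A B C1 D 1 (RtoC (- x))) <= M * t.
Proof.
  intros Ha Hinv HG HC Hx. pose proof (proj1 HG) as Hdet.
  assert (NC : IZR C1 <> 0) by now apply not_0_IZR.
  assert (PC : 0 < IZR C1 ^ 2) by (rewrite <- Rsqr_pow2; now apply Rsqr_pos_lt).
  destruct (qser_decay (qint a 1) p (p + 2) (qint_growth a p 1 Ha) (le_n _)) as [M [HM Hdec]].
  set (Y := (IZR B * 1 + IZR D * RtoC (- x))%C).
  exists (Cmod (Y ^ m) * (M * (IZR C1 ^ 2) ^ (p + 2))). split.
  { repeat apply Rmult_le_pos; try assumption; [apply Cmod_ge_0 | apply pow_le; lra]. }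
  intros t Ht. set (z := (x + Ci * t)%C).
  assert (Iz : Im z = t) by (unfold z, Im; simpl; ring).
  assert (Hz : 0 < Im z) by lra.
  assert (Hdet' : (D * A - (- B) * (- C1) = 1)%Z) by lia.
  set (w := mob D (- B) (- C1) A z).
  assert (Hw : 0 < Im w) by now apply Im_mob_pos.
  assert (Egw : mob A B C1 D w = z).
  { unfold w. rewrite <- mob_comp by assumption.
    replace (A * D + B * - C1)%Z with 1%Z by lia.
    replace (A * - B + B * A)%Z with 0%Z by lia.
    replace (C1 * D + D * - C1)%Z with 0%Z by lia.
    replace (C1 * - B + D * A)%Z with 1%Z by lia.
    unfold mob. replace (IZR 0 * z + IZR 1)%C with (RtoC 1) by ring.
    replace (IZR 1 * z + IZR 0)%C with z by ring. field. }
  assert (Iw : Im w * (IZR C1 ^ 2 * t) = 1).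
  { unfold w. rewrite Im_mob by assumption. rewrite Iz. unfold jfac.
    replace (IZR (- C1) * z + IZR A)%C with (RtoC (- IZR C1) * (Ci * t))%C.
    - rewrite !Cmod_mult, Cmod_Ci, !Cmod_R, Rabs_Ropp, (Rabs_pos_eq t) by lra.
      rewrite Rmult_1_l, Rpow_mult_distr, pow2_abs. field. split; lra.
    - unfold z. rewrite Hx, opp_IZR, RtoC_opp, RtoC_div by assumption. field.
      intros E. apply RtoC_inj in E. contradiction. }
  rewrite <- (cocycle_const a p m N A B C1 D 1 (RtoC (- x)) w Ha Hinv HG Hw), Egw.
  fold Y.
  replace (IZR A * 1 + IZR C1 * RtoC (- x))%C with (RtoC 0).
  2:{ rewrite Hx, <- RtoC_mult, <- RtoC_mult, <- RtoC_plus. f_equal. field. assumption. }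
  rewrite eich_0_l.
  replace (_ - (_ - _))%C with (Y ^ m * qser (qint a 1) w)%C by ring.
  rewrite Cmod_mult, !Rmult_assoc. apply Rmult_le_compat_l; [apply Cmod_ge_0|].
  specialize (Hdec w Hw). set (q := Cmod (qser (qint a 1) w)) in *.
  replace q with ((q * Im w ^ (p + 2)) * (IZR C1 ^ 2 * t) ^ (p + 2)).
  2:{ rewrite Rmult_assoc, <- Rpow_mult_distr, Iw, pow1. ring. }
  apply Rmult_le_compat; try assumption.
  - apply Rmult_le_pos; [apply Cmod_ge_0 | apply pow_le; lra].
  - apply pow_le. apply Rmult_le_pos; lra.
  - rewrite Rpow_mult_distr. apply Rmult_le_compat_l; [apply pow_le; lra|].
    replace (p + 2)%nat with (S (p + 1)) by lia. simpl. rewrite <- (Rmult_1_r t) at 3.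
    apply Rmult_le_compat_l; [lra|].
    rewrite <- (pow1 (p + 1)). apply pow_incr. lra.
Qed.

Lemma pow_n_Cpow (x : C) (n : nat) : pow_n x n = (x ^ n)%C.
Proof.
  induction n as [|n IH]; [reflexivity|]. rewrite Cpow_S, <- IH. reflexivity.
Qed.

Lemma int_from_infty_cusp (chi1 chi2 : Z -> C) (p m : nat) (N A B C1 D : Z) (x : R) :
  poly_growth p (fun n => eis_coeff chi1 chi2 (m + 2) (S n)) ->
  weight_invariant (fun n => eis_coeff chi1 chi2 (m + 2) (S n)) (m + 2) N ->
  in_Gamma1 N A B C1 D -> C1 <> 0%Z -> x = IZR A / IZR C1 ->
  int_from_infty (fun z => Cmult (eisenstein chi1 chi2 (m + 2) z)
                                 (Ppoly (m + 2) z (RtoC 1) (RtoC (- x)))) x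
  = (2 * cocycle (fun n => eis_coeff chi1 chi2 (m + 2) (S n)) m A B C1 D 1 (RtoC (- x)))%C.
Proof.
  set (a := fun n => eis_coeff chi1 chi2 (m + 2) (S n)).
  intros Ha Hinv HG HC Hx.
  set (L := cocycle a m A B C1 D 1 (RtoC (- x))).
  set (f := fun z => (2 * qser a z * (1 * z + RtoC (- x)) ^ m)%C).
  assert (It : forall t : R, Im (x + t * Ci) = t) by (intros; unfold Im; simpl; ring).
  unfold int_from_infty.
  (* Along the ray the derivative of [eich] carries a factor [i], and [-2 i] times [i] is the factor
     2 of the Eisenstein series. *)
  rewrite (RInt_gen_primitive (fun t : R => (-2 * Ci) * eich a 1 (RtoC (- x)) m 0 (x + Ci * t))%C
     _ (-2 * Ci * L)%C).
  - transitivity (2 * L * (- (Ci * Ci)))%C; [ring|].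
    replace (Ci * Ci)%C with (RtoC (-1)).
    + replace (- RtoC (-1))%C with (RtoC 1) by (rewrite <- RtoC_opp; f_equal; lra). ring.
    + unfold Ci, RtoC, Cmult; simpl. f_equal; ring.
  - intros t Ht.
    pose proof (cder_is_derive (fun z => (-2 * Ci) * eich a 1 (RtoC (- x)) m 0 z)%C x Ci _ t
       (cder_scal (-2 * Ci) _ _ _ (eich_cder a p 1 (RtoC (- x)) (x + t * Ci) m Ha
          ltac:(rewrite It; assumption) 0))) as H.
    apply (is_derive_ext _ (fun t : R => (-2 * Ci) * eich a 1 (RtoC (- x)) m 0 (x + Ci * t))%C) in H.
    2:{ intros s. replace (x + s * Ci)%C with (x + Ci * s)%C by ring. reflexivity. }
    unfold Ppoly. rewrite pow_n_Cpow. replace (m + 2 - 2)%nat with m by lia.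
    change (eisenstein chi1 chi2 (m + 2) (x + Ci * t)%C) with (2 * qser a (x + Ci * t))%C.
    rewrite (qser_qint_0 a p) in H by (try rewrite It; assumption).
    replace (x + Ci * t)%C with (x + t * Ci)%C by ring.
    replace (2 * qser a (x + t * Ci) * (1 * (x + t * Ci) + RtoC (- x)) ^ m)%C with
     (Ci * (-2 * Ci * ((1 * (x + t * Ci) + RtoC (- x)) ^ m * qser a (x + t * Ci))))%C; [exact H|].
    transitivity ((-2 * (Ci * Ci)) * qser a (x + t * Ci) * (1 * (x + t * Ci) + RtoC (- x)) ^ m)%C; [ring|].
    do 2 f_equal. unfold Ci, RtoC, Cmult; simpl. f_equal; ring.
  - intros t Ht.
    assert (HF : exists F, cder f (x + t * Ci)%C F).
    { assert (HP : exists P, cder (fun z => (1 * z + RtoC (- x)) ^ m)%C (x + t * Ci)%C P).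
      { destruct m as [|m']; [exists (RtoC 0); apply (cder_const 1) | eexists; apply cder_affine_pow]. }
      destruct HP as [P HP]. eexists. apply cder_mult; [|exact HP].
      apply cder_scal. apply qser_cder with p; [assumption|]. now rewrite It. }
    destruct HF as [F HF]. apply cder_is_derive in HF.
    apply (continuous_ext (fun s : R => f (x + s * Ci)%C)).
    + intros s. unfold Ppoly. rewrite pow_n_Cpow. replace (m + 2 - 2)%nat with m by lia. unfold f.
      replace (x + s * Ci)%C with (x + Ci * s)%C by ring. reflexivity.
    + apply (ex_derive_continuous (V := C_R_NormedModule)). eexists. exact HF.
  - destruct (eich_cusp_limit a p m N A B C1 D x Ha Hinv HG HC Hx) as [M [HM H]].
    intros eps He. exists (Rmin 1 (eps / (2 * M + 1))). split.
    + apply Rmin_glb_lt; [lra|]. apply Rdiv_lt_0_compat; lra.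
    + intros t [Ht0 Ht]. pose proof (Rmin_l 1 (eps / (2 * M + 1))). pose proof (Rmin_r 1 (eps / (2 * M + 1))).
      specialize (H t ltac:(lra)).
      replace (_ - _)%C with (-2 * Ci * (eich a 1 (RtoC (- x)) m 0 (x + Ci * t) - L))%C by ring.
      rewrite !Cmod_mult, Cmod_Ci, Cmod_R, Rabs_left by lra. fold L in H.
      apply Rle_lt_trans with (2 * M * t); [lra|].
      apply Rle_lt_trans with (2 * M * (eps / (2 * M + 1))); [apply Rmult_le_compat_l; lra|].
      apply Rmult_lt_reg_r with (2 * M + 1); [lra|].
      replace (2 * M * (eps / (2 * M + 1)) * (2 * M + 1)) with (2 * M * eps) by (field; lra). nra.
  - destruct (eich_vertical_decay a p m x Ha 0) as [M [HM H]].
    intros eps He. exists (Rmax 1 (2 * M / eps)). intros t Ht.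
    pose proof (Rmax_l 1 (2 * M / eps)). pose proof (Rmax_r 1 (2 * M / eps)).
    specialize (H t ltac:(lra)).
    rewrite !Cmod_mult, Cmod_Ci, Cmod_R, Rabs_left by lra.
    apply Rmult_lt_reg_r with t; [lra|].
    assert (2 * M < eps * t).
    { replace (2 * M) with (eps * (2 * M / eps)) by (field; lra). apply Rmult_lt_compat_l; lra. }
    lra.
Qed.

(** * Parity of the characters and weight of the Eisenstein series *)

(** Modulo 1 every value equals [chi 1 = 1]. *)
Lemma char_conductor_gt_1 (q : Z) (chi : Z -> C) :
  is_dirichlet_char q chi -> nontrivial_char q chi -> (1 < q)%Z.
Proof.
  intros [Hq [Hper [_ [H1 _]]]] [n [_ Hn]].
  destruct (Z.eq_dec q 1) as [->|]; [|lia].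
  exfalso. apply Hn. rewrite <- H1. replace n with (1 + 1 * (n - 1))%Z by lia.
  now apply periodic_mul.
Qed.

Lemma char_at_0 (q : Z) (chi : Z -> C) : (1 < q)%Z -> is_dirichlet_char q chi -> chi 0%Z = 0.
Proof.
  intros Hq [_ [_ [_ [_ H0]]]]. apply H0. rewrite Z.gcd_0_l. lia.
Qed.

Lemma char_opp (q : Z) (chi : Z -> C) (n : Z) :
  is_dirichlet_char q chi -> chi (- n)%Z = (chi (-1)%Z * chi n)%C.
Proof.
  intros [_ [_ [Hm _]]]. rewrite <- Hm. reflexivity.
Qed.

Lemma char_neg_1 (q : Z) (chi : Z -> C) :
  is_dirichlet_char q chi -> chi (-1)%Z = 1 \/ chi (-1)%Z = -1.
Proof.
  intros [_ [_ [Hm [H1 _]]]].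
  assert (E : (chi (-1)%Z * chi (-1)%Z)%C = 1) by (rewrite <- Hm; exact H1).
  set (u := chi (-1)%Z) in *.
  destruct (classic (u = 1)) as [|N]; [now left|]. right.
  assert (N' : (u - 1)%C <> 0).
  { intros E'. apply N. replace u with ((u - 1) + 1)%C by ring. rewrite E'. ring. }
  apply (Cmult_reg_r (u - 1)); [assumption|].
  transitivity (u * u - u)%C; [ring | rewrite E; ring].
Qed.

(** At both points the series is the same multiple [kappa] of a lattice sum, so modularity passes
    over. The parity condition carries over to the conjugate because [chi2 (-1)] is 1 or -1, hence
    real. *)
Lemma eis_weight_invariant (k : nat) (q1 q2 : Z) (chi1 chi2 : Z -> C) :
  (2 <= k)%nat -> is_dirichlet_char q1 chi1 -> nontrivial_char q1 chi1 ->
  is_dirichlet_char q2 chi2 -> nontrivial_char q2 chi2 ->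
  Cmult (chi1 (-1)%Z) (chi2 (-1)%Z) = pow_n (RtoC (-1)) k ->
  weight_invariant (fun n => eis_coeff chi1 chi2 k (S n)) k (q1 * q2).
Proof.
  intros Hk D1 T1 D2 T2 Hpar.
  pose proof (char_conductor_gt_1 _ _ D1 T1) as H1.
  pose proof (char_conductor_gt_1 _ _ D2 T2) as H2.
  pose proof (char_at_0 _ _ H1 D1) as Z1. pose proof (char_at_0 _ _ H2 D2) as Z2.
  rewrite pow_n_Cpow in Hpar.
  destruct (eis_qser_lattice q1 q2 chi1 chi2 (chi1 (-1)%Z) (Cconj (chi2 (-1)%Z)) k
     H1 H2 Hk (proj1 (proj2 D1)) (proj1 (proj2 D2)) Z1) as [kappa Hkap].
  - intros n. now apply char_opp with q1.
  - intros n. rewrite (char_opp q2 chi2 n D2). now rewrite Cmult_conj.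
  - assert (Ec : Cconj (chi2 (-1)%Z) = chi2 (-1)%Z).
    { destruct (char_neg_1 _ _ D2) as [->| ->]; unfold Cconj, RtoC; simpl; f_equal; ring. }
    rewrite Ec. transitivity ((-1) ^ k * (chi1 (-1)%Z * chi2 (-1)%Z))%C; [ring|].
    rewrite Hpar, <- Cpow_mult_l.
    replace (-1 * -1)%C with (RtoC 1) by (rewrite <- RtoC_mult; f_equal; ring). apply Cpow_1_l.
  - intros A B C1 D z HG Hz.
    destruct (latblock_has_sum q1 q2 chi1 (dft q2 (fun n => Cconj (chi2 n))) k z
       H1 ltac:(lia) Hk Hz Z1) as [T HT].
    + rewrite dft_sum; [|lia|intros; now rewrite (proj1 (proj2 D2))].
      rewrite Z2. unfold Cconj, RtoC; simpl. f_equal; ring.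
    + pose proof (latblock_modular q1 q2 _ _ k z T A B C1 D H1 H2 Hk Hz Z1 HG HT) as HT'.
      rewrite (Hkap _ _ Hz HT).
      rewrite (Hkap _ _ (Im_mob_pos _ _ _ _ z (proj1 HG) Hz) HT'). ring.
Qed.

Theorem theorem1p11 (k : nat) (q1 q2 : Z) (chi1 chi2 : Z -> C) :
  (2 <= k)%nat ->
  is_primitive_char q1 chi1 -> nontrivial_char q1 chi1 ->
  is_primitive_char q2 chi2 -> nontrivial_char q2 chi2 ->
  Cmult (chi1 (-1)%Z) (chi2 (-1)%Z) = pow_n (RtoC (-1)) k ->
  forall a b c d : Z, in_Gamma1 (q1 * q2)%Z a b c d ->
  let F := fun x : R =>
    Cminus (Shat q1 chi1 chi2 k (Some x))
           (Cmult (RtoC ((IZR c * x + IZR d) ^ (k - 2)))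
                  (Shat q1 chi1 chi2 k (moebius a b c d (Some x)))) in
  forall x0 : R, finite_cusp_Gamma1 (q1 * q2)%Z x0 ->
  forall eps : R, 0 < eps ->
  exists delta : R, 0 < delta /\
    forall x : R, finite_cusp_Gamma1 (q1 * q2)%Z x ->
      Rabs (x - x0) < delta -> Cmod (Cminus (F x) (F x0)) < eps.
Proof.
  intros Hk [D1 _] T1 [D2 _] T2 Hpar a b c d HG F x0 Hx0 eps Heps.
  pose proof (eis_weight_invariant k q1 q2 chi1 chi2 Hk D1 T1 D2 T2 Hpar) as Hinv.
  pose proof (char_conductor_gt_1 _ _ D1 T1) as H1.
  pose proof (char_conductor_gt_1 _ _ D2 T2) as H2.
  assert (Ek : k = (k - 2 + 2)%nat) by lia.
  assert (Ha : poly_growth (S (k - 1)) (fun n => eis_coeff chi1 chi2 k (S n))).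
  { apply eis_coeff_growth with q1 q2; try lia; [apply D1 | apply D2]. }
  set (m := (k - 2)%nat) in *.
  set (co := fun n => eis_coeff chi1 chi2 k (S n)) in *.
  set (p := S (k - 1)) in *.
  set (N := (q1 * q2)%Z) in *.
  assert (HN : (1 < N)%Z) by (unfold N; nia).
  (* The constants of [Shat], together with the factor 2 between the integral and the cocycle. *)
  set (C0 := (pow_n (RtoC (-1)) k * gauss_sum q1 (fun n => Cconj (chi1 n)) *
              (RtoC (INR (k - 1)) * 2))%C).
  assert (Hinv' : weight_invariant co (m + 2) N) by (rewrite <- Ek; exact Hinv).
  assert (HL : forall A B C1 D x, in_Gamma1 N A B C1 D -> C1 <> 0%Z -> x = IZR A / IZR C1 ->
     Shat q1 chi1 chi2 k (Some x) = (C0 * cocycle co m A B C1 D 1 (RtoC (- x)))%C).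
  { intros A B C1 D x HG' HC Hx. unfold Shat.
    pose proof (int_from_infty_cusp chi1 chi2 p m N A B C1 D x) as HI.
    rewrite <- Ek in HI. fold co in HI. rewrite (HI Ha Hinv HG' HC Hx).
    unfold C0. ring. }
  (* The form is chosen so that the given matrix, of determinant 1, sends it to [(1, -x)]; it is
     [(1, -x)] acted on by the inverse matrix. *)
  set (K := fun x : R => cocycle co m a b c d (RtoC (IZR c * x + IZR d)) (RtoC (- (IZR a * x + IZR b)))).
  assert (HF : forall x, finite_cusp_Gamma1 N x -> F x = (- C0 * K x)%C).
  { intros x [A [B [C1 [D [HS Hx]]]]].
    unfold moebius in Hx. destruct (Z.eqb_spec C1 0) as [|HC]; [discriminate|].
    injection Hx as Hx.
    assert (NC : IZR C1 <> 0) by now apply not_0_IZR.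
    assert (HRx : IZR C1 * x = IZR A) by (rewrite <- Hx; field; assumption).
    unfold F. rewrite (HL A B C1 D x HS HC (eq_sym Hx)).
    pose proof (in_Gamma1_mul N a b c d A B C1 D HN HG HS) as HGS.
    pose proof (cocycle_mul co p m N a b c d A B C1 D (RtoC (IZR c * x + IZR d))
       (RtoC (- (IZR a * x + IZR b))) HN Ha Hinv' HG HS) as HM.
    assert (HR : IZR a * IZR d - IZR b * IZR c = 1).
    { rewrite <- !mult_IZR, <- minus_IZR. now rewrite (proj1 HG). }
    replace (IZR a * RtoC (IZR c * x + IZR d) + IZR c * RtoC (- (IZR a * x + IZR b)))%C
      with (RtoC 1) in HM.
    2:{ rewrite <- !RtoC_mult, <- RtoC_plus. f_equal. lra. }
    replace (IZR b * RtoC (IZR c * x + IZR d) + IZR d * RtoC (- (IZR a * x + IZR b)))%C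
      with (RtoC (- x)) in HM.
    2:{ rewrite <- !RtoC_mult, <- RtoC_plus. f_equal.
        transitivity (- ((IZR a * IZR d - IZR b * IZR c) * x)); [rewrite HR|]; ring. }
    fold (K x) in HM.
    assert (EC : IZR (c * A + d * C1) = IZR C1 * (IZR c * x + IZR d)).
    { rewrite plus_IZR, !mult_IZR, <- HRx. ring. }
    assert (EA : IZR (a * A + b * C1) = IZR C1 * (IZR a * x + IZR b)).
    { rewrite plus_IZR, !mult_IZR, <- HRx. ring. }
    assert (HShat : (RtoC ((IZR c * x + IZR d) ^ m) * Shat q1 chi1 chi2 k (moebius a b c d (Some x)))%C
       = (C0 * (K x + cocycle co m A B C1 D 1 (RtoC (- x))))%C).
    { rewrite <- HM. unfold moebius. destruct (Req_EM_T (IZR c * x + IZR d) 0) as [E|E].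
      (* Here [g x = oo]: the product [g s] fixes [oo] and its cocycle at [X = 0] vanishes, in
         agreement with [Shat oo = 0]. For [k = 2] the power is [0^0 = 1], and the zero comes from
         [Shat]. *)
      - rewrite E in *. rewrite Rmult_0_r in EC. apply eq_IZR in EC. rewrite EC in *.
        rewrite (cocycle_parabolic co p m N) by assumption. simpl. ring.
      (* The form [(c x + d, -(a x + b))] is [c x + d] times [(1, -y)]; homogeneity of degree
         [k - 2] accounts for the automorphy factor. *)
      - set (y := (IZR a * x + IZR b) / (IZR c * x + IZR d)).
        rewrite (HL _ _ _ _ y HGS).
        + replace (RtoC (- (IZR a * x + IZR b))) with (RtoC (IZR c * x + IZR d) * RtoC (- y))%C.
          2:{ rewrite <- RtoC_mult. f_equal. unfold y. field. assumption. }
          rewrite <- (Cmult_1_r (RtoC (IZR c * x + IZR d))) at 1.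
          rewrite cocycle_homogeneous, RtoC_pow. ring.
        + intros EZ. rewrite EZ in EC. symmetry in EC. apply Rmult_integral in EC. tauto.
        + rewrite EA, EC. unfold y. field. split; assumption. }
    rewrite HShat. ring. }
  (* The formula for [- C0 * K x] makes sense at complex [w], where differentiability at [x0] yields
     continuity. *)
  assert (HK : exists DK, cder (fun w => - C0 * cocycle co m a b c d (IZR c * w + IZR d)
       (- IZR a * w + - IZR b))%C (RtoC x0) DK).
  { destruct (cder_eich_coeffs co (IZR c) (IZR d) (- IZR a) (- IZR b) (mob a b c d Ci) x0 m 0) as [P1 HP1].
    destruct (cder_eich_coeffs co (IZR a * IZR c - IZR c * IZR a) (IZR a * IZR d - IZR c * IZR b)
       (IZR b * IZR c - IZR d * IZR a) (IZR b * IZR d - IZR d * IZR b) Ci x0 m 0) as [P2 HP2].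
    eexists. apply cder_scal. unfold cocycle. apply cder_minus; [exact HP1|].
    refine (cder_ext _ _ _ _ 1 Rlt_0_1 _ HP2). intros h _. cbv beta. f_equal; ring. }
  destruct HK as [DK HK]. destruct (cder_continuous _ _ _ eps HK Heps) as [delta [Hd Hcont]].
  exists delta. split; [assumption|]. intros x Hx Hxx.
  rewrite (HF x Hx), (HF x0 Hx0).
  specialize (Hcont (RtoC (x - x0))). rewrite Cmod_R in Hcont. specialize (Hcont Hxx).
  cbv beta in Hcont. rewrite <- RtoC_plus in Hcont.
  replace (x0 + (x - x0)) with x in Hcont by ring.
  unfold K.
  replace (RtoC (IZR c * x + IZR d)) with (IZR c * x + IZR d)%C by (now rewrite RtoC_plus, RtoC_mult).
  replace (RtoC (IZR c * x0 + IZR d)) with (IZR c * x0 + IZR d)%C by (now rewrite RtoC_plus, RtoC_mult).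
  replace (RtoC (- (IZR a * x + IZR b))) with (- IZR a * x + - IZR b)%C
    by (rewrite RtoC_opp, RtoC_plus, RtoC_mult; ring).
  replace (RtoC (- (IZR a * x0 + IZR b))) with (- IZR a * x0 + - IZR b)%C
    by (rewrite RtoC_opp, RtoC_plus, RtoC_mult; ring).
  exact Hcont.
Qed.
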